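(* Let $\gamma>0$, $n\in\mathbb{N}$, and let $K,B\subset\mathbb{R}^n$ be convex bodies symmetric with respect to the origin with $\log M(K,B)\ge\gamma n$. Then \[\log\hat{M}(K,B/\alpha)\ge \beta^{-1}\log M(K,B),\] where $\alpha\ge1$ depends only on $\gamma$ and $\beta\ge1$ is a universal constant.
   Context: Logarithms are to base 2. The packing number $M(K,B)$ is the maximal number of translates $x_i+B$ with $x_i\in K$ whose interiors are pairwise disjoint. The convex separation number is \[\hat{M}(K,B):=\sup\{N:\ \exists\, x_1,\dots,x_N\in K \text{ such that } (x_j+\mathrm{int}\,B)\cap \mathrm{conv}\{x_i: i<j\}=\emptyset \text{ for all } j\},\] where $\mathrm{int}$ denotes interior and $\mathrm{conv}$ the convex hull. *)

(* Defs.v *)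
From HB Require Import structures.
From mathcomp Require Import all_boot all_order all_algebra.
From mathcomp Require Import all_classical all_reals all_analysis.
Set Implicit Arguments. Unset Strict Implicit. Unset Printing Implicit Defensive.
Import Order.TTheory GRing.Theory Num.Theory.
Import numFieldNormedType.Exports.
Local Open Scope classical_set_scope.
Local Open Scope ring_scope.

Section Defs.
Variables (R : realType) (n : nat).
Local Notation V := 'rV[R]_n.

Definition log2 (x : R) : R := ln x / ln 2.

Definition convex_set (S : set V) : Prop :=
  forall x y (t : R), S x -> S y -> 0 <= t <= 1 -> S (t *: x + (1 - t) *: y).

Definition convex_body (S : set V) : Prop :=
  convex_set S /\ compact S /\ (interior S !=set0).

Definition origin_symmetric (S : set V) : Prop := forall x, S x -> S (- x).

Definition translate (x : V) (S : set V) : set V := [set x + s | s in S].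

(* dilate c S = { c s : s in S }; B / alpha is dilate alpha^-1 B *)
Definition dilate (c : R) (S : set V) : set V := [set c *: s | s in S].

Definition conv (S : set V) : set V :=
  [set v | exists (m : nat) (l : 'I_m -> R) (y : 'I_m -> V),
      (forall i, 0 <= l i) /\ \sum_(i < m) l i = 1 /\
      (forall i, S (y i)) /\ v = \sum_(i < m) l i *: y i].

Definition packable (K B : set V) (N : nat) : Prop :=
  exists x : 'I_N -> V, (forall i, K (x i)) /\
    forall i j, i != j ->
      interior (translate (x i) B) `&` interior (translate (x j) B) = set0.

(* packing number M(K,B) (a maximum; the set is bounded for convex bodies) *)
Definition packing_number (K B : set V) : R :=
  sup [set (N%:R : R) | N in packable K B].

Definition convex_separable (K B : set V) (N : nat) : Prop :=
  exists x : 'I_N -> V, (forall i, K (x i)) /\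
    forall j : 'I_N,
      translate (x j) (interior B) `&` conv [set x i | i in [set i : 'I_N | (i < j)%N]]
        = set0.

Definition convex_separation_number (K B : set V) : R :=
  sup [set (N%:R : R) | N in convex_separable K B].

End Defs.

(* Main.v *)
Require Import Defs.
From HB Require Import structures.
From mathcomp Require Import all_boot all_order all_algebra.
From mathcomp Require Import perm mxpoly sesquilinear spectral complex.
From mathcomp Require Import all_classical all_reals all_analysis.
From mathcomp Require Import ring lra.
Set Implicit Arguments.
Unset Strict Implicit.
Unset Printing Implicit Defensive.
Import Order.TTheory GRing.Theory Num.Theory.
Import numFieldNormedType.Exports.
Local Open Scope ring_scope.

(** Write D for the Euclidean unit ball and K°, B°, E° for polars. A lower bound for the convex
    separation number follows from points x_j in K and functionals h_j in B° with <h_j, x_j - x_i>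
    >= delta whenever i < j ([sepsys]): once alpha > 1/delta, h_j strictly separates x_j +
    int(B/alpha) from the hull of the earlier points ([sepsys_separable]). The proof produces such a
    system from a packing by passing through Hilbert space.

    Reduction to ellipsoids. By [regular_ellipsoid], for each eps there is t such that every
    symmetric body B in dimension n has an ellipsoid E for which e^(n eps) translates of tB cover E
    and as many translates of tB° cover E°. Since log M(K,B) >= gamma n, losses e^(n eps) with eps a
    small multiple of gamma are harmless. A linear map turns the ellipsoid of B into D; let E be
    that of K, so E = D Q^2 with Q symmetric ([gram_fourth_root]). In [entropy_chain], many
    B-separated points of K give many points of K separated by a multiple of D; Euclidean duality of
    entropy ([euclidean_duality]) turns them into points of D separated by a multiple of K°, then of
    E°, that is, for f -> |f Q^2|; finally [sepn_sqrt_ellipsoid] yields points b_i of D separated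
    for f -> |f Q|.

    Construction ([core_sepsys]). Take b_i as functionals and x_i = b_i Q^2 in E as points. Then
    <b_i, x_i - x_j> = <b_i Q, b_i Q - b_j Q>, which is bounded below when the lengths |b_i Q|
    nearly agree. Pigeonholing over thin shells, over the covering of E by tK and over that of D by
    tB° leaves many indices whose points lie in one translate of tK and whose functionals lie in one
    translate of tB°. Recentring is free for the points, and for the functionals it is harmless
    after sorting by their common part ([twosided_sepsys]). If some |b_i Q| is huge, equally spaced
    points on one segment suffice ([sepsys_line]).

    Regular ellipsoids come from an iteration in the style of Milman. A determinant maximiser
    ([ell_position]) and a crude K-convexity estimate ([radproj_bound]) bound Rademacher averages
    for B and B° simultaneously ([ell_dual_bound]). With the dual Sudakov inequality
    ([dual_sudakov]), replacing B by (B ∩ E1) + E2 costs little entropy and brings the body closer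
    to an ellipsoid ([truncation]): distance 16^(m+1) becomes 16^m, with errors forming a geometric
    series. *)

(** * Euclidean inner product and squared norm *)

Section Euclidean.
Variable R : realFieldType.
Implicit Types (n : nat).

Definition dot n (x y : 'rV[R]_n) : R := \sum_i x 0 i * y 0 i.
Definition nsq n (x : 'rV[R]_n) : R := \sum_i x 0 i ^+ 2.

Lemma nsqE n (x : 'rV[R]_n) : nsq x = dot x x. Proof. by []. Qed.

Lemma dotC n (x y : 'rV[R]_n) : dot x y = dot y x.
Proof. by apply: eq_bigr => i _; rewrite mulrC. Qed.

Lemma dotDl n (x y z : 'rV[R]_n) : dot (x + y) z = dot x z + dot y z.
Proof. by rewrite -big_split; apply: eq_bigr => i _; rewrite mxE mulrDl. Qed.

Lemma dotZl n c (x z : 'rV[R]_n) : dot (c *: x) z = c * dot x z.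
Proof. by rewrite mulr_sumr; apply: eq_bigr => i _; rewrite mxE mulrA. Qed.

Lemma dotNl n (x z : 'rV[R]_n) : dot (- x) z = - dot x z.
Proof. by rewrite -scaleN1r dotZl mulN1r. Qed.

Lemma dotBl n (x y z : 'rV[R]_n) : dot (x - y) z = dot x z - dot y z.
Proof. by rewrite dotDl dotNl. Qed.

Lemma dotDr n (z x y : 'rV[R]_n) : dot z (x + y) = dot z x + dot z y.
Proof. by rewrite dotC dotDl !(dotC z). Qed.

Lemma dotZr n c (z x : 'rV[R]_n) : dot z (c *: x) = c * dot z x.
Proof. by rewrite dotC dotZl (dotC z). Qed.

Lemma dotNr n (z x : 'rV[R]_n) : dot z (- x) = - dot z x.
Proof. by rewrite dotC dotNl (dotC z). Qed.

Lemma dotBr n (z x y : 'rV[R]_n) : dot z (x - y) = dot z x - dot z y.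
Proof. by rewrite dotDr dotNr. Qed.

Lemma dot0l n (x : 'rV[R]_n) : dot 0 x = 0.
Proof. by rewrite -(scale0r (0 : 'rV[R]_n)) dotZl mul0r. Qed.

Lemma dot0r n (x : 'rV[R]_n) : dot x 0 = 0.
Proof. by rewrite dotC dot0l. Qed.

Lemma dot_sumr n (J : finType) (z : 'rV[R]_n) (x : J -> 'rV[R]_n) :
  dot z (\sum_j x j) = \sum_j dot z (x j).
Proof.
apply: (big_ind2 (fun a b => dot z a = b)) => //; first exact: dot0r.
by move=> x1 x2 y1 y2 <- <-; rewrite dotDr.
Qed.

Lemma dot_mulmx m n (x : 'rV[R]_m) (A : 'M[R]_(m, n)) (y : 'rV[R]_n) :
  dot (x *m A) y = dot x (y *m A^T).
Proof.
rewrite /dot; under eq_bigr do rewrite mxE mulr_suml.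
rewrite exchange_big /=; apply: eq_bigr => j _; rewrite mxE mulr_sumr.
by apply: eq_bigr => i _; rewrite mxE; ring.
Qed.

Lemma nsq_ge0 n (x : 'rV[R]_n) : 0 <= nsq x.
Proof. by apply: sumr_ge0 => i _; exact: sqr_ge0. Qed.

Lemma nsq_eq0 n (x : 'rV[R]_n) : (nsq x == 0) = (x == 0).
Proof.
apply/eqP/eqP => [h|->]; last by rewrite nsqE dot0l.
apply/rowP => i; rewrite mxE; apply/eqP; rewrite -sqrf_eq0.
by move/psumr_eq0P: h => -> // j _; exact: sqr_ge0.
Qed.

Lemma nsq0 n : nsq (0 : 'rV[R]_n) = 0.
Proof. by apply/eqP; rewrite nsq_eq0. Qed.

Lemma nsqZ n c (x : 'rV[R]_n) : nsq (c *: x) = c ^+ 2 * nsq x.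
Proof. by rewrite !nsqE dotZl dotZr; ring. Qed.

Lemma nsqN n (x : 'rV[R]_n) : nsq (- x) = nsq x.
Proof. by rewrite -scaleN1r nsqZ sqrrN expr1n mul1r. Qed.

Lemma nsqD n (x y : 'rV[R]_n) : nsq (x + y) = nsq x + 2 * dot x y + nsq y.
Proof. by rewrite !nsqE !dotDl !dotDr (dotC y x); ring. Qed.

Lemma nsqB n (x y : 'rV[R]_n) : nsq (x - y) = nsq x - 2 * dot x y + nsq y.
Proof. by rewrite nsqD nsqN dotNr; ring. Qed.

Lemma cauchy_schwarz n (x y : 'rV[R]_n) : dot x y ^+ 2 <= nsq x * nsq y.
Proof.
have [y0|yn0] := eqVneq (nsq y) 0.
  by move/eqP: y0; rewrite nsq_eq0 => /eqP ->; rewrite dot0r nsq0 expr0n mulr0.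
have yp : 0 < nsq y by rewrite lt_neqAle eq_sym yn0 nsq_ge0.
have := nsq_ge0 (nsq y *: x - dot x y *: y).
rewrite nsqB !nsqZ dotZl dotZr => h.
rewrite -subr_ge0 -(pmulr_rge0 _ yp); apply: le_trans h _.
by rewrite le_eqVlt; apply/orP; left; apply/eqP; ring.
Qed.

Lemma dot_le n (x y : 'rV[R]_n) a b : 0 <= a -> 0 <= b ->
  nsq x <= a ^+ 2 -> nsq y <= b ^+ 2 -> dot x y <= a * b.
Proof.
move=> a0 b0 hx hy; apply: le_trans (ler_norm _) _.
rewrite -ler_sqr ?nnegrE ?mulr_ge0 // real_normK ?num_real //.
apply: le_trans (cauchy_schwarz x y) _; rewrite exprMn.
by apply: ler_pM => //; exact: nsq_ge0.
Qed.

Lemma nsqD_le n (x y : 'rV[R]_n) a b : 0 <= a -> 0 <= b ->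
  nsq x <= a ^+ 2 -> nsq y <= b ^+ 2 -> nsq (x + y) <= (a + b) ^+ 2.
Proof.
by move=> a0 b0 hx hy; rewrite nsqD; have := dot_le a0 b0 hx hy; rewrite sqrrD; lra.
Qed.

Lemma nsq_convex n (x y : 'rV[R]_n) t : 0 <= t <= 1 ->
  nsq (t *: x + (1 - t) *: y) <= t * nsq x + (1 - t) * nsq y.
Proof.
move=> /andP[t0 t1]; rewrite nsqD !nsqZ dotZl dotZr.
have := nsq_ge0 (x - y); rewrite nsqB => h.
have : 0 <= t * (1 - t) * (nsq x - 2 * dot x y + nsq y).
  by rewrite mulr_ge0 // mulr_ge0 // subr_ge0.
nra.
Qed.

End Euclidean.

Lemma sqr_le_sum2 (R : realFieldType) (a b c : R) :
  0 <= a -> a <= b + c -> a ^+ 2 <= 2 * b ^+ 2 + 2 * c ^+ 2.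
Proof.
move=> a0 h; have h2 : a ^+ 2 <= (b + c) ^+ 2.
  by rewrite ler_sqr ?nnegrE //; apply: le_trans h.
by have := sqr_ge0 (b - c); nra.
Qed.

(** * Seminorms and Jensen's inequality for their squares *)

Section Seminorm.
Variables (R : realFieldType) (V : lmodType R).

Definition seminorm (p : V -> R) : Prop :=
  (forall x y, p (x + y) <= p x + p y) /\ (forall c x, p (c *: x) = `|c| * p x).

Variable p : V -> R.
Hypothesis pP : seminorm p.

Lemma seminorm0 : p 0 = 0.
Proof. by rewrite -(scale0r (0 : V)) pP.2 normr0 mul0r. Qed.

Lemma seminormN x : p (- x) = p x.
Proof. by rewrite -scaleN1r pP.2 normrN1 mul1r. Qed.

Lemma seminorm_ge0 x : 0 <= p x.
Proof.
have := pP.1 x (- x); rewrite subrr seminorm0 seminormN => h; lra.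
Qed.

Lemma seminorm_sum (W : finType) (P : pred W) (z : W -> V) :
  p (\sum_(w | P w) z w) <= \sum_(w | P w) p (z w).
Proof.
elim/big_ind2 : _ => //; first by rewrite seminorm0.
by move=> x1 x2 y1 y2 h1 h2; apply: le_trans (pP.1 _ _) _; apply: lerD.
Qed.

(** Nonnegativity of the variance. *)
Lemma sqr_wavg_le (W : finType) (c s : W -> R) :
  (forall w, 0 <= c w) -> \sum_w c w = 1 ->
  (\sum_w c w * s w) ^+ 2 <= \sum_w c w * s w ^+ 2.
Proof.
move=> c0 c1.
have e m : \sum_w c w * (s w - m) ^+ 2 =
   \sum_w c w * s w ^+ 2 - 2 * m * (\sum_w c w * s w) + m ^+ 2 * \sum_w c w.
  rewrite !mulr_sumr -sumrB -big_split /=.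
  by apply: eq_bigr => w _; ring.
have h m : 0 <= \sum_w c w * (s w - m) ^+ 2.
  by apply: sumr_ge0 => w _; rewrite mulr_ge0 // sqr_ge0.
have := h (\sum_w c w * s w); rewrite e c1; nra.
Qed.

Lemma seminorm_jensen2 (W : finType) (c : W -> R) (z : W -> V) :
  (forall w, 0 <= c w) -> \sum_w c w = 1 ->
  p (\sum_w c w *: z w) ^+ 2 <= \sum_w c w * p (z w) ^+ 2.
Proof.
move=> c0 c1; apply: le_trans (sqr_wavg_le (fun w => p (z w)) c0 c1).
rewrite ler_sqr ?nnegrE ?seminorm_ge0 //; last first.
  by apply: sumr_ge0 => w _; rewrite mulr_ge0 // seminorm_ge0.
apply: le_trans (seminorm_sum _ _) _; apply: ler_sum => w _.
by rewrite pP.2 ger0_norm.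
Qed.

End Seminorm.

(** * Tilted product measures on the discrete cube *)

Section Cube.
Variables (R : realFieldType) (I : finType).
Local Notation cube := {ffun I -> bool}.

Definition sgn (b : bool) : R := if b then 1 else -1.

Lemma sgn_sqr b : sgn b * sgn b = 1.
Proof. by case: b; rewrite /sgn ?mulrNN mulr1. Qed.

Lemma sgn_norm b : `|sgn b| = 1.
Proof. by case: b; rewrite /sgn ?normrN normr1. Qed.

Definition cubeavg (f : cube -> R) : R := (\sum_w f w) / 2 ^+ #|I|.

(** Mass at [w] of the product measure under which the i-th sign has mean [t i]. *)
Definition bias (t : I -> R) (w : cube) : R := \prod_i ((1 + t i * sgn (w i)) / 2).

Lemma prod_sum_cube (F : I -> bool -> R) :
  \sum_(w : cube) \prod_i F i (w i) = \prod_i (F i true + F i false).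
Proof.
rewrite -(bigA_distr_bigA F) /=.
by apply: eq_bigr => i _; rewrite big_bool.
Qed.

Lemma bias_sum1 t : \sum_w bias t w = 1.
Proof.
rewrite (prod_sum_cube (fun i b => (1 + t i * sgn b) / 2)) big1 // => i _.
by rewrite /sgn; field.
Qed.

Lemma bias_ge0 t w : (forall i, `|t i| <= 1) -> 0 <= bias t w.
Proof.
move=> ht; apply: prodr_ge0 => i _; have := ht i; rewrite ler_norml => /andP[h1 h2].
rewrite /sgn; case: (w i); lra.
Qed.

Lemma bias_mean t i : \sum_w bias t w * sgn (w i) = t i.
Proof.
pose F j b := (1 + t j * sgn b) / 2 * (if j == i then sgn b else 1).
have -> : \sum_w bias t w * sgn (w i) = \sum_(w : cube) \prod_j F j (w j).
  apply: eq_bigr => w _; rewrite /F big_split /=; congr (_ * _).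
  by rewrite (bigD1 i) //= eqxx big1 ?mulr1 // => j /negbTE ->.
rewrite prod_sum_cube (bigD1 i) //= big1 ?mulr1.
  by rewrite /F eqxx /sgn; field.
by move=> j /negbTE h; rewrite /F h /sgn; field.
Qed.

(** This l2 mass controls, through Cauchy-Schwarz, how much tilted mass a set of given cardinality
    can carry. *)
Lemma bias_sqr t : \sum_w bias t w ^+ 2 = (\prod_i (1 + t i ^+ 2)) / 2 ^+ #|I|.
Proof.
have e w : bias t w ^+ 2 = \prod_i ((1 + t i * sgn (w i)) / 2) ^+ 2.
  by rewrite prodrXl.
rewrite (eq_bigr _ (fun w _ => e w)).
rewrite (prod_sum_cube (fun i b => ((1 + t i * sgn b) / 2) ^+ 2)).
rewrite -exprVn -prodr_const -big_split /=; apply: eq_bigr => i _.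
by rewrite /sgn; field.
Qed.

Lemma cube_sum_const (c : R) : \sum_(w : cube) c = 2 ^+ #|I| * c.
Proof. by rewrite sumr_const -[c *+ _]mulr_natl -natrX -card_bool -card_ffun. Qed.

Variable V : lmodType R.
Implicit Types u : I -> V.

Definition radsum u (w : cube) : V := \sum_i sgn (w i) *: u i.

Lemma bias_radsum t u : \sum_w bias t w *: radsum u w = \sum_i t i *: u i.
Proof.
under eq_bigr do rewrite scaler_sumr.
rewrite exchange_big /=; apply: eq_bigr => i _.
under eq_bigr do rewrite scalerA.
by rewrite -scaler_suml bias_mean.
Qed.

Variable p : V -> R.
Hypothesis pP : seminorm p.

(* A centred variable with values in [-2, 2] is dominated, in convex order, by
   twice a Rademacher sign: this is the kernel [bias (t w)] below. *)
Lemma tilted_second_moment (a : I -> R) u : (forall i, `|a i| <= 1) ->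
  \sum_w bias a w * p (radsum u w - \sum_i a i *: u i) ^+ 2
  <= 4 * cubeavg (fun w => p (radsum u w) ^+ 2).
Proof.
move=> ha.
pose t (w : cube) i := (sgn (w i) - a i) / 2.
have ht w i : `|t w i| <= 1.
  have := ha i; rewrite !ler_norml /t /sgn => /andP[h1 h2].
  by case: (w i); lra.
have key w : p (radsum u w - \sum_i a i *: u i) ^+ 2
   <= \sum_s bias (t w) s * (4 * p (radsum u s) ^+ 2).
  have -> : radsum u w - \sum_i a i *: u i =
     \sum_s bias (t w) s *: (2 *: radsum u s).
    under [RHS]eq_bigr do rewrite scalerA mulrC -scalerA.
    rewrite -scaler_sumr bias_radsum scaler_sumr /radsum -sumrB.
    by apply: eq_bigr => i _; rewrite scalerA -scalerBl /t mulrC divfK ?pnatr_eq0.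
  apply: le_trans (seminorm_jensen2 pP _ _ _) _.
  - by move=> s; apply: bias_ge0.
  - exact: bias_sum1.
  - rewrite le_eqVlt; apply/orP; left; apply/eqP.
    apply: eq_bigr => s _; rewrite pP.2 ger0_norm //; ring.
apply: (@le_trans _ _ (\sum_w \sum_s bias a w * bias (t w) s * (4 * p (radsum u s) ^+ 2))).
  apply: ler_sum => w _; under [leRHS]eq_bigr do rewrite -mulrA.
  by rewrite -mulr_sumr; apply: ler_wpM2l; [exact: bias_ge0 | exact: key].
rewrite exchange_big /= /cubeavg mulrA mulr_sumr mulr_suml le_eqVlt.
apply/orP; left; apply/eqP; apply: eq_bigr => s _.
rewrite -mulr_suml mulrC; congr (_ * _).
(* Under [bias a] the tilt [t w i] has mean zero, so after averaging over [w] the kernel becomes the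
   uniform law in [s]; [F] is the factor of one coordinate. *)
pose F i b := (1 + a i * sgn b) / 2 * ((1 + (sgn b - a i) / 2 * sgn (s i)) / 2).
have -> : \sum_w bias a w * bias (t w) s = \sum_(w : cube) \prod_i F i (w i).
  by apply: eq_bigr => w _; rewrite /bias -big_split.
rewrite prod_sum_cube -exprVn -prodr_const; apply: eq_bigr => i _.
by rewrite /F /sgn; field.
Qed.

(** Markov's inequality gives the ball of squared radius 16 L about the tilted mean a tilted mass of
    at least 3/4; Cauchy-Schwarz and [bias_sqr] convert this into a cardinality. It is a discrete
    counterpart of the Gaussian bound gamma(x + A) >= exp(-|x|^2/2) gamma(A) for symmetric A. *)
Lemma tilted_small_ball (a : I -> R) u (L : R) : (forall i, `|a i| <= 1) ->
  0 < L -> cubeavg (fun w => p (radsum u w) ^+ 2) <= L ->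
  9 / 16 * 2 ^+ #|I| <=
   #|[set w : cube | p (radsum u w - \sum_i a i *: u i) ^+ 2 <= 16 * L]|%:R
     * \prod_i (1 + a i ^+ 2).
Proof.
move=> ha L0 hL; set A := [set w | _].
set f := fun w : cube => p (radsum u w - \sum_i a i *: u i) ^+ 2.
have b0 w : 0 <= bias a w by exact: bias_ge0.
have hm : \sum_w bias a w * f w <= 4 * L.
  by apply: le_trans (tilted_second_moment _ ha) _; rewrite ler_pM2l.
have hc : 16 * L * \sum_(w in ~: A) bias a w <= 4 * L.
  apply: le_trans hm; rewrite mulr_sumr [leRHS](bigID (mem A)) /=.
  rewrite [X in _ <= _ + X](eq_bigl (mem (~: A))); last by move=> w; rewrite !inE.
  rewrite -[X in X <= _]add0r; apply: lerD.
    by apply: sumr_ge0 => w _; rewrite mulr_ge0 // /f sqr_ge0.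
  apply: ler_sum => w; rewrite !inE -ltNge => hw; rewrite mulrC.
  by apply: ler_wpM2l => //; apply: ltW.
have h34 : 3 / 4 <= \sum_(w in A) bias a w.
  have hs : \sum_(w in A) bias a w + \sum_(w in ~: A) bias a w = 1.
    rewrite -(bias_sum1 a) [in RHS](bigID (mem A)) /=; congr (_ + _).
    by apply: eq_bigl => w; rewrite !inE.
  have : 16 * \sum_(w in ~: A) bias a w <= 4.
    by rewrite -(ler_pM2r L0) mulrAC.
  lra.
have cs : (\sum_(w in A) bias a w) ^+ 2 <= #|A|%:R * \sum_w bias a w ^+ 2.
  set N : R := #|A|%:R.
  have e x : \sum_(w in A) (N * bias a w - x) ^+ 2 =
      N ^+ 2 * \sum_(w in A) bias a w ^+ 2 - 2 * N * x * (\sum_(w in A) bias a w)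
      + x ^+ 2 * \sum_(w in A) 1.
    by rewrite !mulr_sumr -sumrB -big_split /=; apply: eq_bigr => w _; ring.
  have hx x : 0 <= \sum_(w in A) (N * bias a w - x) ^+ 2.
    by apply: sumr_ge0 => w _; rewrite sqr_ge0.
  have := hx (\sum_(w in A) bias a w); rewrite e sumr_const -/N.
  have [N0|Nn] := eqVneq N 0.
    have A0 : A = finset.set0 by apply/eqP; rewrite -cards_eq0 -(eqr_nat R) -/N N0.
    by move=> _; rewrite N0 A0 big_set0 expr0n /= mul0r.
  have Np : 0 < N by rewrite lt_neqAle eq_sym Nn ler0n.
  move=> h.
  have : (\sum_(w in A) bias a w) ^+ 2 <= N * \sum_(w in A) bias a w ^+ 2.
    by rewrite -(ler_pM2l Np); lra.
  move=> /le_trans; apply.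
  rewrite ler_pM2l // [leRHS](bigID (mem A)) /= lerDl.
  by apply: sumr_ge0 => w _; rewrite sqr_ge0.
have h916 : 9 / 16 <= #|A|%:R * \sum_w bias a w ^+ 2.
  by apply: le_trans cs; nra.
by move: h916; rewrite bias_sqr mulrA ler_pdivlMr ?exprn_gt0.
Qed.

(** A volume argument: around the separated tilted means, the sets of [tilted_small_ball] are
    disjoint, since twice the radius 4 sqrt L has square 64 L, and together they fit into the
    cube. *)
Lemma tilted_separated_card (T : finType) (a : T -> I -> R) u (L P : R) :
  (forall t i, `|a t i| <= 1) -> 0 < L -> 0 <= P ->
  cubeavg (fun w => p (radsum u w) ^+ 2) <= L ->
  (forall t, \prod_i (1 + a t i ^+ 2) <= P) ->
  (forall t s, t != s ->
     64 * L < p (\sum_i a t i *: u i - \sum_i a s i *: u i) ^+ 2) ->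
  9 / 16 * #|T|%:R <= P.
Proof.
move=> ha L0 P0 hL hP hsep.
pose A t := [set w : cube | p (radsum u w - \sum_i a t i *: u i) ^+ 2 <= 16 * L].
have dis : (\sum_t #|A t| <= 2 ^ #|I|)%N.
  have -> : (2 ^ #|I| = #|{: cube}|)%N by rewrite card_ffun card_bool.
  have : (\sum_t #|A t| = \sum_(w : cube) #|[set t | w \in A t]|)%N.
    under eq_bigr do rewrite -sum1_card big_mkcond /=.
    rewrite exchange_big /=; apply: eq_bigr => w _.
    by rewrite -sum1_card [RHS]big_mkcond /=; apply: eq_bigr => t _; rewrite inE.
  rewrite /= => ->; rewrite -sum1_card; apply: leq_sum => w _.
  apply/card_le1P => t; rewrite inE => ht s; rewrite !inE /=.
  apply/idP/eqP => [hs|->]; last by move: ht; rewrite inE.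
  apply/eqP; case: eqP => // /eqP nts; have := hsep _ _ nts; rewrite ltNge => /negP[].
  move: ht hs; rewrite !inE => ht hs.
  set x := radsum u w in ht hs; set xs := \sum_i a s i *: u i in ht hs *.
  set xt := \sum_i a t i *: u i in ht hs *.
  have -> : xs - xt = (x - xt) - (x - xs) by rewrite opprB [RHS]addrC subrKA.
  have h1 := pP.1 (x - xt) (- (x - xs)); rewrite (seminormN pP) in h1.
  have := sqr_le_sum2 (seminorm_ge0 pP _) h1; lra.
have : \sum_(t : T) (9 / 16 * 2 ^+ #|I|) <= \sum_t #|A t|%:R * P.
  apply: ler_sum => t _; apply: le_trans (tilted_small_ball (ha t) L0 hL) _.
  by apply: ler_wpM2l => //; rewrite ler0n.
rewrite sumr_const -mulr_suml -natr_sum => h.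
have h2 : (\sum_t #|A t|)%:R * P <= 2 ^+ #|I| * P.
  by apply: ler_wpM2r => //; rewrite -natrX ler_nat.
have := le_trans h h2; rewrite -[_ *+ #|xpredT|]mulr_natr.
have : 0 < 2 ^+ #|I| :> R by rewrite exprn_gt0.
set y := (X in 0 < X) => y0 h3.
rewrite -(ler_pM2r y0) [9 / 16 * _ * y]mulrAC [P * y]mulrC; exact: h3.
Qed.
End Cube.

(** * Walsh functions and the noise operator *)

Section Walsh.
Variables (R : realFieldType) (I : finType).
Local Notation cube := {ffun I -> bool}.

Definition walsh (S : {set I}) (w : cube) : R := \prod_(i in S) sgn R (w i).

Lemma walsh_orth (S T : {set I}) :
  \sum_w walsh S w * walsh T w = (S == T)%:R * 2 ^+ #|I|.
Proof.
pose F i b : R := (if i \in S then sgn R b else 1) * (if i \in T then sgn R b else 1).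
have -> : \sum_w walsh S w * walsh T w = \sum_(w : cube) \prod_i F i (w i).
  apply: eq_bigr => w _; rewrite /walsh big_mkcond [X in _ * X]big_mkcond /=.
  by rewrite -big_split.
rewrite prod_sum_cube; have [eST|neST] := eqVneq S T.
  rewrite mul1r -prodr_const; apply: eq_bigr => i _; rewrite /F eST.
  by case: ifP => _; rewrite /sgn ?mulrNN ?mulr1.
rewrite mul0r; have /existsP[i hi] : [exists i, (i \in S) != (i \in T)].
  apply: contraNT neST; rewrite negb_exists => /forallP h.
  by apply/eqP/setP => i; apply/eqP; have := h i; rewrite negbK.
apply/eqP/prodf_eq0; exists i => //; rewrite /F.
by move: hi; case: (i \in S); case: (i \in T) => //= _; rewrite /sgn ?mulr1 ?mul1r subrr.
Qed.

Lemma walsh_parseval (b : {set I} -> R) :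
  \sum_w (\sum_S b S * walsh S w) ^+ 2 = 2 ^+ #|I| * \sum_S b S ^+ 2.
Proof.
have e w : (\sum_S b S * walsh S w) ^+ 2 =
    \sum_S \sum_T b S * b T * (walsh S w * walsh T w).
  rewrite expr2 mulr_suml; apply: eq_bigr => S _.
  by rewrite mulr_sumr; apply: eq_bigr => T _; ring.
rewrite (eq_bigr _ (fun w _ => e w)) exchange_big mulr_sumr /=.
apply: eq_bigr => S _; rewrite exchange_big /=.
transitivity (\sum_T b S * b T * ((S == T)%:R * 2 ^+ #|I|)).
  by apply: eq_bigr => T _; rewrite -mulr_sumr walsh_orth.
rewrite (bigD1 S) //= big1 ?addr0; first by rewrite eqxx mul1r; ring.
by move=> T nTS; rewrite eq_sym (negbTE nTS) mul0r mulr0.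
Qed.

Definition wcoef (f : cube -> R) (S : {set I}) : R :=
  (\sum_w walsh S w * f w) / 2 ^+ #|I|.

Lemma walsh_bessel (f : cube -> R) :
  2 ^+ #|I| * \sum_S wcoef f S ^+ 2 <= \sum_w f w ^+ 2.
Proof.
have m0 : 0 < 2 ^+ #|I| :> R by rewrite exprn_gt0.
have : 0 <= \sum_w (f w - \sum_S wcoef f S * walsh S w) ^+ 2.
  by apply: sumr_ge0 => w _; exact: sqr_ge0.
have -> : \sum_w (f w - \sum_S wcoef f S * walsh S w) ^+ 2 =
    \sum_w f w ^+ 2 - 2 * (\sum_w f w * \sum_S wcoef f S * walsh S w)
    + \sum_w (\sum_S wcoef f S * walsh S w) ^+ 2.
  by rewrite mulr_sumr -sumrB -big_split /=; apply: eq_bigr => w _; ring.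
have -> : \sum_w f w * \sum_S wcoef f S * walsh S w =
     2 ^+ #|I| * \sum_S wcoef f S ^+ 2.
  under eq_bigr do rewrite mulr_sumr.
  rewrite exchange_big mulr_sumr /=; apply: eq_bigr => S _.
  rewrite expr2 {3}/wcoef mulrCA [_ * (_ / _)]mulrC divfK ?gt_eqF // mulr_sumr.
  by apply: eq_bigr => w _; ring.
by rewrite walsh_parseval => h; lra.
Qed.

(** Parseval, r^(2|S|) <= r^4 for |S| >= 2, and Bessel. *)
Lemma walsh_tail (f : cube -> R) (r : R) : 0 <= r <= 1 ->
  \sum_w (\sum_(S : {set I} | (2 <= #|S|)%N) r ^+ #|S| * wcoef f S * walsh S w) ^+ 2
  <= r ^+ 4 * \sum_w f w ^+ 2.
Proof.
move=> /andP[r0 r1].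
pose b (S : {set I}) := if (2 <= #|S|)%N then r ^+ #|S| * wcoef f S else 0.
have e w : (\sum_(S : {set I} | (2 <= #|S|)%N) r ^+ #|S| * wcoef f S * walsh S w) =
   \sum_S b S * walsh S w.
  rewrite big_mkcond /=; apply: eq_bigr => S _; rewrite /b.
  by case: ifP => //; rewrite mul0r.
under eq_bigr do rewrite e.
rewrite walsh_parseval.
have r4 : 0 <= r ^+ 4 by rewrite exprn_ge0.
apply: le_trans (ler_wpM2l r4 (walsh_bessel f)).
rewrite mulrCA ler_pM2l ?exprn_gt0 // mulr_sumr; apply: ler_sum => S _; rewrite /b.
case: ifP => hS; last by rewrite expr0n mulr_ge0 // sqr_ge0.
rewrite exprMn -exprM; apply: ler_wpM2r; first exact: sqr_ge0.
by apply: ler_wiXn2l => //; rewrite mulnC (leq_mul2l 2 2).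
Qed.

Lemma sum_sets_small (W : zmodType) (f : {set I} -> W) :
  \sum_S f S = f finset.set0 + \sum_i f [set i] + \sum_(S : {set I} | (2 <= #|S|)%N) f S.
Proof.
rewrite (bigID (fun S : {set I} => (2 <= #|S|)%N)) /= addrC; congr (_ + _).
rewrite (bigD1 finset.set0) /=; last by rewrite cards0.
congr (_ + _).
rewrite -(big_imset (h := fun i => [set i]) (A := predT) f) /=; last first.
  by move=> i j _ _; apply: finset.set1_inj.
apply: eq_bigl => S; rewrite -ltnNge ltnS; apply/andP/imsetP.
  move=> [h1 h2]; have /cards1P[i ->] : #|S| == 1%N.
    by rewrite eqn_leq h1 card_gt0.
  by exists i.
move=> [i _ ->]; rewrite cards1; split=> //.
by apply/eqP => /setP/(_ i); rewrite !inE eqxx.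
Qed.

(** The left side is the transition kernel of the noise operator with correlation [r]. Expanding the
    product over subsets of coordinates diagonalises it in the Walsh basis. *)
Lemma noise_kernel (r : R) (w s : cube) :
  bias (fun i => r * sgn R (w i)) s =
  (\sum_(S : {set I}) r ^+ #|S| * (walsh S w * walsh S s)) / 2 ^+ #|I|.
Proof.
rewrite /bias big_split /= prodr_const exprVn; congr (_ * _).
under eq_bigr do rewrite addrC.
rewrite bigA_distr /=; apply: eq_bigr => S _.
rewrite (bigID (mem S)) /= [X in _ * X]big1 ?mulr1; last first.
  by move=> i /negbTE ->.
under eq_bigr => i hi do rewrite hi -mulrA.
by rewrite big_split /= prodr_const big_split.
Qed.

End Walsh.

(** * K-convexity: boundedness of the Rademacher projection *)

Section KConvex.
Variables (R : realFieldType) (I : finType) (n : nat).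
Local Notation cube := {ffun I -> bool}.
Local Notation V := 'rV[R]_n.

(** Degree-one Walsh coefficient; [radsum (radcoef H)] is the Rademacher projection of [H]. *)
Definition radcoef (H : cube -> V) (i : I) : V :=
  (2 ^+ #|I|)^-1 *: \sum_(s : cube) sgn R (s i) *: H s.

Variables (p : V -> R) (g : 'M[R]_n) (d : R).
Hypothesis pP : seminorm p.
Hypothesis p_le : forall x, p x ^+ 2 <= nsq (x *m g).
Hypothesis le_p : forall x, nsq (x *m g) <= d ^+ 2 * p x ^+ 2.

(* The noise operator of parameter [r] is a contraction; its Walsh tail of order
   at least two is [O(r ^ 2)] in the Hilbert norm, hence [O(d r ^ 2)] in [p]. *)
Lemma radproj_bound (H : cube -> V) (r : R) : 0 <= r <= 1 ->
  r ^+ 2 * cubeavg (fun w => p (radsum (radcoef H) w) ^+ 2)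
  <= 3 * (2 + r ^+ 4 * d ^+ 2) * cubeavg (fun w => p (H w) ^+ 2).
Proof.
move=> r01; have /andP[r0 r1] := r01.
have m0 : 0 < 2 ^+ #|I| :> R by rewrite exprn_gt0.
have mn0 : 2 ^+ #|I| != 0 :> R by rewrite gt_eqF.
pose k (w s : cube) := bias (fun i => r * sgn R (w i)) s.
pose T (w : cube) := \sum_s k w s *: H s.
pose c (S : {set I}) := (2 ^+ #|I|)^-1 *: \sum_s walsh R S s *: H s.
pose Rest (w : cube) := \sum_(S : {set I} | (2 <= #|S|)%N) (r ^+ #|S| * walsh R S w) *: c S.
pose M := (2 ^+ #|I|)^-1 *: \sum_s H s.
have kle w i : `|r * sgn R (w i)| <= 1 by rewrite normrM sgn_norm mulr1 ger0_norm.
have k0 w s : 0 <= k w s by exact: bias_ge0.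
have k1 w : \sum_s k w s = 1 by exact: bias_sum1.
have ksym w s : k w s = k s w.
  by apply: eq_bigr => i _; rewrite mulrAC.
(* Splitting by Walsh degree isolates the projection: T, M and Rest are each bounded, hence so is
   the degree-one part. *)
have TE w : T w = M + r *: radsum (radcoef H) w + Rest w.
  have -> : T w = \sum_(S : {set I}) (r ^+ #|S| * walsh R S w) *: c S.
    rewrite /T /k; under eq_bigr do rewrite noise_kernel mulr_suml scaler_suml.
    rewrite exchange_big /=; apply: eq_bigr => S _; rewrite /c scalerA scaler_sumr.
    by apply: eq_bigr => s _; rewrite scalerA; congr (_ *: _); ring.
  rewrite sum_sets_small; congr (_ + _ + _).
    rewrite cards0 expr0 mul1r /walsh big_set0 scale1r /c /M; congr (_ *: _).
    by apply: eq_bigr => s _; rewrite /walsh big_set0 scale1r.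
  rewrite /radsum scaler_sumr; apply: eq_bigr => i _.
  rewrite cards1 expr1 /walsh big_set1 scalerA; congr (_ *: _).
  rewrite /c /radcoef; congr (_ *: _); apply: eq_bigr => s _.
  by rewrite /walsh big_set1.
set A := \sum_w p (H w) ^+ 2.
have A0 : 0 <= A by apply: sumr_ge0 => w _; exact: sqr_ge0.
have hT : \sum_w p (T w) ^+ 2 <= A.
  apply: (@le_trans _ _ (\sum_w \sum_s k w s * p (H s) ^+ 2)).
    by apply: ler_sum => w _; apply: seminorm_jensen2.
  rewrite exchange_big /=; apply: ler_sum => s _.
  rewrite -mulr_suml; under eq_bigr do rewrite ksym.
  by rewrite k1 mul1r.
have hM : \sum_(w : cube) p M ^+ 2 <= A.
  have : p M ^+ 2 <= A / 2 ^+ #|I|.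
    rewrite /M scaler_sumr /A mulr_suml.
    under [leRHS]eq_bigr do rewrite mulrC.
    apply: (seminorm_jensen2 pP) => [s|]; first by rewrite invr_ge0 ltW.
    by rewrite cube_sum_const divff.
  rewrite ler_pdivlMr // => h.
  by rewrite cube_sum_const mulrC.
have hR : \sum_w p (Rest w) ^+ 2 <= r ^+ 4 * (d ^+ 2 * A).
  apply: (@le_trans _ _ (\sum_w nsq (Rest w *m g))).
    by apply: ler_sum => w _; exact: p_le.
  apply: (@le_trans _ _ (r ^+ 4 * \sum_w nsq (H w *m g))); last first.
    apply: ler_wpM2l; first by rewrite exprn_ge0.
    by rewrite mulr_sumr; apply: ler_sum => w _; exact: le_p.
  rewrite /nsq exchange_big [X in _ <= _ * X]exchange_big /= mulr_sumr.
  apply: ler_sum => j _; apply: le_trans (walsh_tail _ r01).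
  rewrite le_eqVlt; apply/orP; left; apply/eqP; apply: eq_bigr => w _.
  congr (_ ^+ 2); rewrite /Rest mulmx_suml summxE; apply: eq_bigr => S _.
  rewrite -scalemxAl mxE /c -scalemxAl mxE mulmx_suml summxE /wcoef.
  rewrite [(_ * _) * (_ * _)](_ : _ = r ^+ #|S| * ((2 ^+ #|I|)^-1 *
     (\sum_i (walsh R S i *: H i *m g) 0 j)) * walsh R S w); last by ring.
  congr (_ * _ * _); rewrite mulrC; congr (_ * _); apply: eq_bigr => s _.
  by rewrite -scalemxAl mxE.
have hp w : r ^+ 2 * p (radsum (radcoef H) w) ^+ 2
   <= 3 * (p (T w) ^+ 2 + p M ^+ 2 + p (Rest w) ^+ 2).
  have -> : r ^+ 2 * p (radsum (radcoef H) w) ^+ 2 =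
      p (r *: radsum (radcoef H) w) ^+ 2 by rewrite pP.2 ger0_norm // exprMn.
  have -> : r *: radsum (radcoef H) w = T w + (- M + - Rest w).
    by rewrite TE addrACA subrr addr0 [M + _]addrC addrK.
  have h1 := pP.1 (T w) (- M + - Rest w); have h2 := pP.1 (- M) (- Rest w).
  rewrite !(seminormN pP) in h2.
  have h3 := le_trans h1 (lerD (lexx _) h2).
  have h4 : p (T w + (- M - Rest w)) ^+ 2 <= (p (T w) + (p M + p (Rest w))) ^+ 2.
    by rewrite ler_sqr ?nnegrE ?(seminorm_ge0 pP) // (le_trans _ h3) // (seminorm_ge0 pP).
  apply: le_trans h4 _.
  have := sqr_ge0 (p (T w) - p M); have := sqr_ge0 (p (T w) - p (Rest w)).
  by have := sqr_ge0 (p (Rest w) - p M); lra.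
rewrite /cubeavg !mulrA ler_pM2r ?invr_gt0 // mulr_sumr.
apply: (le_trans (ler_sum _ (fun w _ => hp w))).
rewrite -mulr_sumr !big_split /= -mulrA ler_pM2l //.
rewrite mulrDl -/A -mulrA; move: hT hM hR.
set a1 := \sum_w p (T w) ^+ 2; set a2 := \sum_(w : cube) p M ^+ 2.
set a3 := \sum_w p (Rest w) ^+ 2.
lra.
Qed.

End KConvex.

(** * A symmetric fourth root of a Gram matrix *)

Section FourthRoot.
Local Open Scope sesquilinear_scope.

Lemma interpolation_exists (F : fieldType) (f : F -> F) (s : seq F) :
  exists q : {poly F}, {in s, forall x, q.[x] = f x}.
Proof.
elim: s => [|a s [q hq]]; first by exists 0.
have [as_|nas] := boolP (a \in s).
  by exists q => x; rewrite inE => /predU1P[->|]; exact: hq.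
pose w : {poly F} := \prod_(y <- s) ('X - y%:P).
have wa : w.[a] != 0 by rewrite -rootE root_prod_XsubC.
exists (q + ((f a - q.[a]) / w.[a])%:P * w) => x; rewrite inE !hornerE.
have [->|xa /= xs] := eqVneq x a; first by rewrite divfK // subrKC.
have /rootP -> : root w x by rewrite root_prod_XsubC.
by rewrite mulr0 addr0 hq.
Qed.

Lemma horner_mx_tr (F : fieldType) n (A : 'M[F]_n.+1) (q : {poly F}) :
  (horner_mx A q)^T = horner_mx A^T q.
Proof.
elim/poly_ind: q => [|q c IH]; first by rewrite !rmorph0 trmx0.
rewrite !rmorphD !rmorphM /= !horner_mx_X !horner_mx_C linearD /= tr_scalar_mx.
congr (_ + _); rewrite -[in LHS]mulmxE trmx_mul IH mulmxE.
by rewrite -!mulmxE; exact: (comm_mx_horner q (erefl (A^T *m A^T))).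
Qed.

(** The root is a real polynomial in T = u^T u interpolating x^(1/4) at the eigenvalues. Being a
    polynomial in T makes it real and symmetric, so the complex spectral theorem is used only to
    check its fourth power. *)
Lemma gram_fourth_root (R : rcfType) n (u : 'M[R]_n) :
  exists2 Q : 'M[R]_n, Q^T = Q & Q *m Q *m Q *m Q = u^T *m u.
Proof.
case: n u => [|n] u; first by exists 0; apply/matrixP => -[].
pose C := R[i]; pose toC : {rmorphism R -> C} := real_complex R.
have [T TE Tsym] : exists2 T, T = u^T *m u & T^T = T.
  by exists (u^T *m u); rewrite ?trmx_mul ?trmxK.
rewrite -TE; pose Tc : 'M[C]_n.+1 := map_mx toC T; pose uc : 'M[C]_n.+1 := map_mx toC u.
have conjtoC x : Num.conj (toC x) = toC x by apply/CrealP/complex_realP; exists x.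
have Tcn : Tc ^t* = Tc.
  by apply/matrixP => i j; rewrite !mxE /= conjtoC -[in RHS]Tsym mxE.
have /orthomx_spectralP E : Tc \is normalmx by apply/normalmxP; rewrite Tcn.
set P := spectralmx Tc in E; set sp := spectral_diag Tc in E.
have Pu : P \is unitarymx by exact: spectral_unitarymx.
have PU : P \in unitmx by exact: unitarymx_unit.
have sp_ge0 i : 0 <= sp 0 i.
  have dE : diag_mx sp = (P *m uc^T) *m (P *m uc^T) ^t*.
    have -> : diag_mx sp = P *m Tc *m invmx P by rewrite E !mulmxA mulmxV // mul1mx mulmxK.
    rewrite invmx_unitary // trmx_mul trmxK map_mxM /= -!mulmxA; congr (_ *m _).
    have -> : map_mx Num.conj uc = uc by apply/matrixP => k l; rewrite !mxE conjtoC.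
    by rewrite mulmxA; congr (_ *m _); rewrite /Tc TE map_mxM /= -map_trmx.
  have := congr1 (fun X : 'M[C]_n.+1 => X i i) dE; rewrite /= !mxE eqxx mulr1n => ->.
  by apply: sumr_ge0 => k _; rewrite !mxE mul_conjC_ge0.
pose la i := complex.Re (sp 0 i); have laE i : toC (la i) = sp 0 i.
  by rewrite /toC /la /= RRe_real // ger0_real.
have la0 i : 0 <= la i by rewrite -ler0c laE.
have [q hq] := interpolation_exists (fun x => Num.sqrt (Num.sqrt x)) [seq la i | i <- enum 'I_n.+1].
have hq4 i : q.[la i] ^+ 4 = la i.
  rewrite hq; last by apply/mapP; exists i; rewrite ?mem_enum.
  by rewrite (exprM _ 2 2) !sqr_sqrtr ?sqrtr_ge0.
exists (horner_mx T q); first by rewrite horner_mx_tr Tsym.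
have -> : horner_mx T q *m horner_mx T q *m horner_mx T q *m horner_mx T q = horner_mx T (q ^+ 4).
  by rewrite !mulmxE rmorphXn /= !exprS expr0 mulr1 !mulrA.
have toCi : injective (map_mx toC : 'M[R]_n.+1 -> 'M[C]_n.+1).
  by move=> A B /matrixP h; apply/matrixP => i j; have := h i j; rewrite !mxE => /complexI.
apply: toCi; rewrite -/Tc map_horner_mx -/Tc E horner_mx_uconjC // horner_mx_diag.
congr (_ *m diag_mx _ *m _); apply/rowP => i; rewrite !mxE -laE horner_map /=.
by rewrite horner_exp hq4.
Qed.

End FourthRoot.

Local Open Scope classical_set_scope.

(** * Continuity and boundedness in terms of the Euclidean norm *)

Section Topology.
Variable R : realType.

Lemma continuous_fsum (T : topologicalType) (J : finType) (f : J -> T -> R) :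
  (forall j, continuous (f j)) -> continuous (fun x => \sum_j f j x).
Proof.
move=> cf; have : forall r : seq J, continuous (fun x => \sum_(j <- r) f j x).
  elim=> [|j r IH].
    by under eq_fun do rewrite big_nil; move=> x; exact: cvg_cst.
  by under eq_fun do rewrite big_cons; move=> x; apply: cvgD; [exact: cf|exact: IH].
by apply.
Qed.

Lemma continuous_fprod (T : topologicalType) (J : finType) (f : J -> T -> R) :
  (forall j, continuous (f j)) -> continuous (fun x => \prod_j f j x).
Proof.
move=> cf; have : forall r : seq J, continuous (fun x => \prod_(j <- r) f j x).
  elim=> [|j r IH].
    by under eq_fun do rewrite big_nil; move=> x; exact: cvg_cst.
  by under eq_fun do rewrite big_cons; move=> x; apply: cvgM; [exact: cf|exact: IH].
by apply.
Qed.

Lemma continuous_dot n (f : 'rV[R]_n) : continuous (dot f).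
Proof.
apply: continuous_fsum => i x.
have h1 : (fun _ : 'rV[R]_n => f 0 i) y @[y --> x] --> f 0 i by apply: cvg_cst; exact: nbhs_filter.
have h2 : (fun y : 'rV[R]_n => y 0 i) y @[y --> x] --> x 0 i.
  exact: coord_continuous.
exact: (cvgM h1 h2).
Qed.

Lemma continuous_nsqB n (x : 'rV[R]_n) : continuous (fun y : 'rV[R]_n => nsq (x - y)).
Proof.
apply: continuous_fsum => i y.
have -> : (fun z : 'rV[R]_n => (x - z) 0 i ^+ 2) =
    (fun z => (x 0 i - z 0 i) * (x 0 i - z 0 i)).
  by apply/funext => z; rewrite expr2 !mxE.
have h1 : (fun _ : 'rV[R]_n => x 0 i) z @[z --> y] --> x 0 i by apply: cvg_cst; exact: nbhs_filter.
have h2 : (fun z : 'rV[R]_n => z 0 i) z @[z --> y] --> y 0 i.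
  exact: coord_continuous.
have h3 : (fun z : 'rV[R]_n => x 0 i - z 0 i) z @[z --> y] --> x 0 i - y 0 i.
  exact: (cvgB h1 h2).
exact: (cvgM h3 h3).
Qed.

Lemma normr_le_nsq n (x : 'rV[R]_n) r : 0 <= r -> nsq x <= r ^+ 2 -> `|x| <= r.
Proof.
move=> r0 hx; have -> : `|x| = mx_norm x by [].
rewrite mx_normrE; apply/bigmax_leP; split=> [//|[i j] _ /=].
rewrite -ler_sqr ?nnegrE ?normr_ge0 // real_normK ?num_real //.
apply: le_trans hx; rewrite ord1 /nsq (bigD1 j) //= lerDl.
by apply: sumr_ge0 => k _; exact: sqr_ge0.
Qed.

Lemma nbhs_nsq n (x : 'rV[R]_n) r : 0 < r -> nbhs x [set y | nsq (x - y) <= r ^+ 2].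
Proof.
move=> r0; have FF : Filter (nbhs x) := nbhs_filter x.
have h0 : (fun y : 'rV[R]_n => nsq (x - y)) y @[y --> x] --> nsq (x - x).
  exact: continuous_nsqB.
rewrite subrr nsq0 in h0.
have := (@cvgrPdist_lt _ _ _ _ FF _ _).1 h0 _ (exprn_gt0 2 r0).
apply: filterS => y; rewrite sub0r normrN ger0_norm ?nsq_ge0 // => h.
exact: ltW.
Qed.

(** The ambient norm of row vectors is the maximum norm; this is the bridge to [nsq]. *)
Lemma bounded_nsq n (A : set 'rV[R]_n) :
  bounded_set A <-> exists2 r, 0 < r & forall x, A x -> nsq x <= r ^+ 2.
Proof.
split.
  move=> [M [_ hM]]; have h : forall x, A x -> `|x| <= `|M| + 1.
    by move=> x; apply: hM; rewrite (le_lt_trans (ler_norm _)) // ltrDl.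
  exists (n.+1%:R * (`|M| + 1)) => [|x /h hx].
    by rewrite mulr_gt0 // ltr_wpDl.
  apply: (@le_trans _ _ (\sum_(i < n) (`|M| + 1) ^+ 2)).
    apply: ler_sum => i _; rewrite -real_normK ?num_real // ler_sqr ?nnegrE //.
      apply: le_trans hx; have -> : `|x| = mx_norm x by []. rewrite mx_normrE.
      by apply: (le_bigmax _ (fun ij : 'I_1 * 'I_n => `|x ij.1 ij.2|) (0, i)).
  rewrite sumr_const card_ord -[leLHS]mulr_natl exprMn; apply: ler_wpM2r; first exact: sqr_ge0.
  by rewrite -natrX ler_nat (leq_trans (leqnSn n)) // expnS expn1 leq_pmulr.
move=> [r r0 hr]; exists r; split; first exact: num_real.
by move=> M rM x /hr hx; apply: le_trans (ltW rM); apply: normr_le_nsq hx; exact: ltW.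
Qed.

Lemma seminorm_nsq_le n (p : 'rV[R]_n -> R) : seminorm p ->
  exists2 c, 0 < c & forall x, p x ^+ 2 <= c * nsq x.
Proof.
move=> sp; pose e : 'rV[R]_n := \row_k p (delta_mx 0 k).
exists (nsq e + 1) => [|x]; first by rewrite ltr_wpDl // nsq_ge0.
apply: (@le_trans _ _ (nsq e * nsq x)); last first.
  by apply: ler_wpM2r; rewrite ?nsq_ge0 // lerDl.
have -> : nsq x = nsq (\row_k `|x 0 k|).
  by apply: eq_bigr => k _; rewrite mxE real_normK ?num_real.
apply: le_trans (cauchy_schwarz _ _).
have h : p x <= dot e (\row_k `|x 0 k|).
  rewrite {1}[x]row_sum_delta; apply: le_trans (seminorm_sum sp _ _) _.
  by apply: ler_sum => k _; rewrite sp.2 !mxE mulrC.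
by rewrite ler_sqr ?nnegrE ?(seminorm_ge0 sp) // (le_trans _ h) // (seminorm_ge0 sp).
Qed.

Lemma seminorm_continuous n (p : 'rV[R]_n -> R) : seminorm p -> continuous p.
Proof.
move=> gs x; have [c c0 hc] := seminorm_nsq_le gs.
have FF : Filter (nbhs x) := nbhs_filter x.
suff : p y @[y --> nbhs x] --> p x by [].
apply/(@cvgrPdist_lt _ _ _ _ FF) => e e0.
have h0 : (fun y : 'rV[R]_n => c * nsq (x - y)) y @[y --> x] --> c * nsq (x - x).
  apply: cvgM; first exact: cvg_cst.
  exact: continuous_nsqB.
rewrite subrr nsq0 mulr0 in h0.
have e20 : 0 < e ^+ 2 by rewrite exprn_gt0.
have := (@cvgrPdist_lt _ _ _ _ FF _ _).1 h0 _ e20.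
apply: filterS => y; rewrite sub0r normrN ger0_norm; last first.
  by rewrite mulr_ge0 ?nsq_ge0 // ltW.
move=> hy; rewrite -ltr_sqr ?nnegrE ?normr_ge0 ?ltW // real_normK ?num_real //.
apply: le_lt_trans hy; apply: le_trans (hc _).
have h1 := gs.1 (x - y) y; rewrite subrK in h1.
have h2 := gs.1 (y - x) x; rewrite subrK -opprB (seminormN gs) in h2.
rewrite -real_normK ?num_real // ler_sqr ?nnegrE ?normr_ge0 ?(seminorm_ge0 gs) //.
by rewrite ler_norml; apply/andP; split; lra.
Qed.

End Topology.

(** * Symmetric convex bodies: polars, support functions and gauges *)

Section Bodies.
Variables (R : realType) (n : nat).
Local Notation V := 'rV[R]_n.
Implicit Types (B C : set V) (f x y : V).

Definition polar B : set V := [set f | forall x, B x -> dot f x <= 1].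

(** Nonempty interior is recorded as a Euclidean ball about the origin, the form that polarity
    exchanges with boundedness. *)
Definition body B : Prop :=
  [/\ compact B, Defs.convex_set B, origin_symmetric B
    & exists2 r, 0 < r & forall x, nsq x <= r ^+ 2 -> B x].

Lemma body0 B : body B -> B 0.
Proof. by move=> [_ _ _ [r r0 h]]; apply: h; rewrite nsq0 sqr_ge0. Qed.

Lemma body_bounded B : body B -> exists2 r, 0 < r & forall x, B x -> nsq x <= r ^+ 2.
Proof. by move=> [cB _ _ _]; apply/bounded_nsq; exact: compact_bounded. Qed.

Lemma body_scale B c x : body B -> `|c| <= 1 -> B x -> B (c *: x).
Proof.
move=> bB; have [_ cv sy _] := bB.
have pos d y : 0 <= d <= 1 -> B y -> B (d *: y).
  move=> hd hy; have := cv _ _ _ hy (body0 bB) hd.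
  by rewrite scaler0 addr0.
move=> c1 Bx; have [c0|c0] := lerP 0 c.
  by apply: pos => //; rewrite c0 -(ger0_norm c0).
rewrite -[c]opprK scaleNr -scalerN; apply: pos; last exact: sy.
by rewrite -(ltr0_norm c0) normr_ge0.
Qed.

Lemma compact_closed_nsq (A : set V) r :
  closed A -> (forall x, A x -> nsq x <= r ^+ 2) -> compact A.
Proof.
move=> cA hA; apply: bounded_closed_compact => //; apply/bounded_nsq.
exists (`|r| + 1); first by rewrite ltr_wpDl.
move=> x /hA h; apply: le_trans h _; rewrite -real_normK ?num_real //.
by rewrite ler_sqr ?nnegrE ?addr_ge0 // lerDl.
Qed.

Lemma body_closed B : body B -> closed B.
Proof. by move=> [cB _ _ _]; apply: compact_closed => //; exact: norm_hausdorff. Qed.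

Lemma closed_fun_le (f : V -> R) c : continuous f -> closed [set x | f x <= c].
Proof.
move=> cf; apply: (@preimage_closed _ _ f [set y | y <= c]); last exact: closed_le.
by move=> x _; exact: cf.
Qed.

Lemma polar_body B : body B -> body (polar B).
Proof.
move=> bB; have [cB cv sy [r r0 hr]] := bB.
have [M M0 hM] := body_bounded bB.
split.
- apply: (@compact_closed_nsq _ r^-1).
    have -> : polar B = \bigcap_(x in B) [set f | dot f x <= 1].
      by apply/seteqP; split => f h x; exact: h.
    apply: closed_bigI => x _.
    under eq_set do rewrite dotC.
    by apply: closed_fun_le; exact: continuous_dot.
  move=> f hf; have [f0|fn0] := eqVneq (nsq f) 0; first by rewrite f0 sqr_ge0.
  have fp : 0 < nsq f by rewrite lt_neqAle eq_sym fn0 nsq_ge0.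
  set s := Num.sqrt (nsq f); have s0 : 0 < s by rewrite sqrtr_gt0.
  have sE : nsq f = s ^+ 2 by rewrite sqr_sqrtr // ltW.
  have : dot f ((r / s) *: f) <= 1.
    by apply: hf; apply: hr; rewrite nsqZ sE exprMn exprVn mulfVK // expf_neq0 // gt_eqF.
  rewrite dotZr -nsqE sE expr2 mulrA mulfVK ?gt_eqF // => h.
  have h2 : s <= r^-1 by rewrite -[r^-1]mul1r ler_pdivlMr // mulrC.
  by rewrite -expr2; apply: lerXn2r; rewrite ?nnegrE ?invr_ge0 // ltW.
- move=> f g t hf hg /andP[t0 t1] x Bx; rewrite dotDl !dotZl.
  have h1 : t * dot f x <= t * 1 by apply: ler_wpM2l => //; exact: hf.
  have h2 : (1 - t) * dot g x <= (1 - t) * 1.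
    by apply: ler_wpM2l; rewrite ?subr_ge0 //; exact: hg.
  by apply: le_trans (lerD h1 h2) _; rewrite !mulr1 addrC subrK.
- by move=> f hf x Bx; rewrite dotNl -dotNr; apply: hf; exact: sy.
- exists M^-1; first by rewrite invr_gt0.
  move=> f hf x /hM hx; have := dot_le _ (ltW M0) hf hx.
  by rewrite mulVf ?gt_eqF //; apply; rewrite invr_ge0 ltW.
Qed.

(** A point x outside B is separated from B by f0 = x - b0, where b0 is the point of B nearest to
    x. *)
Lemma bipolar B : body B -> polar (polar B) = B.
Proof.
move=> bB; have [cB cv sy _] := bB.
apply/seteqP; split => [x hx|x Bx f]; last by rewrite dotC; exact.
apply: contrapT => nBx.
have [b0 + hmin] := EVT_min_rV (ex_intro _ 0 (body0 bB)) cB (continuous_subspaceT (@continuous_nsqB R n x)).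
rewrite inE => Bb0; set f0 := x - b0.
have f0p : 0 < nsq f0.
  rewrite lt_neqAle nsq_ge0 andbT eq_sym nsq_eq0 subr_eq0.
  by apply/eqP => xb; apply: nBx; rewrite xb.
have var b : B b -> dot f0 b <= dot f0 b0.
  move=> Bb; rewrite leNgt; apply/negP => lt.
  pose u := dot f0 b - dot f0 b0; have u0 : 0 < u by rewrite subr_gt0.
  pose w := nsq (b - b0); have w0 : 0 <= w by exact: nsq_ge0.
  have h t : 0 <= t <= 1 -> 2 * t * u <= t ^+ 2 * w.
    move=> t01; have := hmin (t *: b + (1 - t) *: b0).
    rewrite inE => /(_ (cv _ _ _ Bb Bb0 t01)).
    have -> : x - (t *: b + (1 - t) *: b0) = f0 - t *: (b - b0).
      by apply/rowP => i; rewrite !mxE; ring.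
    rewrite (nsqB f0) nsqZ dotZr -/w -/f0 dotBr -/u; lra.
  (* Moving by this t towards b gives t w <= u, which contradicts 2 u <= t w, the consequence of
     minimality. *)
  pose t := u / (u + w).
  have uw : 0 < u + w by rewrite ltr_wpDr.
  have t0 : 0 < t by rewrite divr_gt0.
  have t1 : t <= 1 by rewrite ler_pdivrMr // mul1r lerDl.
  have hh : 2 * u <= t * w.
    have := h t; rewrite t1 ltW // => /(_ isT) ht.
    by rewrite -(ler_pM2l t0); lra.
  move: hh; have -> : t * w = u * (w / (u + w)) by rewrite /t; ring.
  have : w / (u + w) <= 1 by rewrite ler_pdivrMr // mul1r lerDr ltW.
  nra.
set c := dot f0 b0; have c0 : 0 <= c by rewrite -(dot0r f0); apply: var; exact: body0.
have fx : dot f0 x = c + nsq f0 by rewrite nsqE {3}/f0 dotBr -/c; ring.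
(* A level strictly between the maximum c of f0 on B and its value c + |f0|^2 at x; its positivity
   allows f0 to be normalised into the polar. *)
set s := c + nsq f0 / 2; have s0 : 0 < s by rewrite ltr_wpDl // divr_gt0.
have : dot x (s^-1 *: f0) <= 1.
  apply: hx => b Bb; rewrite dotZl mulrC ler_pdivrMr // mul1r.
  by apply: le_trans (var _ Bb) _; rewrite lerDl divr_ge0 // ltW.
rewrite dotC dotZl mulrC ler_pdivrMr // mul1r fx /s; lra.
Qed.

(** Support function of B. The Minkowski functional [gauge] is then defined as the support function
    of the polar, so that both share one theory; [gauge_le1] identifies its unit ball through
    [bipolar]. *)
Definition supp B f : R := sup [set dot f x | x in B].

Definition gauge B : V -> R := supp (polar B).

Lemma supp_attained B f : body B -> exists2 x, B x & supp B f = dot f x.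
Proof.
move=> bB; have [cB _ _ _] := bB.
have [x + hmax] := EVT_max_rV (ex_intro _ 0 (body0 bB)) cB
    (continuous_subspaceT (@continuous_dot R n f)).
rewrite inE => Bx; exists x => //; apply/eqP; rewrite eq_le; apply/andP; split.
  apply: ge_sup; first by exists (dot f x), x.
  by move=> _ [y By <-]; apply: hmax; rewrite inE.
apply: ub_le_sup; last by exists x.
by exists (dot f x) => _ [y By <-]; apply: hmax; rewrite inE.
Qed.

Lemma le_supp B f x : body B -> B x -> dot f x <= supp B f.
Proof.
move=> bB Bx; have [M M0 hM] := body_bounded bB.
apply: ub_le_sup; last by exists x.
exists (Num.sqrt (nsq f) * M) => _ [y By <-].
apply: dot_le; rewrite ?sqrtr_ge0 ?(ltW M0) ?sqr_sqrtr ?nsq_ge0 //; exact: hM.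
Qed.

Lemma supp_le B f c : body B -> (forall x, B x -> dot f x <= c) -> supp B f <= c.
Proof. by move=> bB h; have [x Bx ->] := supp_attained f bB; exact: h. Qed.

Lemma supp_seminorm B : body B -> seminorm (supp B).
Proof.
move=> bB; have [_ _ sy _] := bB; split=> [f g|c f].
  have [x Bx ->] := supp_attained (f + g) bB.
  by rewrite dotDl; apply: lerD; exact: le_supp.
have pos d h : 0 <= d -> supp B (d *: h) = d * supp B h.
  move=> d0; apply/eqP; rewrite eq_le; apply/andP; split.
    apply: supp_le => // x Bx; rewrite dotZl; apply: ler_wpM2l => //; exact: le_supp.
  have [x Bx ->] := supp_attained h bB.
  by rewrite -dotZl; exact: le_supp.
have opp h : supp B (- h) = supp B h.
  apply/eqP; rewrite eq_le; apply/andP; split.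
    by apply: supp_le => // x Bx; rewrite dotNl -dotNr; apply: le_supp => //; exact: sy.
  by apply: supp_le => // x Bx; rewrite -[h in leLHS]opprK dotNl -dotNr; apply: le_supp => //; exact: sy.
have [c0|c0] := lerP 0 c; first by rewrite ger0_norm // pos.
by rewrite ltr0_norm // -[c in LHS]opprK scaleNr opp pos // oppr_ge0 ltW.
Qed.

Lemma supp_le1 B f : body B -> (supp B f <= 1) <-> polar B f.
Proof.
move=> bB; split=> [h x Bx|h]; last exact: supp_le.
by apply: le_trans h; exact: le_supp.
Qed.

Lemma gauge_seminorm B : body B -> seminorm (gauge B).
Proof. by move=> bB; apply: supp_seminorm; exact: polar_body. Qed.

Lemma gauge_le1 B x : body B -> (gauge B x <= 1) <-> B x.
Proof. by move=> bB; rewrite -{2}(bipolar bB); apply: supp_le1; exact: polar_body. Qed.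

Lemma gauge_polar B : body B -> gauge (polar B) = supp B.
Proof. by move=> bB; rewrite /gauge bipolar. Qed.

Lemma gauge_le B x c : body B -> 0 < c -> (gauge B x <= c) <-> B (c^-1 *: x).
Proof.
move=> bB c0; have := gauge_le1 (c^-1 *: x) bB.
by rewrite (gauge_seminorm bB).2 ger0_norm ?invr_ge0 ?(ltW c0) // mulrC ler_pdivrMr // mul1r.
Qed.

Lemma dot_le_gauge B f x : body B -> dot f x <= supp B f * gauge B x.
Proof.
move=> bB; have gs := gauge_seminorm bB; have ss := supp_seminorm bB.
have [g0|gn0] := eqVneq (gauge B x) 0.
  have h t : 0 < t -> t * dot f x <= supp B f.
    move=> t0; rewrite -dotZr; apply: le_supp => //.
    by apply/(gauge_le1 _ bB); rewrite gs.2 g0 mulr0.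
  rewrite g0 mulr0 leNgt; apply/negP => d0.
  have s0 := seminorm_ge0 ss f.
  have := h ((supp B f + 1) / dot f x); rewrite divr_gt0 ?ltr_wpDl // => /(_ isT).
  by rewrite divfK ?gt_eqF // gerDl ler10.
have gp : 0 < gauge B x by rewrite lt_neqAle eq_sym gn0 (seminorm_ge0 gs).
rewrite -ler_pdivrMr // mulrC -dotZr; apply: le_supp => //.
by apply/(gauge_le _ bB gp).
Qed.

Lemma nsq_le_gauge B : body B -> exists2 c, 0 < c & forall x, nsq x <= c * gauge B x ^+ 2.
Proof.
move=> bB; have [_ _ _ [r r0 hr]] := polar_body bB.
exists (r^-1 ^+ 2) => [|x]; first by rewrite exprn_gt0 // invr_gt0.
have [x0|xn0] := eqVneq (nsq x) 0.
  by rewrite x0 mulr_ge0 // sqr_ge0.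
have xp : 0 < nsq x by rewrite lt_neqAle eq_sym xn0 nsq_ge0.
set s := Num.sqrt (nsq x); have s0 : 0 < s by rewrite sqrtr_gt0.
have sE : nsq x = s ^+ 2 by rewrite sqr_sqrtr // ltW.
have : dot x ((r / s) *: x) <= gauge B x.
  apply: le_supp; first exact: polar_body.
  by apply: hr; rewrite nsqZ sE exprMn exprVn mulfVK // expf_neq0 // gt_eqF.
rewrite dotZr -nsqE sE expr2 mulrA mulfVK ?gt_eqF // => h.
have h2 : s <= r^-1 * gauge B x by rewrite mulrC ler_pdivlMr // mulrC.
rewrite -expr2 -exprMn; apply: lerXn2r => //; rewrite nnegrE ltW //.
exact: lt_le_trans h2.
Qed.

End Bodies.

(** * Separated sets, coverings and entropy *)

Lemma fiber_pigeonhole (T U : finType) (P : {set T}) (f : T -> U) : (0 < #|P|)%N ->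
  exists u, (#|P| <= #|U| * #|[set t in P | f t == u]|)%N.
Proof.
move=> P0; have [t0 tP] : exists t, t \in P by apply/set0Pn; rewrite -card_gt0.
pose F u := #|[set t in P | f t == u]|.
pose u := [arg max_(v > f t0) F v].
exists u; have uM v : (F v <= F u)%N by rewrite /u; case: arg_maxnP => // i _ h; exact: h.
have -> : #|P| = (\sum_v F v)%N.
  rewrite -sum1_card (partition_big f predT) //=; apply: eq_bigr => v _.
  by rewrite /F -sum1_card; apply: eq_bigl => t; rewrite inE.
by rewrite -sum_nat_const; apply: leq_sum => v _.
Qed.

Section Separation.
Variables (R : realType) (n : nat).
Local Notation V := 'rV[R]_n.
Implicit Types (A B C : set V) (N M : nat).

Definition sepn A C N := exists x : 'I_N -> V,
  (forall i, A (x i)) /\ (forall i j, i != j -> ~ C (x i - x j)).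

Definition cov A C N := exists y : 'I_N -> V, forall x, A x -> exists i, C (x - y i).

Lemma sepn_fin A C (T : finType) (P : {set T}) (x : T -> V) :
  (forall t, t \in P -> A (x t)) ->
  (forall t s, t \in P -> s \in P -> t != s -> ~ C (x t - x s)) -> sepn A C #|P|.
Proof.
move=> hA hC; exists (fun i => x (enum_val i)); split=> [i|i j ij].
  by apply: hA; exact: enum_valP.
apply: hC; [exact: enum_valP | exact: enum_valP |].
by apply: contraNneq ij => /enum_val_inj ->.
Qed.

Lemma sepn_finT A C (T : finType) (x : T -> V) :
  (forall t, A (x t)) -> (forall t s, t != s -> ~ C (x t - x s)) -> sepn A C #|T|.
Proof.
by move=> hA hC; rewrite -cardsT; apply: (sepn_fin (x := x)) => // t s _ _; exact: hC.
Qed.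

Lemma cov_fin A C (T : finType) (y : T -> V) :
  (forall x, A x -> exists t, C (x - y t)) -> cov A C #|T|.
Proof.
move=> h; exists (fun i => y (enum_val i)) => x /h[t ht].
by exists (enum_rank t); rewrite enum_rankK.
Qed.

Lemma sepn_leq A C N M : (M <= N)%N -> sepn A C N -> sepn A C M.
Proof.
move=> MN [x [h1 h2]]; exists (fun i => x (widen_ord MN i)); split=> // i j ij.
by apply: h2; apply: contraNneq ij => /(congr1 val) /= /val_inj ->.
Qed.

Lemma sepn_sub A A' C C' N : A `<=` A' -> C' `<=` C -> sepn A C N -> sepn A' C' N.
Proof.
move=> sA sC [x [h1 h2]]; exists x; split=> [i|i j ij]; first exact/sA/h1.
by move=> /sC; exact: h2.
Qed.

Lemma cov_sub A A' C C' N : A' `<=` A -> C `<=` C' -> cov A C N -> cov A' C' N.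
Proof. by move=> sA sC [y h]; exists y => x /sA/h[i hi]; exists i; exact: sC. Qed.

Lemma sepn_cov A C C' N M : (forall x y, C' x -> C' y -> C (x - y)) ->
  cov A C' M -> sepn A C N -> (N <= M)%N.
Proof.
move=> hC [y hy] [x [xA xC]].
have /choice[f hf] : forall i, exists j, C' (x i - y j) by move=> i; exact: hy.
rewrite -[N]card_ord -[M]card_ord; apply: (@leq_card _ _ f) => i j fij.
apply/eqP; case: eqP => // /eqP ij; case: (xC _ _ ij).
by have := hC _ _ (hf i) (hf j); rewrite fij opprB addrA subrK.
Qed.

Lemma cov_trans A B C N M : cov A B N -> cov B C M -> cov A C (N * M).
Proof.
move=> [y hy] [z hz]; rewrite -[N]card_ord -[M]card_ord -card_prod.
apply: (@cov_fin _ _ _ (fun t => y t.1 + z t.2)) => x /hy[i /hz[j h]].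
by exists (i, j); rewrite /= opprD addrA.
Qed.

Lemma cov_scale A A' C C' c N : c != 0 ->
  (forall x, A' x -> A (c *: x)) -> (forall x, C (c *: x) -> C' x) ->
  cov A C N -> cov A' C' N.
Proof.
move=> c0 hA hC [y hy]; exists (fun i => c^-1 *: y i) => x /hA/hy[i h].
by exists i; apply: hC; rewrite scalerBr scalerA mulfV // scale1r.
Qed.

Lemma cov_lin A A' C C' (g : 'M[R]_n) N : g \in unitmx ->
  (forall x, A' x -> A (x *m g)) -> (forall x, C (x *m g) -> C' x) ->
  cov A C N -> cov A' C' N.
Proof.
move=> gu hA hC [y hy]; exists (fun i => y i *m invmx g) => x /hA/hy[i h].
by exists i; apply: hC; rewrite mulmxBl -mulmxA mulVmx // mulmx1.
Qed.

Definition maxsep A C N := sepn A C N /\ forall M, sepn A C M -> (M <= N)%N.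

Lemma maxsep_exists A C M : (forall N, sepn A C N -> (N <= M)%N) ->
  exists N, maxsep A C N.
Proof.
move=> hM; have ex : exists N, `[< sepn A C N >].
  by exists 0%N; apply/asboolP; exists (fun=> 0); split; case.
have ub N : `[< sepn A C N >] -> (N <= M)%N by move=> /asboolP/hM.
case: (ex_maxnP ex ub) => N /asboolP h1 h2; exists N; split=> // K hK.
by apply: h2; apply/asboolP.
Qed.

(** A point of A left uncovered could be added to the maximal separated set. *)
Lemma maxsep_cov A C N : C 0 -> (forall x, C x -> C (- x)) -> maxsep A C N ->
  exists y : 'I_N -> V, (forall i, A (y i)) /\ forall x, A x -> exists i, C (x - y i).
Proof.
move=> C0 Cs [[y [yA yC]] hmax]; exists y; split=> // x Ax.
apply: contrapT => /forallNP nx.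
suff /hmax : sepn A C N.+1 by rewrite ltnn.
have -> : N.+1 = #|{: option 'I_N}| by rewrite card_option card_ord.
apply: (@sepn_finT _ _ _ (fun o => if o is Some i then y i else x)) => [[i|]|] //.
move=> [i|] [j|] //= ij; first exact: yC.
by move=> /Cs; rewrite opprB; exact: nx.
Qed.

Lemma sepn_finite A C (r s : R) : (forall x, A x -> nsq x <= r ^+ 2) ->
  0 < s -> (forall x, nsq x <= s ^+ 2 -> C x) ->
  exists M, forall N, sepn A C N -> (N <= M)%N.
Proof.
move=> hA s0 hC.
(* Grid of mesh h: two points in one cell are at squared distance at most n h^2 <= s^2. *)
pose h := s / n.+1%:R; have h0 : 0 < h by rewrite divr_gt0.
pose r' := `|r|; pose K := (Num.truncn (2 * r' / h)).+1.
have xr x i : A x -> 0 <= (x 0 i + r') / h <= 2 * r' / h.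
  move=> /hA hx; have : `|x 0 i| <= r'.
    rewrite /r' -ler_sqr ?nnegrE ?normr_ge0 // !real_normK ?num_real //.
    apply: le_trans hx; rewrite /nsq (bigD1 i) //= lerDl.
    by apply: sumr_ge0 => k _; exact: sqr_ge0.
  rewrite ler_norml => /andP[h1 h2]; apply/andP; split.
    by rewrite divr_ge0 ?(ltW h0) //; lra.
  by rewrite ler_pM2r ?invr_gt0 //; lra.
exists #|{ffun 'I_n -> 'I_K}| => N [x [xA xC]].
pose f (i : 'I_N) : {ffun 'I_n -> 'I_K} := [ffun j => inord (Num.truncn ((x i 0 j + r') / h))].
rewrite -[N]card_ord; apply: (@leq_card _ _ f) => i j /ffunP fij.
apply/eqP; case: eqP => // /eqP ij; case: (xC _ _ ij); apply: hC.
have xl k : (x i - x j) 0 k ^+ 2 <= h ^+ 2.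
  have [/andP[a1 a2] /andP[b1 b2]] := (xr _ k (xA i), xr _ k (xA j)).
  have trK y : 0 <= y -> y <= 2 * r' / h -> (Num.truncn y < K)%N.
    by move=> y0 yr; rewrite ltnS; exact: le_truncn.
  have := fij k; rewrite !ffunE => /(congr1 val); rewrite /= !inordK; try exact: trK.
  have := truncn_itv a1; have := truncn_itv b1 => /andP[c1 c2] /andP[d1 d2] e.
  rewrite e in d1 d2; move: c1 c2 d1 d2; rewrite -natr1.
  rewrite ler_pdivlMr // ltr_pdivrMr // ler_pdivlMr // ltr_pdivrMr // => c1 c2 d1 d2.
  rewrite -real_normK ?num_real // !mxE ler_sqr ?nnegrE ?normr_ge0 ?(ltW h0) //.
  by rewrite ler_norml; apply/andP; split; lra.
apply: (@le_trans _ _ (\sum_(k < n) h ^+ 2)); first by apply: ler_sum => k _; exact: xl.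
rewrite sumr_const card_ord -[leLHS]mulr_natr -[leRHS]mulr1 /h exprMn -mulrA.
apply: ler_wpM2l; first exact: sqr_ge0.
rewrite exprVn mulrC ler_pdivrMr ?exprn_gt0 // mul1r.
by rewrite -natrX ler_nat (leq_trans (leqnSn n)) // expnS expn1 leq_pmulr.
Qed.

(** Entropy in natural logarithm, so that composing coverings adds exponents. *)
Definition cove A C (e : R) := exists2 N, cov A C N & N%:R <= expR e.

Lemma cove_trans A B C e f : cove A B e -> cove B C f -> cove A C (e + f).
Proof.
move=> [N h1 h2] [M h3 h4]; exists (N * M)%N; first exact: cov_trans h1 h3.
by rewrite natrM expRD; apply: ler_pM.
Qed.

Lemma cove_le A A' C C' e f : A' `<=` A -> C `<=` C' -> e <= f ->
  cove A C e -> cove A' C' f.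
Proof.
move=> sA sC ef [N h1 h2]; exists N; first exact: cov_sub h1.
by apply: le_trans h2 _; rewrite ler_expR.
Qed.

Lemma cove_scale A A' C C' c e : c != 0 ->
  (forall x, A' x -> A (c *: x)) -> (forall x, C (c *: x) -> C' x) ->
  cove A C e -> cove A' C' e.
Proof. by move=> c0 hA hC [N h1 h2]; exists N => //; exact: (cov_scale c0 hA hC h1). Qed.

Lemma cove_lin A A' C C' (g : 'M[R]_n) e : g \in unitmx ->
  (forall x, A' x -> A (x *m g)) -> (forall x, C (x *m g) -> C' x) ->
  cove A C e -> cove A' C' e.
Proof. by move=> c0 hA hC [N h1 h2]; exists N => //; exact: (cov_lin c0 hA hC h1). Qed.

Lemma cove_refl A C e : 0 <= e -> A `<=` C -> cove A C e.
Proof.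
move=> e0 AC; exists 1%N; last by rewrite -expR0 ler_expR.
by exists (fun=> 0) => x /AC Cx; exists ord0; rewrite subr0.
Qed.

Lemma sepn_cove A C e : C 0 -> (forall x, C x -> C (- x)) ->
  (forall N, sepn A C N -> N%:R <= expR e) -> cove A C e.
Proof.
move=> C0 Cs h; have [N hN] : exists N, maxsep A C N.
  apply: (maxsep_exists (M := Num.truncn (expR e))) => N /h hN.
  by rewrite truncn_ge_nat // expR_ge0.
have [y [_ hy]] := maxsep_cov C0 Cs hN.
by exists N; [exists y | exact/h/hN.1].
Qed.

End Separation.

(** * The Rademacher ell-norm of a matrix and the dual Sudakov inequality *)

Section EllNorm.
Variables (R : realType) (n : nat).
Local Notation V := 'rV[R]_n.
Local Notation J := ('I_n * 'I_n)%type.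
Local Notation cube := {ffun J -> bool}.

Definition rowrep (v : 'M[R]_n) (j : J) : V := row j.1 v.

(* Each row of [v] is used [n] times, so that [sum_l eps_(i, l) / sqrt n] plays the
   role of the i-th Gaussian coordinate. *)
Definition ellsq (p : V -> R) (v : 'M[R]_n) : R :=
  cubeavg (fun w : cube => p (radsum (rowrep v) w) ^+ 2) / n%:R.

Hypothesis n0 : (0 < n)%N.

Let nR0 : 0 < n%:R :> R. Proof. by rewrite ltr0n. Qed.

Lemma cubeavg_radsum_sqr (I : finType) (b : I -> R) :
  cubeavg (fun w : {ffun I -> bool} => (\sum_i sgn R (w i) * b i) ^+ 2) = \sum_i b i ^+ 2.
Proof.
have e i : forall w : {ffun I -> bool}, sgn R (w i) = walsh R [set i]%SET w.
  by move=> w; rewrite /walsh big_set1.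
have m0 : 2 ^+ #|I| != 0 :> R by rewrite expf_neq0.
rewrite /cubeavg; apply: (mulIf m0); rewrite divfK //.
have ex (w : {ffun I -> bool}) : (\sum_i sgn R (w i) * b i) ^+ 2 =
    \sum_i \sum_j b i * b j * (walsh R [set i]%SET w * walsh R [set j]%SET w).
  rewrite expr2 mulr_suml; apply: eq_bigr => i _; rewrite mulr_sumr.
  by apply: eq_bigr => j _; rewrite !e; ring.
rewrite (eq_bigr _ (fun w _ => ex w)) exchange_big mulr_suml /=.
apply: eq_bigr => i _; rewrite exchange_big /=.
transitivity (\sum_j b i * b j * (([set i]%SET == [set j]%SET)%:R * 2 ^+ #|I|)).
  by apply: eq_bigr => j _; rewrite -mulr_sumr walsh_orth.
rewrite (bigD1 i) //= big1 ?addr0; first by rewrite eqxx mul1r; ring.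
by move=> j nji; rewrite (inj_eq set1_inj) eq_sym (negbTE nji) mul0r mulr0.
Qed.

Lemma cubeavg_le (I : finType) (f g : {ffun I -> bool} -> R) :
  (forall w, f w <= g w) -> cubeavg f <= cubeavg g.
Proof.
move=> h; rewrite /cubeavg ler_pM2r ?invr_gt0 ?exprn_gt0 //.
by apply: ler_sum => w _; exact: h.
Qed.

Lemma cubeavg_ge0 (I : finType) (f : {ffun I -> bool} -> R) :
  (forall w, 0 <= f w) -> 0 <= cubeavg f.
Proof. by move=> h; rewrite divr_ge0 ?exprn_ge0 // sumr_ge0. Qed.

Lemma ellsq_ge0 p v : 0 <= ellsq p v.
Proof. by rewrite divr_ge0 // cubeavg_ge0 // => w; exact: sqr_ge0. Qed.

(** The weak second moment is at most the strong one: for f in C, n |f v^T|^2 is the mean square of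
    <f, Rademacher sum>, which the support function dominates pointwise. *)
Lemma supp_row_comb_le (C : set V) (v : 'M[R]_n) (a : V) : body C ->
  supp C (a *m v) ^+ 2 <= nsq a * ellsq (supp C) v.
Proof.
move=> bC; have [f Cf ->] := supp_attained (a *m v) bC.
rewrite dot_mulmx; apply: le_trans (cauchy_schwarz _ _) _.
apply: ler_wpM2l; first exact: nsq_ge0.
rewrite /ellsq ler_pdivlMr //.
have -> : nsq (f *m v^T) * n%:R = \sum_(j : J) dot (rowrep v j) f ^+ 2.
  transitivity (\sum_(i < n) \sum_(l < n) dot (rowrep v (i, l)) f ^+ 2); last first.
    by rewrite (pair_bigA _ (fun i l => dot (rowrep v (i, l)) f ^+ 2)); apply: eq_bigr => -[].
  rewrite /nsq mulr_suml; apply: eq_bigr => i _.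
  rewrite /rowrep /= sumr_const card_ord mulr_natr; congr (_ ^+ 2 *+ _).
  by rewrite mxE dotC; apply: eq_bigr => k _; rewrite !mxE.
rewrite -cubeavg_radsum_sqr; apply: cubeavg_le => w.
have -> : \sum_j sgn R (w j) * dot (rowrep v j) f = dot f (radsum (rowrep v) w).
  by rewrite dot_sumr; apply: eq_bigr => j _; rewrite dotZr dotC.
have ss := supp_seminorm bC.
rewrite -real_normK ?num_real // ler_sqr ?nnegrE ?normr_ge0 ?(seminorm_ge0 ss) //.
rewrite ler_norml dotC; apply/andP; split; last exact: le_supp.
by rewrite -(seminormN ss) lerNl -dotNl; exact: le_supp.
Qed.

(** A large separated set in the image of the ball gives separated tilted means after dilation by
    rho, and [tilted_separated_card] bounds their number by the l2 mass of the tilts. *)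
Lemma dual_sudakov (C : set V) (v : 'M[R]_n) (L t e : R) : body C ->
  0 < L -> ellsq (supp C) v <= L -> 0 < t -> 0 <= e <= 1 ->
  128 * L <= t ^+ 2 * n%:R * e ->
  cove [set x | exists2 a, nsq a <= 1 & x = a *m v] [set x | supp C x <= t] (n%:R * e).
Proof.
move=> bC L0 hL t0 /andP[e0 e1] hyp.
have ss := supp_seminorm bC; have t20 : 0 < t ^+ 2 by rewrite exprn_gt0.
have ne0 : 0 <= n%:R * e by rewrite mulr_ge0 // ltW.
(* For a small budget the diameter bound already makes a single translate enough; otherwise r2 > 1
   below absorbs the factor 16/9. *)
have [small|big] := lerP (n%:R * e) 2.
  apply: cove_refl => // _ [a ha ->] /=.
  rewrite -ler_sqr ?nnegrE ?(seminorm_ge0 ss) ?(ltW t0) //.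
  apply: le_trans (supp_row_comb_le v a bC) _.
  apply: (@le_trans _ _ (1 * L)); first by apply: ler_pM; rewrite ?nsq_ge0 ?ellsq_ge0.
  have : t ^+ 2 * n%:R * e <= t ^+ 2 * 2 by rewrite -mulrA; apply: ler_wpM2l => //; exact: ltW.
  nra.
apply: sepn_cove => /=; first by rewrite (seminorm0 ss) ltW.
  by move=> x; rewrite (seminormN ss).
move=> N [x [hx hsep]].
have /choice[a ha] : forall i, exists a, nsq a <= 1 /\ x i = a *m v.
  by move=> i; have [b b1 b2] := hx i; exists b.
set r2 := n%:R * e / 2; have r20 : 1 < r2 by rewrite /r2; lra.
set rho := Num.sqrt (n%:R * r2).
have nr2 : 0 <= n%:R * r2 by rewrite mulr_ge0 ?(ltW nR0) //; lra.
have rho2 : rho ^+ 2 = n%:R * r2 by rewrite sqr_sqrtr.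
have rho0 : 0 <= rho by exact: sqrtr_ge0.
(* Spreading the tilt over the n copies of a row keeps every entry at most 1, since rho^2 = n r2 <=
   n^2, while the squares sum to r2 |a i|^2 <= r2. *)
pose b (i : 'I_N) (j : J) := rho * a i 0 j.1 / n%:R.
have comb i : \sum_j b i j *: rowrep v j = rho *: x i.
  transitivity (\sum_(k < n) \sum_(l < n) b i (k, l) *: rowrep v (k, l)).
    by rewrite (pair_bigA _ (fun k l => b i (k, l) *: rowrep v (k, l))); apply: eq_bigr => -[].
  rewrite (ha i).2 mulmx_sum_row scaler_sumr; apply: eq_bigr => k _.
  rewrite /b /rowrep /= sumr_const card_ord -scaler_nat scalerA scalerA; congr (_ *: _).
  by field; rewrite gt_eqF.
have an i k : a i 0 k ^+ 2 <= 1.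
  apply: le_trans (ha i).1; rewrite /nsq (bigD1 k) //= lerDl.
  by apply: sumr_ge0 => l _; exact: sqr_ge0.
have r2n : r2 <= n%:R by rewrite /r2; nra.
have := @tilted_separated_card R J V (supp C) ss 'I_N b (rowrep v) (n%:R * L) (expR r2).
rewrite card_ord => main.
have : 9 / 16 * N%:R <= expR r2.
  apply: main.
  - move=> i j; rewrite -ler_sqr ?nnegrE ?normr_ge0 // real_normK ?num_real //.
    rewrite /b !exprMn rho2 expr1n exprVn ler_pdivrMr ?exprn_gt0 // mul1r.
    apply: (@le_trans _ _ (n%:R * r2 * 1)); first by apply: ler_wpM2l => //.
    by rewrite mulr1 expr2 ler_pM2l.
  - exact: mulr_gt0.
  - exact: expR_ge0.
  - by move: hL; rewrite /ellsq ler_pdivrMr // mulrC.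
  - move=> i; apply: (@le_trans _ _ (\prod_j expR (b i j ^+ 2))).
      apply: ler_prod => j _; rewrite addr_ge0 ?sqr_ge0 //=; exact: expR_ge1Dx.
    rewrite -expR_sum ler_expR.
    have -> : \sum_j b i j ^+ 2 = \sum_(k < n) \sum_(l < n) b i (k, l) ^+ 2.
      by rewrite (pair_bigA _ (fun k l => b i (k, l) ^+ 2)); apply: eq_bigr => -[].
    apply: (@le_trans _ _ (r2 * nsq (a i))); last first.
      by rewrite -[leRHS]mulr1; apply: ler_wpM2l; [lra | exact: (ha i).1].
    rewrite mulr_sumr le_eqVlt; apply/orP; left; apply/eqP; apply: eq_bigr => k _.
    rewrite /b /= sumr_const card_ord -[LHS]mulr_natr !exprMn rho2.
    by field; rewrite gt_eqF.
  - move=> i j ij; rewrite !comb -scalerBr ss.2 ger0_norm // exprMn rho2.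
    have := hsep _ _ ij; rewrite /= => /negP; rewrite -ltNge => hs.
    have hs2 : t ^+ 2 < supp C (x i - x j) ^+ 2.
      by rewrite ltr_sqr ?nnegrE ?(ltW t0) ?(seminorm_ge0 ss).
    apply: (@le_lt_trans _ _ (n%:R * r2 * t ^+ 2)); last first.
      by rewrite ltr_pM2l // mulr_gt0 //; lra.
    rewrite -!mulrA mulrCA ler_pM2l //; rewrite /r2; lra.
move=> h; have -> : n%:R * e = r2 + r2 by rewrite /r2; field.
rewrite expRD; have := expR_ge1Dx r2; nra.
Qed.

End EllNorm.

(** * The extremal position for the ell-norm *)

(** The determinant is t^n q(1/t) with q the characteristic polynomial of -A: its two leading
    coefficients give 1 + t tr A, and the others contribute O(t^2). *)
Lemma det_1D_ge (R : realType) n (A : 'M[R]_n) : (0 < n)%N ->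
  exists2 c, 0 <= c & forall t, 0 < t <= 1 -> 1 + t * \tr A - c * t ^+ 2 <= \det (1%:M + t *: A).
Proof.
case: n A => // m A _; set n := m.+1; pose q := char_poly (- A).
have sq : size q = n.+1 by exact: size_char_poly.
have qn : q`_n = 1 by have /monicP := char_poly_monic (- A); rewrite lead_coefE sq.
have qn1 : q`_m = \tr A by rewrite char_poly_trace // linearN opprK.
exists (\sum_(i < m) `|q`_i|); first by apply: sumr_ge0.
move=> t /andP[t0 t1].
have -> : \det (1%:M + t *: A) = t ^+ n * q.[t^-1].
  rewrite /q /char_poly -horner_evalE -det_map_mx -detZ; congr (\det _).
  apply/matrixP => i j; rewrite !mxE /= /horner_eval !hornerE hornerMn hornerX.
  by rewrite mulrDr opprK mulrnAr mulfV // gt_eqF.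
rewrite horner_coef sq [leRHS]mulr_sumr.
have -> : \sum_(i < n.+1) t ^+ n * (q`_i * t^-1 ^+ i) = \sum_(i < n.+1) q`_i * t ^+ (n - i).
  apply: eq_bigr => i _; rewrite mulrCA exprVn; congr (_ * _).
  by rewrite expfB_cond // gt_eqF // add0n leq_ord.
rewrite 2!big_ord_recr /= -/n qn qn1 subnn expr0 subSnn.
rewrite expr1 mulr1.
suff : - ((\sum_(i < m) `|q`_i|) * t ^+ 2) <= \sum_(i < m) q`_i * t ^+ (n - i) by lra.
rewrite mulr_suml -sumrN; apply: ler_sum => i _.
have hp : t ^+ (n - i) <= t ^+ 2.
  apply: ler_wiXn2l; rewrite ?(ltW t0) // ltn_subRL addn1 ltnS.
  exact: ltn_ord.
have h0 : 0 <= t ^+ (n - i) by rewrite exprn_ge0 // ltW.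
apply: (@le_trans _ _ (- (`|q`_i| * t ^+ (n - i)))).
  by rewrite lerN2; apply: ler_wpM2l.
by rewrite -mulNr; apply: ler_wpM2r => //; rewrite lerNl -normrN ler_norm.
Qed.

Section EllPosition.
Variables (R : realType) (n : nat).
Local Notation V := 'rV[R]_n.
Local Notation J := ('I_n * 'I_n)%type.
Local Notation cube := {ffun J -> bool}.
Hypothesis n0 : (0 < n)%N.
Variable p : V -> R.
Hypothesis pP : seminorm p.

Let nR0 : 0 < n%:R :> R. Proof. by rewrite ltr0n. Qed.

Lemma radsum_rowrep_lin (a b : R) (v z : 'M[R]_n) (w : cube) :
  radsum (rowrep (a *: v + b *: z)) w = a *: radsum (rowrep v) w + b *: radsum (rowrep z) w.
Proof.
rewrite /radsum !scaler_sumr -big_split; apply: eq_bigr => j _ /=.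
rewrite /rowrep linearD !linearZ /= scalerDr !scalerA.
by rewrite [_ * a]mulrC [_ * b]mulrC.
Qed.

Lemma ellsqZ c v : ellsq p (c *: v) = c ^+ 2 * ellsq p v.
Proof.
rewrite /ellsq /cubeavg !mulrA !mulr_sumr; congr (_ / _ / _); apply: eq_bigr => w _.
have := radsum_rowrep_lin c 0 v 0 w; rewrite !scale0r !addr0 => ->.
by rewrite pP.2 exprMn real_normK ?num_real.
Qed.

(** From (x + t y)^2 <= (1 + t)(x^2 + t y^2), a bound of first order in t that involves only squared
    norms. *)
Lemma ellsq_add_le v z t : 0 <= t ->
  ellsq p (v + t *: z) <= (1 + t) * (ellsq p v + t * ellsq p z).
Proof.
move=> t0.
pose f z (w : cube) := p (radsum (rowrep z) w) ^+ 2.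
have hf w : f (v + t *: z) w <= (1 + t) * (f v w + t * f z w).
  rewrite /f; have := radsum_rowrep_lin 1 t v z w; rewrite !scale1r => ->.
  set x := radsum _ w; set y := radsum _ w.
  have h := pP.1 x (t *: y); rewrite pP.2 ger0_norm // in h.
  have h2 : p (x + t *: y) ^+ 2 <= (p x + t * p y) ^+ 2.
    by rewrite ler_sqr ?nnegrE ?(seminorm_ge0 pP) // (le_trans _ h) // (seminorm_ge0 pP).
  by apply: le_trans h2 _; have := mulr_ge0 t0 (sqr_ge0 (p x - p y)); lra.
have -> : (1 + t) * (ellsq p v + t * ellsq p z) =
   cubeavg (fun w => (1 + t) * (f v w + t * f z w)) / n%:R.
  by rewrite /cubeavg -mulr_sumr big_split /= -mulr_sumr /ellsq /cubeavg; ring.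
by rewrite ler_pM2r ?invr_gt0 //; apply: cubeavg_le.
Qed.

Lemma ellsq_vec_continuous : continuous (fun y : 'rV[R]_(n * n) => ellsq p (vec_mx y)).
Proof.
have cw (w : cube) : continuous (fun y : 'rV[R]_(n * n) => p (radsum (rowrep (vec_mx y)) w) ^+ 2).
  pose pw (y : 'rV[R]_(n * n)) := p (radsum (rowrep (vec_mx y)) w).
  have spw : seminorm pw.
    split=> [y z|c y]; rewrite /pw.
      have := radsum_rowrep_lin 1 1 (vec_mx y) (vec_mx z) w.
      by rewrite !scale1r linearD => ->; exact: pP.1.
    have := radsum_rowrep_lin c 0 (vec_mx y) 0 w; rewrite !scale0r !addr0 linearZ /= => ->.
    exact: pP.2.
  have -> : (fun y : 'rV[R]_(n * n) => p (radsum (rowrep (vec_mx y)) w) ^+ 2) =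
     (fun y => pw y * pw y) by apply/funext => y; rewrite expr2.
  move=> y; have h := seminorm_continuous spw (x := y).
  exact: (cvgM h h).
have -> : (fun y : 'rV[R]_(n * n) => ellsq p (vec_mx y)) =
   (fun y => (\sum_w p (radsum (rowrep (vec_mx y)) w) ^+ 2) * ((2 ^+ #|{: J}|)^-1 / n%:R)).
  by apply/funext => y; rewrite /ellsq /cubeavg mulrA.
move=> y; have h1 := continuous_fsum cw (x := y).
have h2 : (fun _ : 'rV[R]_(n * n) => (2 ^+ #|{: J}|)^-1 / n%:R : R) z @[z --> y] -->
   ((2 ^+ #|{: J}|)^-1 / n%:R : R) by apply: cvg_cst; exact: nbhs_filter.
exact: (cvgM h1 h2).
Qed.

Lemma det_vec_continuous : continuous (fun y : 'rV[R]_(n * n) => \det (vec_mx y) ^+ 2).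
Proof.
have cd : continuous (fun y : 'rV[R]_(n * n) => \det (vec_mx y : 'M[R]_n)).
  apply: continuous_fsum => s y.
  have cpr : continuous (fun y : 'rV[R]_(n * n) => \prod_i (vec_mx y : 'M[R]_n) i (s i)).
    apply: continuous_fprod => i.
    under eq_fun do rewrite mxE.
    by move=> x; exact: coord_continuous.
  have h1 : (fun _ : 'rV[R]_(n * n) => (-1) ^+ s : R) z @[z --> y] --> ((-1) ^+ s : R).
    by apply: cvg_cst; exact: nbhs_filter.
  exact: (cvgM h1 (cpr y)).
under eq_fun do rewrite expr2.
by move=> y; exact: (cvgM (cd y) (cd y)).
Qed.

End EllPosition.

Section EllPosition2.
Variables (R : realType) (n : nat).
Hypothesis n0 : (0 < n)%N.
Variable C : set 'rV[R]_n.
Hypothesis bC : body C.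
Let pP := supp_seminorm bC.

(** The entries are bounded by [ellsq], so its unit ball is compact and det^2 has a maximiser there;
    homogeneity, both sides having degree 2n, extends the comparison to all z. *)
Lemma ellsq_det_max : exists v, [/\ \det v != 0, ellsq (supp C) v <= 1 &
  forall z, \det z ^+ 2 <= \det v ^+ 2 * ellsq (supp C) z ^+ n].
Proof.
pose S := [set y : 'rV[R]_(n * n) | ellsq (supp C) (vec_mx y) <= 1].
have [c c0 hc] : exists2 c, 0 < c & forall x, nsq x <= c * supp C x ^+ 2.
  by have := nsq_le_gauge (polar_body bC); rewrite gauge_polar.
have entry (v : 'M[R]_n) (i j : 'I_n) : v i j ^+ 2 <= c * ellsq (supp C) v.
  apply: (@le_trans _ _ (nsq (row i v))).
    rewrite /nsq (bigD1 j) //= !mxE lerDl.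
    by apply: sumr_ge0 => k _; exact: sqr_ge0.
  apply: le_trans (hc _) _; rewrite ler_pM2l //.
  have := supp_row_comb_le n0 v (delta_mx 0 i) bC; rewrite -rowE => h.
  apply: le_trans h _; rewrite /nsq (bigD1 i) //= big1 ?addr0.
    by rewrite mxE !eqxx expr1n mul1r.
  by move=> k /negbTE ki; rewrite mxE eqxx ki expr0n.
have S0 : S !=set0 by exists 0; rewrite /S /= linear0 -(scale0r (0 : 'M[R]_n)) ellsqZ // expr0n mul0r.
have cS : compact S.
  apply: (@compact_closed_nsq _ _ _ (Num.sqrt (\sum_(k < n * n) c))).
    by apply: closed_fun_le; exact: ellsq_vec_continuous.
  move=> y Sy; rewrite sqr_sqrtr; last by apply: sumr_ge0 => k _; exact: ltW.
  apply: ler_sum => k _; case/mxvec_indexP: k => i j.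
  have -> : y 0 (mxvec_index i j) = vec_mx y i j by rewrite mxE.
  by apply: le_trans (entry _ _ _) _; rewrite -[leRHS]mulr1 ler_pM2l.
have [y + hmax] := EVT_max_rV S0 cS (continuous_subspaceT (@det_vec_continuous R n)).
rewrite inE => Sy; exists (vec_mx y); split=> //.
  have q1 : 0 <= ellsq (supp C) 1%:M by exact: ellsq_ge0.
  set s := Num.sqrt (ellsq (supp C) 1%:M + 1).
  have s0 : 0 < s by rewrite sqrtr_gt0 ltr_wpDl.
  have := hmax (mxvec (s^-1 *: 1%:M)); rewrite inE /S /= mxvecK.
  rewrite ellsqZ // exprVn sqr_sqrtr ?addr_ge0 // mulrC ler_pdivrMr ?ltr_wpDl // mul1r lerDl.
  move=> /(_ ler01); rewrite detZ det1 mulr1 => h.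
  apply/negP => /eqP d0; move: h; rewrite d0 expr0n /= leNgt exprn_gt0 //.
  by rewrite exprn_gt0 // invr_gt0.
move=> z; have q0 : 0 <= ellsq (supp C) z by exact: ellsq_ge0.
have [qz|qn] := eqVneq (ellsq (supp C) z) 0.
  have -> : z = 0.
    apply/matrixP => i j; rewrite mxE; apply/eqP; rewrite -sqrf_eq0.
    by rewrite eq_le sqr_ge0 andbT; have := entry z i j; rewrite qz mulr0.
  by rewrite -(scale0r (0 : 'M[R]_n)) detZ expr0n gtn_eqF // mul0r expr0n /=
     mulr_ge0 ?sqr_ge0 // exprn_ge0 // ellsq_ge0.
have qp : 0 < ellsq (supp C) z by rewrite lt_neqAle eq_sym qn.
set q := ellsq (supp C) z in q0 qn qp *; set s := Num.sqrt q.
have s2 : s ^+ 2 = q by rewrite sqr_sqrtr.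
have s0 : 0 < s by rewrite sqrtr_gt0.
have := hmax (mxvec (s^-1 *: z)); rewrite inE /S /= mxvecK ellsqZ // -/q exprVn s2 mulVf //.
move=> /(_ (lexx _)); rewrite detZ exprMn -exprM mulnC exprM exprVn s2 exprVn mulrC.
by rewrite ler_pdivrMr ?exprn_gt0.
Qed.

Lemma expR_le_quad (x : R) : 0 <= x <= 1 / 2 -> expR x <= 1 + x + 2 * x ^+ 2.
Proof.
move=> /andP[x0 x1]; have h := expR_ge1Dx (- x).
have e0 := expR_gt0 x.
have : expR x * (1 - x) <= 1.
  by rewrite -[leRHS](expRxMexpNx_1 x); apply: ler_wpM2l => //; exact: ltW.
have hx : 0 <= x ^+ 2 * (1 - 2 * x) by rewrite mulr_ge0 ?sqr_ge0 //; lra.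
move=> h2; have x1' : 0 < 1 - x by lra.
rewrite -(ler_pM2r x1'); apply: le_trans h2 _; nra.
Qed.

(** Lewis's argument: the first-order term in t of det(v + t z)^2 <= det(v)^2 ellsq(v + t z)^n,
    taken at the maximiser v. *)
Lemma ell_position : exists2 v, v \in unitmx &
  ellsq (supp C) v <= 1 /\
  forall z, 2 * \tr (invmx v *m z) <= n%:R * (1 + ellsq (supp C) z).
Proof.
have [v [dv ev hv]] := ellsq_det_max.
have vu : v \in unitmx by rewrite unitmxE unitfE.
exists v => //; split=> // z; set A := invmx v *m z; set q := ellsq (supp C) z.
have q0 : 0 <= q by exact: ellsq_ge0.
have nR0 : 0 < n%:R :> R by rewrite ltr0n.
have [c c0 hc] := det_1D_ge A n0.
set X := n%:R * (1 + q); have X0 : 0 < X by rewrite mulr_gt0 // ltr_wpDr.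
have key t : 0 < t <= 1 -> t * X <= 1 -> \tr A - X / 2 <= t * (c + X ^+ 2 / 2).
  move=> t01 tX; have /andP[t0 t1] := t01.
  have e1 : \det (v + t *: z) = \det v * \det (1%:M + t *: A).
    by rewrite -det_mulmx mulmxDr mulmx1 -scalemxAr /A mulmxA mulmxV // mul1mx.
  have := hv (v + t *: z); rewrite e1 exprMn ler_pM2l; last first.
    by rewrite lt_neqAle sqr_ge0 andbT eq_sym sqrf_eq0.
  move=> h1.
  have h2 : ellsq (supp C) (v + t *: z) <= expR (t * (1 + q)).
    apply: le_trans (ellsq_add_le n0 pP _ _ (ltW t0)) _; rewrite -/q.
    apply: (@le_trans _ _ ((1 + t) * (1 + t * q))).
      by apply: ler_wpM2l; [lra | rewrite lerD2r].
    rewrite [t * (1 + q)]mulrDr mulr1 expRD; apply: ler_pM; rewrite ?expR_ge1Dx //; first lra.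
    by rewrite addr_ge0 // mulr_ge0 // ltW.
  have h3 : \det (1%:M + t *: A) ^+ 2 <= expR (t * X / 2) ^+ 2.
    apply: le_trans h1 _; apply: (@le_trans _ _ (expR (t * (1 + q)) ^+ n)).
      by apply: lerXn2r; rewrite ?nnegrE ?ellsq_ge0 ?expR_ge0.
    by rewrite -!expRM_natl ler_expR /X; lra.
  have h4 : \det (1%:M + t *: A) <= expR (t * X / 2).
    apply: le_trans (ler_norm _) _.
    by rewrite -ler_sqr ?nnegrE ?normr_ge0 ?expR_ge0 // real_normK ?num_real.
  have h5 : expR (t * X / 2) <= 1 + t * X / 2 + 2 * (t * X / 2) ^+ 2.
    apply: expR_le_quad; apply/andP; split; last by lra.
    by rewrite divr_ge0 // mulr_ge0 // ltW.
  have h6 := le_trans (hc t t01) (le_trans h4 h5).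
  rewrite -(ler_pM2l t0); lra.
rewrite leNgt; apply/negP => lt.
set d := \tr A - X / 2; have d0 : 0 < d by rewrite /d; lra.
set Y := c + X ^+ 2 / 2; have Y0 : 0 <= Y by rewrite addr_ge0 // divr_ge0 // sqr_ge0.
(* Small enough for [key] to apply, and with t Y < d, which contradicts its conclusion. *)
pose t := d / ((1 + d) * (1 + X) * (1 + Y)).
have D0 : 0 < (1 + d) * (1 + X) * (1 + Y) by rewrite !mulr_gt0 //; lra.
have t0 : 0 < t by rewrite divr_gt0.
have dX : 0 < d * X by exact: mulr_gt0.
have dY : 0 <= d * Y by apply: mulr_ge0 => //; exact: ltW.
have XY : 0 <= X * Y by apply: mulr_ge0 => //; exact: ltW.
have dXY : 0 <= d * X * Y by apply: mulr_ge0 => //; exact: ltW.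
have t1 : t <= 1 by rewrite ler_pdivrMr // mul1r; lra.
have tX : t * X <= 1 by rewrite mulrAC ler_pdivrMr // mul1r; lra.
have := key t; rewrite t0 t1 => /(_ isT tX); rewrite -/d -/Y leNgt.
by rewrite mulrAC ltr_pdivrMr // => /negP; apply; nra.
Qed.

End EllPosition2.

(** * Trace duality: the dual ell-norm in extremal position *)

Section CubeMore.
Variables (R : realType) (I : finType).
Local Notation cube := {ffun I -> bool}.

Lemma cubeavg_reindex (s : I -> I) (f : cube -> R) : injective s ->
  cubeavg (fun w => f [ffun i => w (s i)]) = cubeavg f.
Proof.
move=> si; rewrite /cubeavg; congr (_ / _).
have hinj : injective (fun w : cube => [ffun i => w (s i)] : cube).
  move=> w w' /ffunP h; apply/ffunP => i; have [s' s1 s2] := injF_bij si.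
  by have := h (s' i); rewrite !ffunE s2.
by rewrite [RHS](reindex_inj hinj).
Qed.

Lemma cubeavg_dot_radsum n (u : I -> 'rV[R]_n) (H : cube -> 'rV[R]_n) :
  cubeavg (fun w => dot (radsum u w) (H w)) = \sum_i dot (u i) (radcoef H i).
Proof.
rewrite /cubeavg mulr_suml.
under eq_bigr do rewrite dotC dot_sumr mulr_suml.
rewrite exchange_big /=; apply: eq_bigr => i _.
rewrite /radcoef dotZr dot_sumr mulr_sumr; apply: eq_bigr => w _.
by rewrite dotZr dotZr dotC; ring.
Qed.

End CubeMore.

Lemma trace_mul_dot (R : realType) n (A z : 'M[R]_n) :
  \tr (A *m z) = \sum_i dot (row i A^T) (row i z).
Proof.
rewrite /mxtrace; under eq_bigr do rewrite mxE.
rewrite exchange_big /=; apply: eq_bigr => j _.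
by apply: eq_bigr => i _; rewrite !mxE.
Qed.

Section DualBound.
Variable R : realType.

(** Averaging a family over the copies of each row does not increase the second moment: the averaged
    family is the mean of the cyclic shifts [sh c] of [h], each of which has the same distribution,
    and Jensen applies. *)
Lemma ellsq_row_average m (p : 'rV[R]_m.+1 -> R)
    (h : 'I_m.+1 * 'I_m.+1 -> 'rV[R]_m.+1) : seminorm p ->
  ellsq p (\matrix_(i < m.+1) (m.+1%:R^-1 *: \sum_l h (i, l)))
  <= cubeavg (fun w => p (radsum h w) ^+ 2) / m.+1%:R.
Proof.
move=> pP; set n := m.+1; have nR0 : 0 < n%:R :> R by rewrite ltr0n.
rewrite /ellsq ler_pM2r ?invr_gt0 //; set z := \matrix_(i < n) _.
pose sh (c : 'I_n) (j : 'I_n * 'I_n) := (j.1, j.2 + c).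
have shi c : injective (sh c).
  move=> [a b] [a' b'] eq_sh; have /= -> := congr1 fst eq_sh.
  by have /= /addIr -> := congr1 snd eq_sh.
have e w : radsum (rowrep z) w = \sum_(c : 'I_n) n%:R^-1 *: radsum (fun j => h (sh c j)) w.
  rewrite /radsum; under [RHS]eq_bigr do rewrite scaler_sumr.
  rewrite exchange_big /=; apply: eq_bigr => -[i l] _.
  rewrite /rowrep rowK /= !scaler_sumr (reindex_inj (addrI l)) /=.
  by apply: eq_bigr => c _; rewrite !scalerA [sgn _ _ * _]mulrC.
have -> : cubeavg (fun w => p (radsum h w) ^+ 2) =
   \sum_(c : 'I_n) n%:R^-1 * cubeavg (fun w => p (radsum h w) ^+ 2).
  by rewrite sumr_const card_ord -[RHS]mulr_natr mulrAC mulVf ?mul1r // gt_eqF.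
apply: (@le_trans _ _ (\sum_(c : 'I_n) n%:R^-1 *
    cubeavg (fun w => p (radsum (fun j => h (sh c j)) w) ^+ 2))).
  rewrite /cubeavg; under [leRHS]eq_bigr do rewrite mulrA mulr_sumr.
  rewrite -mulr_suml exchange_big /= ler_pM2r ?invr_gt0 ?exprn_gt0 //.
  apply: ler_sum => w _; rewrite e; apply: seminorm_jensen2 => //.
  by rewrite sumr_const card_ord -[LHS]mulr_natr mulVf // gt_eqF.
apply: ler_sum => c _; rewrite ler_pM2l ?invr_gt0 //.
rewrite le_eqVlt; apply/orP; left; apply/eqP.
rewrite -[RHS](cubeavg_reindex _ (shi (- c))); congr (cubeavg _); apply/funext => w.
congr (p _ ^+ 2); rewrite /radsum [RHS](reindex_inj (shi c)) /=.
by apply: eq_bigr => -[i l] _; rewrite ffunE /sh /= addrK.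
Qed.

(** The dual ell-norm is realised by norming points [b w]; their Rademacher projection gives a
    matrix z with large trace against v^-1 and, by K-convexity with r^2 d = 1, controlled ell-norm.
    The extremality of v compares the two. *)
Lemma ell_dual_bound n (B : set 'rV[R]_n) (v g : 'M[R]_n) (r d : R) :
  (0 < n)%N -> body B -> v \in unitmx -> 0 < r <= 1 -> r ^+ 2 * d = 1 ->
  (forall x, gauge B x ^+ 2 <= nsq (x *m g)) ->
  (forall x, nsq (x *m g) <= d ^+ 2 * gauge B x ^+ 2) ->
  (forall z, 2 * \tr (invmx v *m z) <= n%:R * (1 + ellsq (gauge B) z)) ->
  ellsq (supp B) (invmx v)^T <= 9 * d * n%:R ^+ 2.
Proof.
case: n B v g => // m; set n := m.+1 => B v g _ bB vu /andP[r0 r1] rd ple lep hz.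
have nR0 : 0 < n%:R :> R by rewrite ltr0n.
have gs := gauge_seminorm bB; have ss := supp_seminorm bB.
have d0 : 0 < d by rewrite -(pmulr_rgt0 d (exprn_gt0 2 r0)) rd.
pose u := rowrep (invmx v)^T; pose W (w : {ffun 'I_n * 'I_n -> bool}) := radsum u w.
have /choice[b hb] : forall w, exists x, B x /\ supp B (W w) = dot (W w) x.
  by move=> w; have [x h1 h2] := supp_attained (W w) bB; exists x.
set q := ellsq (supp B) (invmx v)^T.
have q0 : 0 <= q by exact: ellsq_ge0.
have nq : cubeavg (fun w => supp B (W w) ^+ 2) = n%:R * q.
  by rewrite /q /ellsq mulrC divfK // gt_eqF.
(* This scaling turns the extremality inequality into 2 c q <= n + c q, hence q <= n / c = 9 d
   n^2. *)
pose c := (n%:R * (9 * d))^-1.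
have c0 : 0 < c by rewrite invr_gt0 !mulr_gt0.
pose H w := (c * supp B (W w)) *: b w.
have avgH : cubeavg (fun w => gauge B (H w) ^+ 2) <= c ^+ 2 * (n%:R * q).
  rewrite -nq /cubeavg mulrA mulr_sumr ler_pM2r ?invr_gt0 ?exprn_gt0 //.
  apply: ler_sum => w _; rewrite gs.2 exprMn real_normK ?num_real // exprMn.
  rewrite -[leRHS]mulr1; apply: ler_wpM2l; first by rewrite mulr_ge0 ?sqr_ge0.
  have /(gauge_le1 _ bB) h1 := (hb w).1.
  by have := seminorm_ge0 gs (b w); nra.
pose z : 'M[R]_n := \matrix_(i < n) (n%:R^-1 *: \sum_l radcoef H (i, l)).
have ez : ellsq (gauge B) z <= 9 * d * (c ^+ 2 * q).
  apply: le_trans (ellsq_row_average _ gs) _.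
  rewrite ler_pdivrMr //.
  have := @radproj_bound R _ n (gauge B) g d gs ple lep H r.
  rewrite (ltW r0) r1 => /(_ isT).
  have -> : r ^+ 4 * d ^+ 2 = 1.
    by have -> : r ^+ 4 * d ^+ 2 = (r ^+ 2 * d) ^+ 2; [ring | rewrite rd expr1n].
  move=> h1.
  have h2 : cubeavg (fun w => gauge B (radsum (radcoef H) w) ^+ 2)
     <= 9 * d * cubeavg (fun w => gauge B (H w) ^+ 2).
    rewrite -(ler_pM2l (exprn_gt0 2 r0)); apply: le_trans h1 _.
    have -> : r ^+ 2 * (9 * d * cubeavg (fun w => gauge B (H w) ^+ 2)) =
      (r ^+ 2 * d) * 9 * cubeavg (fun w => gauge B (H w) ^+ 2) by ring.
    by rewrite rd; lra.
  apply: le_trans h2 _; rewrite -[leRHS]mulrA ler_pM2l ?mulr_gt0 //.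
  by apply: le_trans avgH _; rewrite -/n -[leRHS]mulrA [q * n%:R]mulrC.
have trz : \tr (invmx v *m z) = c * q.
  have : n%:R * \tr (invmx v *m z) = n%:R * (c * q).
    have -> : n%:R * (c * q) = cubeavg (fun w => dot (W w) (H w)).
      rewrite mulrCA -nq /cubeavg mulrA mulr_sumr; congr (_ / _).
      by apply: eq_bigr => w _; rewrite /H dotZr -(hb w).2; ring.
    rewrite cubeavg_dot_radsum.
    transitivity (\sum_(i < n) \sum_(l < n) dot (u (i, l)) (radcoef H (i, l))); last first.
      by rewrite (pair_bigA _ (fun i l => dot (u (i, l)) (radcoef H (i, l)))); apply: eq_bigr => -[].
    rewrite trace_mul_dot mulr_sumr; apply: eq_bigr => i _.
    rewrite rowK dotZr mulrA mulfV ?gt_eqF // mul1r dot_sumr.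
    by apply: eq_bigr => l _.
  by apply: mulfI; rewrite gt_eqF.
have := hz z; rewrite trz => h.
have h2 : 2 * (c * q) <= n%:R * (1 + 9 * d * (c ^+ 2 * q)).
  by apply: le_trans h _; rewrite ler_pM2l // lerD2l.
have e9 : n%:R * (9 * d) * c = 1 by rewrite mulfV // gt_eqF // !mulr_gt0.
have h3 : c * q <= n%:R.
  have : n%:R * (9 * d * (c ^+ 2 * q)) = c * q.
    have -> : n%:R * (9 * d * (c ^+ 2 * q)) = n%:R * (9 * d) * c * (c * q) by ring.
    by rewrite e9 mul1r.
  by move=> e; rewrite mulrDr mulr1 e in h2; lra.
have : n%:R * (9 * d) * (c * q) <= n%:R * (9 * d) * n%:R by rewrite ler_pM2l // !mulr_gt0.
rewrite [n%:R * (9 * d) * (c * q)]mulrA e9 mul1r => h4; lra.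
Qed.

End DualBound.

(** * Ellipsoids, Minkowski sums and the truncation step *)

Section Ellipsoids.
Variables (R : realType) (n : nat).
Local Notation V := 'rV[R]_n.
Implicit Types (A B C : set V) (g : 'M[R]_n).

Definition ell g : set V := [set x | nsq (x *m g) <= 1].

Lemma mulmx_row_dot (x : V) g k : (x *m g) 0 k = dot (row k g^T) x.
Proof. by rewrite mxE dotC; apply: eq_bigr => i _; rewrite !mxE. Qed.

Lemma nsq_mulmx_le g : exists2 c, 0 < c & forall x : V, nsq (x *m g) <= c ^+ 2 * nsq x.
Proof.
pose s := \sum_k nsq (row k g^T); have s0 : 0 <= s by apply: sumr_ge0 => k _; exact: nsq_ge0.
exists (s + 1) => [|x]; first by rewrite ltr_wpDl.
apply: (@le_trans _ _ (s * nsq x)).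
  rewrite {1}/nsq mulr_suml; apply: ler_sum => k _.
  by rewrite mulmx_row_dot; exact: cauchy_schwarz.
by apply: ler_wpM2r; [exact: nsq_ge0 | nra].
Qed.

Lemma continuous_nsq_mulmx g : continuous (fun x : V => nsq (x *m g)).
Proof.
apply: continuous_fsum => k y.
have -> : (fun x : V => (x *m g) 0 k ^+ 2) =
    (fun x => dot (row k g^T) x * dot (row k g^T) x).
  by apply/funext => x; rewrite mulmx_row_dot expr2.
have h := continuous_dot (f := row k g^T) (x := y).
exact: (cvgM h h).
Qed.

Lemma ell_body g : g \in unitmx -> body (ell g).
Proof.
move=> gu; have [c c0 hc] := nsq_mulmx_le (invmx g); have [c' c'0 hc'] := nsq_mulmx_le g.
split.
- apply: (@compact_closed_nsq _ _ _ c).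
    by apply: closed_fun_le; exact: continuous_nsq_mulmx.
  move=> x hx; have := hc (x *m g); rewrite mulmxK // => h; apply: le_trans h _.
  by rewrite -[leRHS]mulr1; apply: ler_wpM2l => //; exact: sqr_ge0.
- move=> x y t hx hy t01; rewrite /ell /= mulmxDl -!scalemxAl.
  apply: le_trans (nsq_convex _ _ t01) _; have /andP[t0 t1] := t01.
  have h1 : t * nsq (x *m g) <= t * 1 by apply: ler_wpM2l.
  have h2 : (1 - t) * nsq (y *m g) <= (1 - t) * 1 by apply: ler_wpM2l; rewrite ?subr_ge0.
  lra.
- by move=> x hx; rewrite /ell /= mulNmx nsqN.
- exists c'^-1; first by rewrite invr_gt0.
  move=> x hx; rewrite /ell /=; apply: le_trans (hc' x) _.
  apply: (@le_trans _ _ (c' ^+ 2 * c'^-1 ^+ 2)); first by rewrite ler_pM2l ?exprn_gt0.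
  by rewrite -exprMn mulfV ?expr1n // gt_eqF.
Qed.

Lemma polar_ell g : g \in unitmx -> polar (ell g) = ell (invmx g)^T.
Proof.
move=> gu; apply/seteqP; split=> [f hf|f hf x hx].
  rewrite /ell /=; set h := f *m _; have [h0|hn0] := eqVneq (nsq h) 0; first by rewrite h0.
  have hp : 0 < nsq h by rewrite lt_neqAle eq_sym hn0 nsq_ge0.
  set s := Num.sqrt (nsq h); have s0 : 0 < s by rewrite sqrtr_gt0.
  have sE : nsq h = s ^+ 2 by rewrite sqr_sqrtr // ltW.
  have : dot f ((s^-1 *: h) *m invmx g) <= 1.
    apply: hf; rewrite /ell /= mulmxKV // nsqZ sE exprVn mulVf //.
    by rewrite expf_neq0 // gt_eqF.
  rewrite dotC dot_mulmx -/h dotZl -nsqE sE expr2 mulrA mulVf ?gt_eqF // mul1r => hs.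
  by rewrite mulr_ile1 // ltW.
have -> : dot f x = dot (f *m (invmx g)^T) (x *m g).
  by rewrite dotC [RHS]dotC dot_mulmx -mulmxA -trmx_mul mulmxV // trmx1 mulmx1.
have h1 : nsq (f *m (invmx g)^T) <= 1 ^+ 2 by rewrite expr1n.
have h2 : nsq (x *m g) <= 1 ^+ 2 by rewrite expr1n.
by have := dot_le ler01 ler01 h1 h2; rewrite mulr1.
Qed.

Lemma setI_body A B : body A -> body B -> body (A `&` B).
Proof.
move=> bA bB; have [cA vA sA [r r0 hr]] := bA; have [cB vB sB [s s0 hs]] := bB.
split.
- have [M M0 hM] := body_bounded bA.
  apply: (@compact_closed_nsq _ _ _ M) => [|x [Ax _]]; last exact: hM.
  by apply: closedI; exact: body_closed.
- by move=> x y t [Ax Bx] [Ay By] t01; split; [exact: vA | exact: vB].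
- by move=> x [Ax Bx]; split; [exact: sA | exact: sB].
- have m0 : 0 < Num.min r s by rewrite lt_min r0.
  exists (Num.min r s) => // x hx; split.
    by apply: hr; apply: le_trans hx _; apply: lerXn2r; rewrite ?nnegrE ?(ltW m0) ?(ltW r0) // ge_min lexx.
  by apply: hs; apply: le_trans hx _; apply: lerXn2r; rewrite ?nnegrE ?(ltW m0) ?(ltW s0) // ge_min lexx orbT.
Qed.

Definition msum A B : set V := [set z | exists x y, [/\ A x, B y & z = x + y]].

Lemma msum_body A B : body A -> body B -> body (msum A B).
Proof.
move=> bA bB; have [cA vA sA [r r0 hr]] := bA; have [cB vB sB _] := bB.
split.
- have -> : msum A B = [set z.1 + z.2 | z in A `*` B].
    apply/seteqP; split=> [_ [x [y [Ax By ->]]]|_ [[x y] [/= Ax By] <-]].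
      by exists (x, y).
    by exists x, y.
  apply: continuous_compact; last exact: compact_setX.
  by apply: continuous_subspaceT; exact: add_continuous.
- move=> _ _ t [x [y [Ax By ->]]] [x' [y' [Ax' By' ->]]] t01.
  exists (t *: x + (1 - t) *: x'), (t *: y + (1 - t) *: y'); split.
  + exact: vA.
  + exact: vB.
  + by rewrite !scalerDr addrACA.
- move=> _ [x [y [Ax By ->]]]; exists (- x), (- y); split; [exact: sA|exact: sB|].
  by rewrite opprD.
- exists r => // x hx; exists x, 0; split; [exact: hr|exact: body0|by rewrite addr0].
Qed.

Lemma cove_msum A B C C' e : (forall x y, A x -> C y -> C' (x + y)) ->
  cove B C e -> cove (msum A B) C' e.
Proof.
move=> h [N [y hy] hN]; exists N => //; exists y => _ [a [b [Aa /hy[i hi] ->]]].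
by exists i; rewrite -addrA; exact: h.
Qed.

(** The right side is a body, hence its own bipolar, and its polar lies in both A and B. *)
Lemma polar_setI_sub A B : body A -> body B -> polar (A `&` B) `<=` msum (polar A) (polar B).
Proof.
move=> bA bB; have bm := msum_body (polar_body bA) (polar_body bB).
rewrite -(bipolar bm) => f hf x hx; apply: hf; split.
  rewrite -(bipolar bA) => c pc; apply: hx; exists c, 0; split=> //; last by rewrite addr0.
  by apply: body0; exact: polar_body.
rewrite -(bipolar bB) => c pc; apply: hx; exists 0, c; split=> //; last by rewrite add0r.
by apply: body0; exact: polar_body.
Qed.

Lemma gauge_ell_bounds B g (d : R) : body B -> g \in unitmx -> 0 <= d ->
  ell g `<=` B -> (forall x, B x -> nsq (x *m g) <= d ^+ 2) ->
  (forall x, gauge B x ^+ 2 <= nsq (x *m g)) /\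
  (forall x, nsq (x *m g) <= d ^+ 2 * gauge B x ^+ 2).
Proof.
move=> bB gu d0 hin hout; have gs := gauge_seminorm bB; split=> x.
  have [x0|xn0] := eqVneq (nsq (x *m g)) 0.
    move/eqP: (x0); rewrite nsq_eq0 => /eqP xg.
    by rewrite -(mulmxK gu x) xg mul0mx (seminorm0 gs) expr0n mul0mx nsq0.
  have xp : 0 < nsq (x *m g) by rewrite lt_neqAle eq_sym xn0 nsq_ge0.
  set s := Num.sqrt (nsq (x *m g)); have s0 : 0 < s by rewrite sqrtr_gt0.
  have sE : nsq (x *m g) = s ^+ 2 by rewrite sqr_sqrtr // ltW.
  rewrite sE ler_sqr ?nnegrE ?(seminorm_ge0 gs) ?(ltW s0) //.
  apply/(gauge_le _ bB s0); apply: hin; rewrite /ell /= -scalemxAl nsqZ sE exprVn mulVf //.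
  by rewrite expf_neq0 // gt_eqF.
have [g0|gn0] := eqVneq (gauge B x) 0.
  have [c c0 hc] := nsq_le_gauge bB.
  have : nsq x <= 0 by apply: le_trans (hc x) _; rewrite g0 expr0n mulr0.
  rewrite le_eqVlt ltNge nsq_ge0 orbF nsq_eq0 => /eqP ->.
  by rewrite mul0mx nsq0 mulr_ge0 ?sqr_ge0.
have gp : 0 < gauge B x by rewrite lt_neqAle eq_sym gn0 (seminorm_ge0 gs).
have /(gauge_le _ bB gp)/hout := lexx (gauge B x).
rewrite -scalemxAl nsqZ exprVn mulrC ler_pdivrMr //.
by rewrite exprn_gt0.
Qed.

(** With v in extremal position, B' = (B ∩ a Dv) + b^-1 Dv. Dual Sudakov for [gauge B] covers the
    added ellipsoid by translates of de B, and for [supp B] it covers the polar of the cutting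
    ellipsoid by translates of de B°. The new body lies between b^-1 Dv and (ab + 1) b^-1 Dv. *)
Lemma truncation B g (r d e de : R) : (0 < n)%N -> body B -> g \in unitmx ->
  0 < r <= 1 -> r ^+ 2 * d = 1 -> 0 < e <= 1 -> 0 < de ->
  ell g `<=` B -> (forall x, B x -> nsq (x *m g) <= d ^+ 2) ->
  exists B' g', [/\ body B' /\ g' \in unitmx, ell g' `<=` B',
    forall x, B' x -> nsq (x *m g') <= (384 / (r * de ^+ 2 * e) + 1) ^+ 2,
    cove B' [set x | gauge B x <= 1 + de] (n%:R * e) &
    cove (polar B') [set f | supp B f <= 1 + de] (n%:R * e)].
Proof.
move=> n0 bB gu r01 rd /andP[e0 e1] de0 hin hout.
have /andP[r0 r1] := r01; have nR0 : 0 < n%:R :> R by rewrite ltr0n.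
have d0 : 0 < d by rewrite -(pmulr_rgt0 d (exprn_gt0 2 r0)) rd.
have [ple lep] := gauge_ell_bounds bB gu (ltW d0) hin hout.
have [v vu [ev hz]] := ell_position n0 (polar_body bB).
have dual := ell_dual_bound n0 bB vu r01 rd ple lep hz.
(* Equality in the hypothesis of [dual_sudakov] with L = 1 and level b de. *)
pose b := Num.sqrt (128 / (de ^+ 2 * n%:R * e)).
have D0 : 0 < de ^+ 2 * n%:R * e by rewrite !mulr_gt0 ?exprn_gt0.
have b0 : 0 < b by rewrite sqrtr_gt0 divr_gt0.
have b2 : b ^+ 2 * (de ^+ 2 * n%:R * e) = 128.
  by rewrite sqr_sqrtr ?divfK ?gt_eqF // ltW // divr_gt0.
(* The product a b for which [a2] below is equality in [dual_sudakov] with L = 9 d n^2 and level a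
   de; 384 = 128 * 3 and 1/r = sqrt d. *)
pose ab := 384 / (r * de ^+ 2 * e).
have D1 : 0 < r * de ^+ 2 * e by rewrite !mulr_gt0 ?exprn_gt0.
have ab0 : 0 < ab by rewrite divr_gt0.
have abE : ab * (r * de ^+ 2 * e) = 384 by rewrite divfK // gt_eqF.
pose a := ab / b; have a0 : 0 < a by rewrite divr_gt0.
have aE : a * b = ab by rewrite divfK // gt_eqF.
have a2 : 128 * (9 * d * n%:R ^+ 2) = (a * de) ^+ 2 * n%:R * e.
  have e3 : (b ^+ 2 * (de ^+ 2 * n%:R * e)) * ((a * de) ^+ 2 * n%:R * e) * r ^+ 2
     = (a * b * (r * de ^+ 2 * e)) ^+ 2 * n%:R ^+ 2 by ring.
  rewrite aE abE b2 in e3.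
  have r20 : r ^+ 2 != 0 by rewrite expf_neq0 // gt_eqF.
  apply: (mulIf r20); have -> : 128 * (9 * d * n%:R ^+ 2) * r ^+ 2 = 128 * 9 * (r ^+ 2 * d) * n%:R ^+ 2 by ring.
  by rewrite rd; lra.
have an0 : a != 0 by rewrite gt_eqF.
have bn0 : b != 0 by rewrite gt_eqF.
have viu : invmx v \in unitmx by rewrite unitmx_inv.
have u1 : a^-1 *: invmx v \in unitmx by rewrite unitmxZ // unitfE invr_eq0.
have u2 : b *: invmx v \in unitmx by rewrite unitmxZ // unitfE.
pose E1 := ell (a^-1 *: invmx v); pose E2 := ell (b *: invmx v).
have bE1 : body E1 by exact: ell_body.
have bE2 : body E2 by exact: ell_body.
have bI : body (B `&` E1) by exact: setI_body.
have gs := gauge_seminorm bB; have ss := supp_seminorm bB.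
exists (msum (B `&` E1) E2), (b *: invmx v); split.
- by split=> //; exact: msum_body.
- by move=> x hx; exists 0, x; split=> //; rewrite ?add0r //; exact: body0.
- move=> _ [x [y [[_ hx] hy ->]]]; rewrite /E1 /E2 /ell /= in hx hy.
  rewrite mulmxDl; apply: (@nsqD_le _ _ _ _ ab 1); rewrite ?(ltW ab0) ?expr1n //.
  have -> : x *m (b *: invmx v) = ab *: (x *m (a^-1 *: invmx v)).
    by rewrite -!scalemxAr scalerA -aE; congr (_ *: _); field.
  by rewrite nsqZ -[leRHS]mulr1; apply: ler_wpM2l => //; exact: sqr_ge0.
- apply: (@cove_msum _ _ [set x | gauge B x <= de]).
    move=> x y [/(gauge_le1 _ bB) hx _] /= hy; apply: le_trans (gs.1 _ _) _; exact: lerD.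
  have h : cove [set x | exists2 c, nsq c <= 1 & x = c *m v]
     [set x | supp (polar B) x <= b * de] (n%:R * e).
    apply: (@dual_sudakov _ _ n0 _ v 1) => //; first exact: polar_body.
    - exact: mulr_gt0.
    - by rewrite (ltW e0).
    - by rewrite mulr1 -b2 exprMn; lra.
  apply: (@cove_scale _ _ _ _ _ _ b _ bn0 _ _ h) => x /=.
    move=> hx; exists (x *m (b *: invmx v)) => //.
    by rewrite -scalemxAr -scalemxAl mulmxKV.
  by rewrite -/(gauge B) gs.2 (gtr0_norm b0) ler_pM2l.
- apply: (@cove_le _ _ (msum (polar B) (polar E1)) _ [set f | supp B f <= 1 + de] _ (n%:R * e)) => //.
    move=> f hf; apply: polar_setI_sub => // x hx; apply: hf.
    by exists x, 0; split=> //; rewrite ?addr0 //; exact: body0.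
  apply: (@cove_msum _ _ [set x | supp B x <= de]).
    move=> x y /(supp_le1 _ bB) hx /= hy; apply: le_trans (ss.1 _ _) _; exact: lerD.
  have h : cove [set x | exists2 c, nsq c <= 1 & x = c *m (invmx v)^T]
     [set x | supp B x <= a * de] (n%:R * e).
    apply: (@dual_sudakov _ _ n0 _ _ (9 * d * n%:R ^+ 2)) => //.
    - by rewrite !mulr_gt0 ?exprn_gt0.
    - exact: mulr_gt0.
    - by rewrite (ltW e0).
    - by rewrite a2.
  apply: (@cove_scale _ _ _ _ _ _ a _ an0 _ _ h) => x /=; last first.
    by rewrite ss.2 (gtr0_norm a0) ler_pM2l.
  rewrite /E1 polar_ell // invmxZ ?unitfE ?invr_eq0 // invrK invmxK /ell /=.
  move=> hx; exists (x *m (a *: v)^T) => //.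
  by rewrite linearZ /= -scalemxAr -scalemxAl -mulmxA -trmx_mul mulVmx // trmx1 mulmx1.
Qed.

End Ellipsoids.

(** * Existence of regular ellipsoids by iterated truncation *)

Section RegularEllipsoid.
Variable R : realType.

Lemma bernoulli_le (x : R) k : 0 <= x -> 1 + x * k%:R <= (1 + x) ^+ k.
Proof.
move=> x0; elim: k => [|k IH]; first by rewrite mulr0 addr0 expr0.
rewrite exprS -natr1; have : 0 <= x * k%:R by rewrite mulr_ge0.
have : 0 <= (1 + x) ^+ k - (1 + x * k%:R) by rewrite subr_ge0.
by move: IH; move: ((1 + x) ^+ k) => z; nra.
Qed.

Lemma exp_ge_large (x M : R) : 0 < x -> exists k0, forall k, (k0 <= k)%N -> M <= (1 + x) ^+ k.
Proof.
move=> x0; exists (Num.truncn (`|M| / x)).+1 => k hk.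
apply: le_trans (bernoulli_le k (ltW x0)).
have : `|M| / x < k%:R.
  apply: lt_le_trans (_ : (Num.truncn (`|M| / x)).+1%:R <= _); last by rewrite ler_nat.
  by have /andP[] := truncn_itv (divr_ge0 (normr_ge0 M) (ltW x0)).
rewrite ltr_pdivrMr // => h; have := ler_norm M; lra.
Qed.

Let y (m : nat) : R := (3 / 4) ^+ m.

(** With d = 16^(m+1) and tolerances (3/4)^(m+1), the distance after truncation is 384
    (256/27)^(m+1) + 1, and 256/27 < 16. *)
Lemma iteration_index (eps : R) : 0 < eps ->
  exists m0, 3 * y m0 <= eps /\ forall m, (m0 <= m)%N ->
    384 / (4^-1 ^+ m.+1 * y m.+1 ^+ 2 * y m.+1) + 1 <= 16 ^+ m.
Proof.
move=> eps0.
have [k1 h1] := @exp_ge_large (1 / 3) (3 / eps) ltac:(lra).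
(* The ratio 16 / (256/27) = 27/16 has to absorb 6160 = 16 (384 + 1). *)
have [k2 h2] := @exp_ge_large (11 / 16) 6160 ltac:(lra).
exists (maxn k1 k2); split.
  have := h1 _ (leq_maxl k1 k2); rewrite (_ : 1 + 1 / 3 = (3 / 4)^-1); last by field.
  rewrite exprVn -/(y _) ler_pdivrMr // => h.
  have yp : 0 < y (maxn k1 k2) by rewrite exprn_gt0.
  have := ler_wpM2r (ltW yp) h; rewrite mulrAC mulVf ?gt_eqF // mul1r.
  exact.
move=> m hm; set k := m.+1.
have := h2 k (leq_trans (leq_trans (leq_maxr k1 k2) hm) (leqnSn m)).
rewrite (_ : 1 + 11 / 16 = 27 / 16); last by field.
move=> hk.
have e1 : 384 / (4^-1 ^+ k * y k ^+ 2 * y k) = 384 * (256 / 27) ^+ k.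
  rewrite -mulrA -exprSr /y -exprM mulnC exprM -exprMn -exprVn; congr (_ * _ ^+ _).
  by field.
have e2 : 16 ^+ k = (27 / 16) ^+ k * (256 / 27) ^+ k :> R.
  by rewrite -exprMn; congr (_ ^+ _); field.
have e3 : 16 ^+ m = 16 ^+ k / 16 :> R by rewrite /k exprS mulrC mulKf.
have c1 : 1 <= (256 / 27) ^+ k :> R by rewrite exprn_ege1 //; lra.
rewrite e1 e3 e2; move: ((27 / 16) ^+ k) ((256 / 27) ^+ k) hk c1 => u w hk c1.
have : 6160 * w <= u * w by apply: ler_wpM2r => //; lra.
lra.
Qed.

(** A one-sided M-ellipsoid: the ellipsoid is covered by the body and the polar ellipsoid by the
    polar body, at a scale independent of the dimension and of the body. *)
Theorem regular_ellipsoid (eps : R) : 0 < eps -> exists2 t, 1 <= t &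
  forall n (B : set 'rV[R]_n), (0 < n)%N -> body B ->
  exists2 g, g \in unitmx &
    cove (ell g) [set x | gauge B x <= t] (n%:R * eps) /\
    cove (ell (invmx g)^T) [set f | supp B f <= t] (n%:R * eps).
Proof.
move=> eps0; have [m0 [y_eps step]] := iteration_index eps0.
pose T : R := 16 ^+ m0; have T1 : 1 <= T by rewrite exprn_ege1 //; lra.
have T0 : 0 < T by lra.
(* Since 3 y_m = 4 y_(m+1), this sequence absorbs each factor 1 + y_(m+1), and the budget eps - 3
   y_m likewise grows by y_(m+1) at each step. *)
pose t m := T * expR (3 - 3 * y m).
have t0 m : 0 < t m by rewrite mulr_gt0 // expR_gt0.
have y0 m : 0 < y m by rewrite exprn_gt0.
have y1 m : y m <= 1 by rewrite exprn_ile1 //; lra.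
have T_t m : T <= t m.
  by rewrite /t -{1}[T]mulr1 ler_pM2l // -[leLHS]expR0 ler_expR; have := y1 m; lra.
exists (T * expR 3).
  by apply: (@le_trans _ _ (t 0%N)); [exact: le_trans (T_t _) | rewrite ler_pM2l // ler_expR; have := y0 0%N; lra].
move=> n B n0 bB; have nR0 : 0 < n%:R :> R by rewrite ltr0n.
(* Induction on the distance 16^m to an ellipsoid; at m0 the given ellipsoid itself works, with t =
   16^m0. *)
suff claim m : (m0 <= m)%N -> forall (B : set 'rV[R]_n) g, body B -> g \in unitmx ->
    ell g `<=` B -> (forall x, B x -> nsq (x *m g) <= (16 ^+ m) ^+ 2) ->
    exists2 g', g' \in unitmx &
    cove (ell g') [set x | gauge B x <= t m] (n%:R * (eps - 3 * y m)) /\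
    cove (ell (invmx g')^T) [set f | supp B f <= t m] (n%:R * (eps - 3 * y m)).
  have [_ _ _ [s s0 hs]] := bB; have [M M0 hM] := body_bounded bB.
  have [k hk] := @exp_ge_large 15 (M / s) ltac:(lra).
  rewrite (_ : 1 + 15 = 16) in hk; last by ring.
  have hm := hk _ (leq_maxr m0 k); set m := maxn m0 k in hm.
  have gu : ((s^-1)%:M : 'M[R]_n) \in unitmx by rewrite unitmxE det_scalar unitrX // unitfE invr_eq0 gt_eqF.
  have [||g' g'u [c1 c2]] := claim m (leq_maxl _ _) B (s^-1)%:M bB gu.
  - move=> x; rewrite /ell /= mul_mx_scalar nsqZ exprVn mulrC ler_pdivrMr ?exprn_gt0 // mul1r.
    exact: hs.
  - move=> x /hM hx; rewrite mul_mx_scalar nsqZ.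
    apply: (@le_trans _ _ (s^-1 ^+ 2 * M ^+ 2)); first by apply: ler_wpM2l => //; exact: sqr_ge0.
    rewrite -exprMn mulrC; apply: lerXn2r => //; rewrite nnegrE ?exprn_ge0 //.
    by rewrite divr_ge0 // ltW.
  exists g' => //; have ht : t m <= T * expR 3.
    by rewrite ler_pM2l // ler_expR; have := y0 m; lra.
  have he : n%:R * (eps - 3 * y m) <= n%:R * eps by rewrite ler_pM2l //; have := y0 m; lra.
  by split; [apply: cove_le c1 | apply: cove_le c2] => //= x /le_trans; exact.
move=> hm; rewrite -(subnKC hm); elim: (m - m0)%N => [|k IH] {m hm B bB} B g bB gu hin hout.
  rewrite addn0 in hout *; exists g => //.
  have e0 : 0 <= n%:R * (eps - 3 * y m0) by rewrite mulr_ge0 ?(ltW nR0) // subr_ge0.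
  split; apply: cove_refl => // x hx /=; last first.
    apply: le_trans (T_t m0); apply: supp_le => // z /hout hz.
    have : dot x (T^-1 *: z) <= 1.
      rewrite -polar_ell // in hx; apply: hx; rewrite /ell /= -scalemxAl nsqZ exprVn mulrC.
      by rewrite ler_pdivrMr ?exprn_gt0 // mul1r.
    by rewrite dotZr mulrC ler_pdivrMr // mul1r.
  apply: le_trans (T_t m0); apply: le_trans T1; apply/(gauge_le1 _ bB); exact: hin.
rewrite addnS in hout *; set m := (m0 + k)%N in IH hout *.
pose r : R := 4^-1 ^+ m.+1; pose d : R := 16 ^+ m.+1.
have rd : r ^+ 2 * d = 1.
  by rewrite /r /d -exprM mulnC exprM -exprMn -[RHS](expr1n _ m.+1); congr (_ ^+ _); field.
have r01 : 0 < r <= 1.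
  by rewrite exprn_gt0 ?invr_gt0 //= exprn_ile1 ?invr_ge0 // invf_le1 //; lra.
have e01 : 0 < y m.+1 <= 1 by rewrite y0 y1.
have [B' [g1 [[bB' g1u] hin1 hout1 c1 c2]]] :=
  truncation n0 bB gu r01 rd e01 (y0 m.+1) hin hout.
have hout2 x : B' x -> nsq (x *m g1) <= (16 ^+ m) ^+ 2.
  move=> /hout1 h; apply: le_trans h _; apply: lerXn2r; rewrite ?nnegrE ?exprn_ge0 //.
    rewrite addr_ge0 // divr_ge0 // !mulr_ge0 ?exprn_ge0 ?invr_ge0 //.
  exact: (step _ (leq_addr _ _)).
have [g2 g2u [c3 c4]] := IH _ _ bB' g1u hin1 hout2.
have tm : t m * (1 + y m.+1) <= t m.+1.
  rewrite /t -mulrA ler_pM2l //; have -> : 3 * y m = 4 * y m.+1 by rewrite /y exprS; field.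
  have -> : 3 - 3 * y m.+1 = (3 - 4 * y m.+1) + y m.+1 by ring.
  by rewrite (expRD (3 - 4 * y m.+1)) ler_pM2l ?expR_gt0 // expR_ge1Dx.
have em : n%:R * (eps - 3 * y m) + n%:R * y m.+1 = n%:R * (eps - 3 * y m.+1).
  by rewrite /y exprS; field.
have tn0 : (t m)^-1 != 0 by rewrite invr_eq0 gt_eqF.
exists g2 => //; split; rewrite -em.
  apply: cove_trans c3 _.
  apply: (@cove_scale _ _ _ _ _ _ _ _ tn0 _ _ c1) => x /=; first by move/(gauge_le _ bB' (t0 m)).
  rewrite (gauge_seminorm bB).2 ger0_norm ?invr_ge0 ?(ltW (t0 m)) // mulrC.
  by rewrite ler_pdivrMr // mulrC => /le_trans; apply.
apply: cove_trans c4 _.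
apply: (@cove_scale _ _ _ _ _ _ _ _ tn0 _ _ c2) => x /=.
  by rewrite -gauge_polar // => /(gauge_le _ (polar_body bB') (t0 m)).
rewrite (supp_seminorm bB).2 ger0_norm ?invr_ge0 ?(ltW (t0 m)) // mulrC.
by rewrite ler_pdivrMr // mulrC => /le_trans; apply.
Qed.

End RegularEllipsoid.

(** * Duality of entropy when one body is the Euclidean ball *)

Section EuclideanDuality.
Variables (R : realType) (n : nat).
Local Notation V := 'rV[R]_n.
Implicit Types (A B C : set V).

Definition eball (r : R) : set V := [set x | nsq x <= r ^+ 2].

Definition snum A C : nat := xget 0%N [set N | maxsep A C N].

Lemma snumP A C (r s : R) : (forall x, A x -> nsq x <= r ^+ 2) -> 0 < s ->
  (forall x, nsq x <= s ^+ 2 -> C x) -> maxsep A C (snum A C).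
Proof.
move=> hA s0 hC; have [M hM] := sepn_finite hA s0 hC.
have [N hN] := maxsep_exists hM.
by rewrite /snum; case: xgetP => [k _ //|/(_ N)]; case.
Qed.

Variable K : set V.
Hypothesis bK : body K.
Variable z : R.
Hypothesis z0 : 0 < z.
Hypothesis hz : z * 4096 = 1.

(** [P j] measures K at Euclidean scale 8^j, [A j] measures the ball against Q j = (8^j/64) K°, and
    [T j] measures it against 2 Q j enlarged by a ball of radius 4z, with z = 8^-4. [P_step] and
    [A_step] telescope over the scales. *)
Let Q (j : nat) : set V := [set f | supp K f <= 8 ^+ j / 64].
Let S (j : nat) : set V :=
  [set f | exists q h, [/\ supp K q <= 2 * (8 ^+ j / 64), nsq h <= (4 * z) ^+ 2 & f = q + h]].
Let P j := snum K (eball (8 ^+ j)).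
Let A j := snum (eball 1) (Q j).
Let T j := snum (eball 1) (S j).

Let ss := supp_seminorm bK.
Let gs := gauge_seminorm bK.

Let p8 j : 0 < 8 ^+ j :> R. Proof. by rewrite exprn_gt0. Qed.

Let PP j : maxsep K (eball (8 ^+ j)) (P j).
Proof. by have [M M0 hM] := body_bounded bK; apply: (snumP hM (p8 j)). Qed.

Let QP : exists2 s, 0 < s & forall j x, nsq x <= s ^+ 2 -> Q j x.
Proof.
have [M M0 hM] := body_bounded bK.
exists (1 / 64 / M) => [|j x hx]; first by rewrite !divr_gt0.
apply: supp_le => // w /hM hw; have := dot_le _ (ltW M0) hx hw.
rewrite divfK ?gt_eqF // => h; apply: le_trans (h _) _.
  by rewrite !divr_ge0 // ltW.
by rewrite ler_pM2r ?invr_gt0 // exprn_ege1 //; lra.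
Qed.

Let AP j : maxsep (eball 1) (Q j) (A j).
Proof. by have [s s0 hs] := QP; apply: (@snumP _ _ 1 s) => // x; exact: hs. Qed.

Let TP j : maxsep (eball 1) (S j) (T j).
Proof.
apply: (@snumP _ _ 1 (4 * z)) => //; first by rewrite mulr_gt0.
move=> x hx; exists 0, x; split=> //; last by rewrite add0r.
by rewrite (seminorm0 ss) mulr_ge0 // divr_ge0 // ltW.
Qed.

Lemma sepn1 B C x : B x -> sepn B C 1.
Proof.
by move=> Bx; exists (fun=> x); split=> // i j; rewrite !ord1 eqxx.
Qed.

Let A_ge1 j : (1 <= A j)%N.
Proof. by apply: (AP j).2; apply: (@sepn1 _ _ 0); rewrite /eball /= nsq0 sqr_ge0. Qed.

Let A_dec j : (A j.+1 <= A j)%N.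
Proof.
apply: (AP j).2; apply: sepn_sub (AP j.+1).1 => // f /= h; apply: le_trans h _.
by rewrite ler_pM2r ?invr_gt0 // exprS ler_peMl ?(ltW (p8 j)) //; lra.
Qed.

(* Tomczak-Jaegermann: for [z] in [2K], [<z, z>] is small when [z] is close to a small
   multiple of the polar of [K]. *)
Let P_step j : (P j <= P j.+1 * T j)%N.
Proof.
have [P0|Ppos] := posnP (P j); first by rewrite P0.
have [[x [xK xsep]] _] := PP j.
have [|| y [yK ycov]] := maxsep_cov _ _ (PP j.+1).
- by rewrite /eball /= nsq0 sqr_ge0.
- by move=> y; rewrite /eball /= nsqN.
have /choice[f hf] : forall i, exists u, eball (8 ^+ j.+1) (x i - y u) by move=> i; exact: ycov.
have := @fiber_pigeonhole _ _ [set: 'I_(P j)]%SET f; rewrite cardsT card_ord => /(_ Ppos)[u hu].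
apply: leq_trans hu _; rewrite card_ord leq_mul2l; apply/orP; right.
apply: (TP j).2.
pose c : R := (8 ^+ j.+1)^-1; have c0 : 0 < c by rewrite invr_gt0.
apply: (@sepn_fin _ _ _ _ _ _ (fun i => c *: (x i - y u))).
  move=> i; rewrite !inE => /eqP fi; have := hf i; rewrite fi /eball /= nsqZ => h.
  rewrite expr1n /c exprVn mulrC ler_pdivrMr ?exprn_gt0 // mul1r; exact: h.
move=> i k; rewrite !inE => /eqP fi /eqP fk ik [q [h [hq hh e]]].
have := xsep _ _ ik; apply; rewrite /eball /=; set x0 := x i - x k.
have ez : x0 = 8 ^+ j.+1 *: (q + h).
  rewrite -e -scalerBr scalerA mulfV ?gt_eqF // scale1r.
  by rewrite opprB addrA subrK.
have gz : gauge K x0 <= 2.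
  apply: le_trans (gs.1 _ _) _; rewrite (seminormN gs).
  have /(gauge_le1 _ bK) h1 := xK i; have /(gauge_le1 _ bK) h2 := xK k; lra.
have zz : nsq x0 <= (2 * 8 ^+ j.+1) ^+ 2.
  have -> : x0 = (x i - y u) - (x k - y u) by rewrite opprB addrA subrK.
  have h1 := hf i; have h2 := hf k; rewrite fi in h1; rewrite fk in h2.
  have -> : 2 * 8 ^+ j.+1 = 8 ^+ j.+1 + 8 ^+ j.+1 :> R by ring.
  by apply: nsqD_le; rewrite ?nsqN // ltW.
have e1 : nsq x0 = 8 ^+ j.+1 * (dot q x0 + dot h x0).
  by rewrite nsqE {1}ez dotZl dotDl.
have d1 : dot q x0 <= 8 ^+ j / 16.
  apply: le_trans (dot_le_gauge q x0 bK) _.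
  apply: (@le_trans _ _ (2 * (8 ^+ j / 64) * 2)); last by lra.
  by apply: ler_pM; rewrite ?(seminorm_ge0 ss) ?(seminorm_ge0 gs).
have d2 : dot h x0 <= 4 * z * (2 * 8 ^+ j.+1).
  by apply: dot_le => //; rewrite mulr_ge0 // ltW.
rewrite e1; have d3 := lerD d1 d2.
apply: (@le_trans _ _ (8 ^+ j.+1 * (8 ^+ j / 16 + 4 * z * (2 * 8 ^+ j.+1)))).
  by rewrite ler_pM2l.
rewrite exprS; have := congr1 ( *%R^~ (8 ^+ j ^+ 2)) hz.
by have := sqr_ge0 (8 ^+ j : R); lra.
Qed.

(** Put a copy of the second separated set, shrunk by z, around each point of the first, halved.
    Within a copy, z Q_(j+4) = Q_j keeps points apart; between copies, a difference in Q_j would put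
    a difference of the first set into 2 Q_j + 4z D. *)
Let A_step j : (T j * A j.+4 <= A j)%N.
Proof.
have [[x [xD xsep]] _] := TP j; have [[y [yD ysep]] _] := AP j.+4.
apply: (AP j).2; rewrite -[T j]card_ord -[A j.+4]card_ord -card_prod.
have z1 : z <= 2^-1 by have := hz; have := z0; lra.
apply: (@sepn_finT _ _ _ _ _ (fun t => 2^-1 *: x t.1 + z *: y t.2)).
  move=> [a b] /=; rewrite /eball /= expr1n.
  have half : (2^-1 + 2^-1) ^+ 2 = 1 :> R by field.
  rewrite -[leRHS]half; apply: nsqD_le; rewrite ?nsqZ ?invr_ge0 //.
    by rewrite -[leRHS]mulr1; apply: ler_wpM2l; [exact: sqr_ge0 | have := xD a; rewrite /eball /= expr1n].
  have := yD b; rewrite /eball /= expr1n => yb.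
  rewrite -[leRHS]mulr1; apply: ler_pM => //; rewrite ?sqr_ge0 ?nsq_ge0 //.
  by apply: lerXn2r; rewrite ?nnegrE ?invr_ge0 // ltW.
move=> [a b] [a' b']; rewrite xpair_eqE negb_and /= => ne.
have [aa|naa] := eqVneq a a'.
  move: ne; rewrite aa eqxx /= => nbb; have := ysep _ _ nbb; apply: contra_not.
  rewrite opprD addrACA subrr add0r -scalerBr /Q /= ss.2 gtr0_norm // => h.
  have -> : 8 ^+ j.+4 = 8 ^+ j * 4096 :> R by rewrite !exprS; ring.
  rewrite -(ler_pM2l z0); apply: le_trans h _.
  have := congr1 ( *%R^~ (8 ^+ j)) hz; lra.
have := xsep _ _ naa; apply: contra_not => /= h.
exists (2 *: (2^-1 *: x a + z *: y b - (2^-1 *: x a' + z *: y b'))), ((- (2 * z)) *: (y b - y b')).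
split.
- by rewrite ss.2 ger0_norm // ler_pM2l.
- rewrite nsqZ; have yy : nsq (y b - y b') <= (1 + 1) ^+ 2 by apply: nsqD_le; rewrite ?nsqN //; exact: yD.
  apply: (@le_trans _ _ ((- (2 * z)) ^+ 2 * (1 + 1) ^+ 2)).
    by apply: ler_wpM2l => //; exact: sqr_ge0.
  by rewrite -exprMn -[leRHS]sqrrN le_eqVlt; apply/orP; left; apply/eqP; ring.
- by apply/rowP => i; rewrite !mxE; field.
Qed.

Lemma euclidean_duality_aux N : sepn K (eball 1) N ->
  exists2 M, sepn (eball 1) [set f | supp K f <= 1 / 64] M & (N <= M ^ 4)%N.
Proof.
have [M M0 hM] := body_bounded bK.
have [J hJ] : exists J, M <= 8 ^+ J / 2.
  exists (Num.truncn (2 * M)).+1.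
  have h1 : 2 * M < (Num.truncn (2 * M)).+1%:R.
    by have /andP[] := @truncn_itv R (2 * M) ltac:(lra).
  have h2 k : k%:R <= 8 ^+ k :> R.
    by rewrite -natrX ler_nat ltnW // ltn_expl.
  by have := h2 (Num.truncn (2 * M)).+1; lra.
(* Descending induction on the scale: [P_step] introduces [T j], and [A_step] trades [T j * A j.+4]
   for [A j], so a window of four factors slides down. At the scale J the set K has diameter at most
   8^J and [P J] is at most 1. *)
have claim k : (P (J - k) <= A (J - k) * A (J - k).+1 * A (J - k).+2 * A (J - k).+3)%N.
  elim: k => [|k IH].
    rewrite subn0; apply: (@leq_trans 1%N); last by rewrite !muln_gt0 !A_ge1.
    have [[x [xK xsep]] _] := PP J; case: (P J) x xK xsep => [|[|p]] // x xK xsep.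
    case: (xsep ord0 (lift ord0 ord0)) => //; rewrite /eball /=.
    apply: le_trans (_ : (M + M) ^+ 2 <= _).
      by apply: nsqD_le; rewrite ?nsqN ?(ltW M0) //; exact: hM.
    by apply: lerXn2r; rewrite ?nnegrE ?(ltW (p8 J)) //; lra.
  have [Jk|Jk] := leqP J k.
    have -> : (J - k.+1 = J - k)%N; last exact: IH.
    by move/eqP: (Jk) => ->; apply/eqP; rewrite subn_eq0 (leq_trans Jk).
  have e : (J - k = (J - k.+1).+1)%N by rewrite -subSn // subSS.
  rewrite e in IH; set j := (J - k.+1)%N in IH *.
  apply: leq_trans (P_step j) _; apply: (@leq_trans (A j.+1 * A j.+2 * A j.+3 * A j.+4 * T j)).
    by rewrite leq_mul2r IH orbT.
  have -> : (A j.+1 * A j.+2 * A j.+3 * A j.+4 * T j = (T j * A j.+4) * (A j.+1 * A j.+2 * A j.+3))%N.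
    by rewrite -mulnA [(A j.+4 * _)%N]mulnC mulnC.
  have -> : (A j * A j.+1 * A j.+2 * A j.+3 = A j * (A j.+1 * A j.+2 * A j.+3))%N by rewrite !mulnA.
  by rewrite leq_mul2r A_step orbT.
move=> sN; exists (A 0%N).
  by apply: sepn_sub (AP 0%N).1 => // f; rewrite /Q /= expr0.
apply: (@leq_trans (P 0%N)); first by apply: (PP 0%N).2; rewrite expr0.
have := claim J; rewrite subnn => h; apply: leq_trans h _.
have A1 := A_dec 0; have A2 := leq_trans (A_dec 1) A1; have A3 := leq_trans (A_dec 2) A2.
by rewrite !expnS expn0 muln1 !mulnA; apply: leq_mul => //; apply: leq_mul => //; apply: leq_mul.
Qed.

End EuclideanDuality.

Lemma euclidean_duality (R : realType) n (K : set 'rV[R]_n) N : body K ->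
  sepn K (eball 1) N ->
  exists2 M, sepn (eball 1) [set f | supp K f <= 1 / 64] M & (N <= M ^ 4)%N.
Proof.
move=> bK; have [z z0 hz] : exists2 z : R, 0 < z & z * 4096 = 1.
  by exists (8^-1 ^+ 4); [rewrite exprn_gt0 // invr_gt0 | field].
exact: (euclidean_duality_aux bK z0 hz).
Qed.

(** * Systems of points and functionals witnessing convex separation *)

Section Systems.
Variables (R : realType) (n : nat).
Local Notation V := 'rV[R]_n.
Implicit Types (A B C K : set V).

Definition sepsys K B (de : R) N := exists x h : 'I_N -> V,
  [/\ forall i, K (x i), forall j, polar B (h j) &
      forall i j : 'I_N, (i < j)%N -> de <= dot (h j) (x j - x i)].

(** On the hull of the earlier points h_j is at most h_j(x_j) - de, whereas on x_j + B/a it is at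
    least h_j(x_j) - 1/a. *)
Lemma sepsys_separable K B (de a : R) N : origin_symmetric B -> 0 < a -> a^-1 < de ->
  sepsys K B de N -> convex_separable K (dilate a^-1 B) N.
Proof.
move=> sB a0 ade [x [h [xK hB gap]]]; exists x; split=> // j.
rewrite -subset0 => _ [[s /interior_subset [b Bb <-] <-]].
move=> [m [l [y [l0 [l1 [yS e]]]]]].
have up : dot (h j) (x j + a^-1 *: b) <= dot (h j) (x j) - de.
  rewrite e dot_sumr.
  apply: (@le_trans _ _ (\sum_(i < m) l i * (dot (h j) (x j) - de))).
    apply: ler_sum => i _; rewrite dotZr; apply: ler_wpM2l => //.
    have [k /= kj <-] := yS i; have := gap _ _ kj; rewrite dotBr; lra.
  by rewrite -mulr_suml l1 mul1r.
have := hB j (- b) (sB _ Bb); rewrite dotNr => lo.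
move: up; rewrite dotDr dotZr => up.
have : a^-1 * (- dot (h j) b) <= a^-1 * 1 by rewrite ler_pM2l ?invr_gt0.
lra.
Qed.

(** Equally spaced points on the segment from 0 to y, all with the same functional. *)
Lemma sepsys_line K B h y (c : R) N : body K -> K y -> polar B h ->
  0 <= c -> c * N%:R <= dot h y -> sepsys K B c N.
Proof.
move=> bK Ky hB c0 hN.
exists (fun i : 'I_N => (i%:R / N%:R) *: y), (fun=> h); split=> // [i|i j ij].
  have N0 : 0 < N%:R :> R by rewrite ltr0n (leq_ltn_trans _ (ltn_ord i)).
  apply: body_scale => //; rewrite ger0_norm ?divr_ge0 // ler_pdivrMr // mul1r ler_nat.
  exact/ltnW/ltn_ord.
have N0 : 0 < N%:R :> R by rewrite ltr0n (leq_ltn_trans _ (ltn_ord i)).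
rewrite -scalerBl dotZr -mulrBl.
have ij1 : 1 <= j%:R - i%:R :> R by rewrite -natrB ?(ltnW ij) // ler1n subn_gt0.
apply: (@le_trans _ _ (1 / N%:R * (c * N%:R))).
  by rewrite mul1r mulrCA mulVf ?mulr1 // gt_eqF.
apply: ler_pM => //; rewrite ?divr_ge0 ?mulr_ge0 //.
by rewrite ler_pM2r ?invr_gt0.
Qed.

(** Among the M + 1 points (i/M) x, two share one of the M translates of the q-ball of radius t, so
    q(x)/M <= 2t. *)
Lemma cove_segment A (q : V -> R) (t e : R) x : seminorm q -> 0 < t ->
  (forall c, 0 <= c <= 1 -> A (c *: x)) -> cove A [set z | q z <= t] e ->
  q x <= 2 * t * expR e.
Proof.
move=> sq t0 hA [M [y hy] hM].
have M0 : (0 < M)%N.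
  have [i _] := hy _ (hA 0 ltac:(by rewrite lexx ler01)).
  exact: leq_ltn_trans (ltn_ord i).
have MR0 : 0 < M%:R :> R by rewrite ltr0n.
have /choice[f hf] : forall i : 'I_M.+1, exists u, q ((i%:R / M%:R) *: x - y u) <= t.
  move=> i; apply: hy; apply: hA; rewrite divr_ge0 //= ler_pdivrMr // mul1r ler_nat.
  by rewrite -ltnS.
have /injectivePn[i [j ij fij]] : ~~ injectiveb f.
  by apply/injectiveP => /leq_card; rewrite !card_ord ltnn.
have h1 : q (((i%:R - j%:R) / M%:R) *: x) <= t + t.
  have -> : ((i%:R - j%:R) / M%:R) *: x =
     ((i%:R / M%:R) *: x - y (f i)) - ((j%:R / M%:R) *: x - y (f i)).
    by rewrite opprB addrA subrK mulrBl scalerBl.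
  apply: le_trans (sq.1 _ _) _; rewrite (seminormN sq).
  by apply: lerD; [exact: hf | rewrite fij; exact: hf].
have ij1 : 1 <= `|i%:R - j%:R| :> R.
  case: (ltngtP i j) => [lt|lt|/val_inj e1]; last by rewrite e1 eqxx in ij.
    by rewrite distrC -natrB ?(ltnW lt) // ger0_norm // ler1n subn_gt0.
  by rewrite -natrB ?(ltnW lt) // ger0_norm // ler1n subn_gt0.
move: h1; rewrite sq.2 normrM [`|M%:R^-1|]gtr0_norm ?invr_gt0 // => h1.
have q0 := seminorm_ge0 sq x.
have h2 : q x / M%:R <= t + t.
  apply: le_trans h1; rewrite -mulrA [q x / _]mulrC -[leLHS]mul1r.
  by apply: ler_wpM2r => //; rewrite mulrC divr_ge0.
move: h2; rewrite ler_pdivrMr // => h2; apply: le_trans h2 _.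
have -> : t + t = 2 * t by ring.
by apply: ler_wpM2l => //; rewrite mulr_ge0 // ltW.
Qed.

(* Sorting by the common part [f0] of the functionals makes its contribution to the
   gaps nonnegative, so that only the small parts [h j - f0] matter. *)
Lemma twosided_sepsys K B (T : finType) (P : {set T}) (x h : T -> V) (z f0 : V) (t de : R) :
  body K -> body B -> 0 < t ->
  (forall a, a \in P -> gauge K (x a - z) <= t) ->
  (forall a, a \in P -> supp B (h a - f0) <= t) ->
  (forall a b, a \in P -> b \in P -> a != b -> de <= dot (h a) (x a - x b)) ->
  sepsys K B (de / t ^+ 2) #|P|.
Proof.
move=> bK bB t0 hx hh gap.
pose le_f : rel T := fun a b => dot f0 (x b) <= dot f0 (x a).
pose s := sort le_f (enum P).
have ss : sorted le_f s by apply: sort_sorted => a b; exact: le_total.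
have sz : size s = #|P| by rewrite size_sort -cardE.
have us : uniq s by rewrite sort_uniq enum_uniq.
have [P0|[a0 aP]] := set_0Vmem P.
  by rewrite P0 cards0; exists (fun=> 0), (fun=> 0); split; case.
pose e (i : 'I_#|P|) := nth a0 s i.
have eP i : e i \in P by rewrite -mem_enum -(mem_sort le_f) mem_nth // sz.
have tn0 : t != 0 by rewrite gt_eqF.
exists (fun i => t^-1 *: (x (e i) - z)), (fun i => t^-1 *: (h (e i) - f0)); split.
- by move=> i; apply/(gauge_le _ bK t0)/hx.
- by move=> i; apply/(supp_le1 _ bB); rewrite (supp_seminorm bB).2 gtr0_norm ?invr_gt0 //
    mulrC ler_pdivrMr // mul1r; exact: hh.
- move=> i j ij.
  have nij : e j != e i by rewrite nth_uniq ?sz // gtn_eqF.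
  have lef : dot f0 (x (e j)) <= dot f0 (x (e i)).
    have tr : transitive le_f by move=> b a c h1 h2; apply: le_trans h2 h1.
    by apply: (sorted_ltn_nth tr a0 ss) => //; rewrite inE sz.
  have := gap _ _ (eP j) (eP i) nij.
  have -> : t^-1 *: (x (e j) - z) - t^-1 *: (x (e i) - z) = t^-1 *: (x (e j) - x (e i)).
    by rewrite -scalerBr opprB addrA subrK.
  rewrite dotZl dotZr mulrA dotBl !dotBr mulrC -expr2 -exprVn => g1.
  by apply: ler_wpM2l; [exact: sqr_ge0 | lra].
Qed.

End Systems.

(** * From separated points to a separating system, in normalised position *)

Section Core.
Variables (R : realType) (n : nat).
Local Notation V := 'rV[R]_n.
Implicit Types (A B C K : set V).

Lemma lin_body B (v : 'M[R]_n) : v \in unitmx -> body B -> body [set a | B (a *m v)].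
Proof.
move=> vu bB; have [_ cv sy [r r0 hr]] := bB; have gs := gauge_seminorm bB.
have [M M0 hM] := body_bounded bB.
have [c c0 hc] := nsq_mulmx_le (invmx v); have [d d0 hd] := nsq_mulmx_le v.
split.
- apply: (@compact_closed_nsq _ _ _ (c * M)).
    have -> : [set a | B (a *m v)] = [set a | gauge B (a *m v) <= 1].
      by apply/seteqP; split=> a /= /(gauge_le1 _ bB).
    apply: closed_fun_le; apply: seminorm_continuous; split=> [x y|a x].
      by rewrite mulmxDl; exact: gs.1.
    by rewrite -scalemxAl gs.2.
  move=> a /= /hM h; have := hc (a *m v); rewrite mulmxK // => h2.
  by apply: le_trans h2 _; rewrite exprMn; apply: ler_wpM2l => //; exact: sqr_ge0.
- by move=> x y t /= Bx By t01; rewrite mulmxDl -!scalemxAl; exact: cv.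
- by move=> x /= Bx; rewrite mulNmx; exact: sy.
- exists (r / d) => [|x hx]; first by rewrite divr_gt0.
  apply: hr; apply: le_trans (hd x) _.
  apply: (@le_trans _ _ (d ^+ 2 * (r / d) ^+ 2)); first by rewrite ler_pM2l ?exprn_gt0.
  by rewrite -exprMn mulrC divfK ?gt_eqF.
Qed.

Lemma dil_body K c : 0 < c -> body K -> body [set x | K (c^-1 *: x)].
Proof.
move=> c0 bK; have -> : [set x | K (c^-1 *: x)] = [set x | K (x *m (c^-1)%:M)].
  by apply/seteqP; split=> x /=; rewrite mul_mx_scalar.
by apply: lin_body => //; rewrite unitmxE det_scalar unitrX // unitfE invr_eq0 gt_eqF.
Qed.

Lemma supp_dil K c f : 0 < c -> body K -> supp [set x | K (c^-1 *: x)] f = c * supp K f.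
Proof.
move=> c0 bK; have bd := dil_body c0 bK; have cn0 : c != 0 by rewrite gt_eqF.
apply/eqP; rewrite eq_le; apply/andP; split.
  apply: supp_le => // x Kx; rewrite mulrC -ler_pdivrMr // mulrC -dotZr; exact: le_supp.
have [x Kx ->] := supp_attained f bK; rewrite -dotZr; apply: le_supp => //=.
by rewrite scalerA mulVf // scale1r.
Qed.

Lemma sepn_scale A A' C C' c N : c != 0 ->
  (forall x, A x -> A' (c *: x)) -> (forall x, C' (c *: x) -> C x) ->
  sepn A C N -> sepn A' C' N.
Proof.
move=> c0 hA hC [x [h1 h2]]; exists (fun i => c *: x i); split=> [i|i j ij].
  exact/hA/h1.
by rewrite -scalerBr => /hC; exact: h2.
Qed.

(** Changes the separating set from C to D at the price of covering D by translates of C'. *)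
Lemma sepn_entropy A C D C' (e s r : R) N : (forall x y, C' x -> C' y -> C (x - y)) ->
  (forall x, A x -> nsq x <= r ^+ 2) -> 0 < s -> (forall x, nsq x <= s ^+ 2 -> D x) ->
  (forall x, D x -> D (- x)) -> cove D C' e -> sepn A C N ->
  exists2 M, sepn A D M & N%:R <= M%:R * expR e.
Proof.
move=> hC hA s0 hD Ds [L cL hL] sN.
have hmax := snumP hA s0 hD; exists (snum A D); first exact: hmax.1.
have D0 : D 0 by apply: hD; rewrite nsq0 sqr_ge0.
have [y [_ hy]] := maxsep_cov D0 Ds hmax.
have cAD : cov A D (snum A D) by exists y.
have := sepn_cov hC (cov_trans cAD cL) sN; rewrite -(ler_nat R) natrM => h.
by apply: le_trans h _; apply: ler_wpM2l.
Qed.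

(* [(ball) Q^2] is covered by covering twice by the same number of balls: entropy of
   the ellipsoid [ball Q] is at least half that of [ball Q^2]. *)
Lemma sepn_sqrt_ellipsoid (Q : 'M[R]_n) (w : R) N : 0 < w ->
  sepn (eball 1) [set f | nsq (f *m Q *m Q) <= (2 * w ^+ 2) ^+ 2] N ->
  exists2 M, sepn (eball 1) [set b | nsq (b *m Q) <= w ^+ 2] M & (N <= M * M)%N.
Proof.
move=> w0 [x [xD xsep]]; have [c c0 hc] := nsq_mulmx_le Q.
pose C := [set b : V | nsq (b *m Q) <= w ^+ 2].
have hmax : maxsep (eball 1) C (snum (eball 1) C).
  apply: (@snumP _ _ _ _ 1 (w / c)) => //; first by rewrite divr_gt0.
  move=> b hb; rewrite /C /=; apply: le_trans (hc b) _.
  apply: (@le_trans _ _ (c ^+ 2 * (w / c) ^+ 2)); first by rewrite ler_pM2l ?exprn_gt0.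
  by rewrite -exprMn mulrC divfK ?gt_eqF.
set M := snum _ _ in hmax; exists M; first exact: hmax.1.
have [||y [_ hy]] := maxsep_cov _ _ hmax.
- by rewrite /C /= mul0mx nsq0 sqr_ge0.
- by move=> b; rewrite /C /= mulNmx nsqN.
have /choice[f hf] : forall i, exists k, C (x i - y k) by move=> i; exact: hy.
have /choice[f2 hf2] : forall i, exists k, C (w^-1 *: ((x i - y (f i)) *m Q) - y k).
  move=> i; apply: hy; rewrite /eball /= nsqZ expr1n exprVn mulrC ler_pdivrMr ?exprn_gt0 //.
  by rewrite mul1r; exact: hf.
rewrite -[N]card_ord -[M]card_ord -card_prod.
apply: (@leq_card _ _ (fun i => (f i, f2 i))) => i j [fij f2ij].
apply/eqP; case: eqP => // /eqP ij; case: (xsep _ _ ij) => /=.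
have key k : nsq ((x k - y (f k)) *m Q *m Q - w *: (y (f2 k) *m Q)) <= (w ^+ 2) ^+ 2.
  have := hf2 k; rewrite /C /= mulmxBl -scalemxAl => h.
  have -> : (x k - y (f k)) *m Q *m Q - w *: (y (f2 k) *m Q) =
    w *: (w^-1 *: ((x k - y (f k)) *m Q *m Q) - y (f2 k) *m Q).
    by rewrite scalerBr scalerA mulfV ?gt_eqF // scale1r.
  by rewrite nsqZ expr2; apply: ler_wpM2l => //; exact: sqr_ge0.
have k1 := key i; have k2 := key j; rewrite -fij -f2ij in k2.
have -> : (x i - x j) *m Q *m Q = ((x i - y (f i)) *m Q *m Q - w *: (y (f2 i) *m Q))
   - ((x j - y (f i)) *m Q *m Q - w *: (y (f2 i) *m Q)).
  by rewrite opprB addrA subrK -!mulmxBl opprB addrA subrK.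
have -> : 2 * w ^+ 2 = w ^+ 2 + w ^+ 2 by ring.
by apply: nsqD_le; rewrite ?nsqN ?sqr_ge0.
Qed.

(** The unit ball is a regular ellipsoid for B and [ell g] one for K; each covering costs e <=
    k/100, where e^k bounds the number of separated points from below. *)
Variables (K B : set V) (g : 'M[R]_n) (t e k : R) (N : nat).
Hypotheses (bK : body K) (bB : body B) (gu : g \in unitmx) (t1 : 1 <= t) (e0 : 0 <= e).
Hypothesis cB : cove (eball 1) [set x | gauge B x <= t] e.
Hypothesis cL : cove (eball 1) [set x | supp B x <= t] e.
Hypothesis cK : cove (ell g) [set x | gauge K x <= t] e.
Hypothesis cC : cove (ell (invmx g)^T) [set x | supp K x <= t] e.
Hypothesis sKB : sepn K B N.
Hypothesis Nk : expR k <= N%:R.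
Hypothesis k0 : 0 < k.
Hypothesis ek : 100 * e <= k.

Let u := invmx g.
Let t0 : 0 < t. Proof. by have := t1; lra. Qed.
(** [tau] combines the factor 2t from replacing B by the ball with the 64 of [euclidean_duality];
    [s] adds the factor 2t from replacing K° by the polar ellipsoid; 2 w^2 = 1/s matches
    [sepn_sqrt_ellipsoid]. *)
Let tau := 64 * (2 * t).
Let s := 2 * tau * t.
Let tau0 : 0 < tau. Proof. by rewrite /tau; have := t0; lra. Qed.
Let s0 : 0 < s. Proof. by rewrite /s !mulr_gt0. Qed.
Let w : R := Num.sqrt (2 * s)^-1.
Let w2 : w ^+ 2 = (2 * s)^-1.
Proof. by rewrite sqr_sqrtr // invr_ge0 mulr_ge0 // ltW. Qed.
Let w0 : 0 < w. Proof. by rewrite sqrtr_gt0 invr_gt0 mulr_gt0. Qed.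

Let gsB := gauge_seminorm bB.
Let gsK := gauge_seminorm bK.
Let ssB := supp_seminorm bB.
Let ssK := supp_seminorm bK.

(** Exponent count: were the last number below e^(k/10), the square root would give M2 <= e^(k/5),
    and duality with its fourth power would give N <= e^(4(k/5 + e) + e) < e^k. *)
Lemma entropy_chain (Q : 'M[R]_n) : Q^T = Q -> Q *m Q *m Q *m Q = u^T *m u ->
  exists2 M, sepn (eball 1) [set b | nsq (b *m Q) <= w ^+ 2] M & expR (k / 10) <= M%:R.
Proof.
move=> Qs Q4.
have [rK rK0 hrK] := body_bounded bK.
have [N1 s1 h1] : exists2 N1, sepn K (eball (2 * t)^-1) N1 & N%:R <= N1%:R * expR e.
  apply: (@sepn_entropy K B _ [set x | gauge B x <= 1 / 2] e (2 * t)^-1 rK) => //.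
  - move=> x y /= hx hy; apply/(gauge_le1 _ bB); apply: le_trans (gsB.1 _ _) _.
    by rewrite (seminormN gsB); lra.
  - by rewrite invr_gt0 mulr_gt0.
  - by move=> x; rewrite /eball /= nsqN.
  apply: (@cove_scale _ _ _ _ _ _ (2 * t) _ _ _ _ cB) => [|x|x /=].
  - by rewrite gt_eqF // mulr_gt0.
  - rewrite /eball /= nsqZ expr1n exprVn => h.
    by rewrite -ler_pdivlMl ?exprn_gt0 ?mulr_gt0 // mulr1.
  - rewrite gsB.2 gtr0_norm ?mulr_gt0 // => h; have := t0; nra.
have bK2 : body [set x | K ((2 * t)^-1 *: x)] by apply: dil_body => //; rewrite mulr_gt0.
have [M1 s2 h2] : exists2 M1, sepn (eball 1) [set f | supp K f <= tau^-1] M1 & (N1 <= M1 ^ 4)%N.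
  have [|M1 s2 h2] := @euclidean_duality _ _ _ N1 bK2.
    apply: (@sepn_scale _ _ _ _ (2 * t) _ _ _ _ s1).
    - by rewrite gt_eqF // mulr_gt0.
    - by move=> x Kx /=; rewrite scalerA mulVf ?scale1r // gt_eqF // mulr_gt0.
    - move=> x; rewrite /eball /= nsqZ expr1n exprVn => h.
      by rewrite -[leRHS]mulr1 ler_pdivlMl ?exprn_gt0 ?mulr_gt0.
  exists M1 => //; apply: sepn_sub s2 => // f /= h.
  rewrite supp_dil ?mulr_gt0 // mul1r -[leRHS]mulr1 ler_pdivlMl // mulrA.
  by move: h; rewrite -[leRHS]mulr1 ler_pdivlMl // /tau.
have uu : u \in unitmx by rewrite unitmx_inv.
have utu : u^T \in unitmx by rewrite unitmx_tr.
have [rE rE0 hrE] : exists2 r, 0 < r & forall x, nsq x <= r ^+ 2 -> ell u^T x.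
  by have [_ _ _] := ell_body utu.
have [M2 s3 h3] : exists2 M2, sepn (eball 1) [set f | ell u^T (s *: f)] M2 & M1%:R <= M2%:R * expR e.
  apply: (@sepn_entropy _ [set f | supp K f <= tau^-1] _ [set f | supp K f <= (2 * tau)^-1] e (rE / s) 1) => //.
  - move=> x y /= hx hy; apply: le_trans (ssK.1 _ _) _; rewrite (seminormN ssK).
    have -> : tau^-1 = (2 * tau)^-1 + (2 * tau)^-1 by field; rewrite gt_eqF.
    exact: lerD.
  - by rewrite divr_gt0.
  - move=> x hx /=; apply: hrE; rewrite nsqZ.
    apply: (@le_trans _ _ (s ^+ 2 * (rE / s) ^+ 2)); first by rewrite ler_pM2l ?exprn_gt0.
    by rewrite -exprMn mulrC divfK ?gt_eqF.
  - by move=> x /=; rewrite scalerN /ell /= mulNmx nsqN.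
  apply: (@cove_scale _ _ _ _ _ _ s _ _ _ _ cC) => [|x //|x /=]; first by rewrite gt_eqF.
  rewrite ssK.2 gtr0_norm // /s -[X in _ <= X -> _]mul1r => h.
  rewrite -[leRHS]mulr1 ler_pdivlMl ?mulr_gt0 // -(ler_pM2r t0).
  by move: h; rewrite mulrAC.
have [M3 s4 h4] : exists2 M3, sepn (eball 1) [set b | nsq (b *m Q) <= w ^+ 2] M3 & (M2 <= M3 * M3)%N.
  apply: sepn_sqrt_ellipsoid => //; apply: sepn_sub s3 => // f /=.
  rewrite /ell /= -scalemxAl nsqZ w2.
  have -> : nsq (f *m u^T) = nsq (f *m Q *m Q).
    rewrite !nsqE [LHS]dot_mulmx trmxK -(mulmxA f u^T u) -Q4 [RHS]dot_mulmx Qs [RHS]dot_mulmx Qs.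
    by rewrite !mulmxA.
  have -> : 2 * (2 * s)^-1 = s^-1 by field; rewrite gt_eqF.
  by rewrite exprVn -[X in _ <= X -> _]mulr1 ler_pdivlMl ?exprn_gt0.
exists M3 => //; rewrite leNgt; apply/negP => lt.
have a2 : M2%:R <= expR (k / 5).
  apply: (@le_trans _ _ (M3%:R * M3%:R)); first by rewrite -natrM ler_nat.
  have -> : k / 5 = k / 10 + k / 10 by field.
  by rewrite expRD; apply: ler_pM => //; exact: ltW.
have a1 : M1%:R <= expR (k / 5 + e).
  by apply: le_trans h3 _; rewrite expRD ler_pM2r ?expR_gt0.
have a0 : N1%:R <= expR (4 * (k / 5 + e)).
  apply: (@le_trans _ _ (M1%:R ^+ 4)); first by rewrite -natrX ler_nat.
  by rewrite expRM_natl; apply: lerXn2r; rewrite ?nnegrE ?expR_ge0.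
have : expR k <= expR (4 * (k / 5 + e) + e).
  apply: le_trans Nk _; apply: le_trans h1 _.
  by rewrite expRD ler_pM2r ?expR_gt0.
by rewrite ler_expR; have := ek; have := k0; lra.
Qed.

(** The functionals are b_i and the points x_i = b_i Q^2, so that pairings become inner products of
    the vectors b_i Q. The hypothesis makes the number of shells affordable. *)
Lemma core_sepsys : 16 * s <= expR (k / 50) ->
  exists2 N', sepsys K B (3 / 8 * (2 * s)^-1 / t ^+ 2) N' & expR (k / 100) <= N'%:R.
Proof.
move=> hk; have [Q Qs Q4] := gram_fourth_root u.
have [M [b [bD bsep]] hM] := entropy_chain Qs Q4.
have s2 : 2 <= s by rewrite /s /tau; have := t1; nra.
have uu : u \in unitmx by rewrite unitmx_inv.
pose x i := b i *m Q *m Q.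
have dotx i z : dot (b i) (z *m Q *m Q) = dot (b i *m Q) (z *m Q).
  by rewrite dot_mulmx Qs.
(* By polarity: E° consists of the f with |f Q^2| <= 1, and <x_i, f> = <b_i, f Q^2>. The factor c
   serves [cove_segment]. *)
have xE i c : 0 <= c <= 1 -> ell g (c *: x i).
  move=> /andP[c0 c1]; rewrite -[ell g](bipolar (ell_body gu)) polar_ell // -/u => f hf.
  have e1 : nsq (f *m Q *m Q) <= 1 ^+ 2.
    rewrite expr1n; move: hf; rewrite /ell /=.
    rewrite !nsqE [X in X <= _ -> _]dot_mulmx trmxK -(mulmxA f u^T u) -Q4 => hf.
    by rewrite dot_mulmx Qs dot_mulmx Qs; rewrite !mulmxA in hf.
  have := dot_le ler01 ler01 (bD i) e1; rewrite mulr1 => h.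
  rewrite dotZl; have -> : dot (x i) f = dot (b i) (f *m Q *m Q).
    by rewrite /x dot_mulmx Qs dot_mulmx Qs.
  by apply: le_trans (ler_wpM2l c0 h) _; rewrite mulr1.
have M0 : (0 < M)%N by rewrite -(ltr0n R); apply: lt_le_trans hM; exact: expR_gt0.
pose La := expR (k / 20).
have La1 : 1 <= La by rewrite -[leLHS]expR0 ler_expR; have := k0; lra.
(* If all |b_i Q|^2 are at most e^(k/20), shells can be pigeonholed; a single larger one supports a
   system on a segment. *)
have [[i hi]|small] := pselect (exists i, La < nsq (b i *m Q)); last first.
  have r_le i : nsq (b i *m Q) <= La.
    by rewrite leNgt; apply/negP => lt; apply: small; exists i.
  (* Shell width for |bQ|^2: inside a shell, <b_i Q, (b_i - b_j) Q> >= (w^2 - w^2/4)/2 = 3 w^2/8,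
     whence the constant 3/8. *)
  pose d := w ^+ 2 / 4; have d0 : 0 < d by rewrite divr_gt0 // exprn_gt0.
  pose Kn := (Num.truncn (La / d)).+1.
  pose f (i : 'I_M) : 'I_Kn := inord (Num.truncn (nsq (b i *m Q) / d)).
  have fle i : (Num.truncn (nsq (b i *m Q) / d) < Kn)%N.
    by rewrite ltnS le_truncn // ler_pM2r ?invr_gt0.
  have := @fiber_pigeonhole _ _ [set: 'I_M]%SET f; rewrite cardsT !card_ord => /(_ M0)[u1 hP1].
  set P1 := [set i in _ | _] in hP1.
  have P10 : (0 < #|P1|)%N by move: (leq_trans M0 hP1); rewrite muln_gt0 => /andP[].
  have shell i j : i \in P1 -> j \in P1 -> nsq (b j *m Q) - nsq (b i *m Q) <= d.
    rewrite !inE => /eqP fi /eqP fj.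
    have : Num.truncn (nsq (b i *m Q) / d) = Num.truncn (nsq (b j *m Q) / d).
      by rewrite -(inordK (fle i)) -(inordK (fle j)) -/(f i) -/(f j) fi fj.
    have /andP[a1 a2] := truncn_itv (divr_ge0 (nsq_ge0 (b i *m Q)) (ltW d0)).
    have /andP[c1 c2] := truncn_itv (divr_ge0 (nsq_ge0 (b j *m Q)) (ltW d0)).
    move=> eT; rewrite -eT in c2; move: a1 c2; rewrite -natr1 ler_pdivlMr // ltr_pdivrMr //.
    by lra.
  have [L1 [y1 hy1] hL1] := cK; have [L2 [y2 hy2] hL2] := cL.
  have /choice[f1 hf1] : forall i, exists v, gauge K (x i - y1 v) <= t.
    by move=> i; apply: hy1; have := xE i 1; rewrite scale1r; apply; rewrite ler01 lexx.
  have /choice[f2 hf2] : forall i, exists v, supp B (b i - y2 v) <= t.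
    by move=> i; apply: hy2; exact: bD.
  have [v1] := @fiber_pigeonhole _ _ P1 f1 P10; rewrite card_ord; set P2 := [set i in _ | _] => hP2.
  have P20 : (0 < #|P2|)%N by move: (leq_trans P10 hP2); rewrite muln_gt0 => /andP[].
  have [v2] := @fiber_pigeonhole _ _ P2 f2 P20; rewrite card_ord; set P3 := [set i in _ | _] => hP3.
  have P32 i : i \in P3 -> i \in P2 /\ f2 i = v2 by rewrite inE => /andP[? /eqP].
  have P21 i : i \in P2 -> i \in P1 /\ f1 i = v1 by rewrite inE => /andP[? /eqP].
  exists #|P3|.
    apply: (@twosided_sepsys _ _ _ _ _ _ x b (y1 v1) (y2 v2)) => //.
    - by move=> i /P32[/P21[_ <-] _]; exact: hf1.
    - by move=> i /P32[_ <-]; exact: hf2.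
    - move=> i j iP jP ij.
      have iP1 := (P21 _ (P32 _ iP).1).1; have jP1 := (P21 _ (P32 _ jP).1).1.
      rewrite /x -!mulmxBl dotx.
      have := bsep _ _ ij; rewrite /= => /negP; rewrite -ltNge mulmxBl => sep.
      have := shell _ _ iP1 jP1; rewrite /d w2 in sep *.
      by move: sep; rewrite nsqB dotBr -nsqE; lra.
  have hKn : Kn%:R <= expR (k / 50) * La.
    have /andP[a1 _] := truncn_itv (divr_ge0 (ltW (lt_le_trans ltr01 La1)) (ltW d0)).
    rewrite /Kn -natr1; apply: (@le_trans _ _ (16 * s * La)); last first.
      by rewrite ler_pM2r // (lt_le_trans ltr01 La1).
    have e1 : La / d = 8 * s * La by rewrite /d w2; field; rewrite gt_eqF.
    apply: (@le_trans _ _ (8 * s * La + 1)); first by rewrite lerD2r -e1.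
    have sLa : 1 <= s * La by rewrite -[1]mulr1; apply: ler_pM => //; lra.
    lra.
  have main : expR (k / 10) <= Kn%:R * (L1%:R * (L2%:R * #|P3|%:R)).
    apply: le_trans hM _; rewrite -!natrM ler_nat.
    apply: leq_trans hP1 _; rewrite leq_mul2l; apply/orP; right.
    by apply: leq_trans hP2 _; rewrite leq_mul2l hP3 orbT.
  have up : Kn%:R * (L1%:R * (L2%:R * #|P3|%:R)) <=
     (expR (k / 50) * La) * (expR (k / 100) * (expR (k / 100) * #|P3|%:R)).
    have ee : expR e <= expR (k / 100) by rewrite ler_expR; have := ek; lra.
    apply: ler_pM; rewrite ?mulr_ge0 //.
    apply: ler_pM; rewrite ?mulr_ge0 //; first exact: le_trans ee.
    by apply: ler_wpM2r; rewrite // (le_trans hL2).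
  have := le_trans main up.
  (* Budget: the shells take k/50 + k/20, the two coverings k/100 each, and k/100 remains. *)
  have -> : k / 10 = (k / 50 + k / 20) + (k / 100 + (k / 100 + k / 100)) by field.
  rewrite 4!expRD -/La ler_pM2l ?mulr_gt0 ?expR_gt0 //.
  by rewrite !ler_pM2l ?expR_gt0.
pose E1 := expR (k / 100); have E11 : 1 <= E1.
  by rewrite -[leLHS]expR0 ler_expR; have := k0; lra.
have E10 : 0 < E1 by exact: expR_gt0.
have eE : expR e <= E1 by rewrite ler_expR; have := ek; lra.
have LaE : La = E1 ^+ 5 by rewrite -expRM_natl; congr expR; field.
(* Dividing x_i and b_i by D puts them into K and B°; the pairing is still at least E1^5 / D^2, of
   order E1^3 / t^2, enough for about E1 points on the segment. *)
pose D := 2 * t * expR e; have D0 : 0 < D by rewrite !mulr_gt0 ?expR_gt0.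
have hx : gauge K (x i) <= D by apply: (cove_segment gsK t0 (xE i) cK).
have hb : supp B (b i) <= D.
  apply: (cove_segment ssB t0 _ cL) => c /andP[c0 c1]; rewrite /eball /= nsqZ.
  apply: ler_pM; rewrite ?sqr_ge0 ?nsq_ge0 //; first by rewrite expr_le1.
  by have := bD i; rewrite /eball /= expr1n.
exists (Num.truncn E1).+1; last first.
  by apply: ltW; have /andP[] := truncn_itv (ltW E10).
apply: (@sepsys_line _ _ _ _ (D^-1 *: b i) (D^-1 *: x i)) => //.
- by apply/(gauge_le _ bK D0).
- by apply/(supp_le1 _ bB); rewrite ssB.2 gtr0_norm ?invr_gt0 // mulrC ler_pdivrMr // mul1r.
- by rewrite !mulr_ge0 ?invr_ge0 ?sqr_ge0 // mulr_ge0 // ltW.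
rewrite dotZl dotZr dotx -nsqE mulrA -expr2 exprVn mulrC [leRHS]mulrC ler_pdivlMr ?exprn_gt0 //.
apply: le_trans (ltW hi); rewrite LaE.
have N2 : (Num.truncn E1).+1%:R <= 2 * E1.
  by have /andP[] := truncn_itv (ltW E10); rewrite -natr1; lra.
have D2 : D ^+ 2 <= 4 * t ^+ 2 * E1 ^+ 2.
  rewrite /D !exprMn -natrX ler_pM2l ?mulr_gt0 ?exprn_gt0 //.
  by apply: lerXn2r; rewrite ?nnegrE ?expR_ge0 // ltW.
have c0 : 0 <= 3 / 8 / (2 * s) / t ^+ 2.
  by rewrite !mulr_ge0 ?invr_ge0 ?sqr_ge0 // mulr_ge0 // ltW.
apply: (@le_trans _ _ (2 * E1 * (3 / 8 / (2 * s) / t ^+ 2) * (4 * t ^+ 2 * E1 ^+ 2))).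
  by apply: ler_pM => //; [exact: mulr_ge0 | exact: sqr_ge0 | exact: ler_wpM2r].
have -> : 2 * E1 * (3 / 8 / (2 * s) / t ^+ 2) * (4 * t ^+ 2 * E1 ^+ 2) = 3 / 2 / s * E1 ^+ 3.
  by field; rewrite !gt_eqF.
have -> : E1 ^+ 5 = E1 ^+ 2 * E1 ^+ 3 by ring.
apply: ler_wpM2r; first by rewrite exprn_ge0 // ltW.
apply: (@le_trans _ _ 1); last by rewrite exprn_ege1.
by rewrite ler_pdivrMr // mul1r; lra.
Qed.

End Core.

(** * Assembly and passage to packing numbers *)

Section Final.
Variable R : realType.

Lemma sepsys_le n (K B : set 'rV[R]_n) (d d' : R) N : d <= d' -> sepsys K B d' N -> sepsys K B d N.
Proof.
by move=> dd [x [h [h1 h2 h3]]]; exists x, h; split=> // i j ij; apply: le_trans (h3 _ _ ij).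
Qed.

Lemma sepsys_lin n (K B : set 'rV[R]_n) (g : 'M[R]_n) (d : R) N : g \in unitmx ->
  sepsys [set a | K (a *m invmx g)] [set a | B (a *m invmx g)] d N -> sepsys K B d N.
Proof.
move=> gu [x [h [hx hh hd]]].
exists (fun i => x i *m invmx g), (fun i => h i *m g^T); split=> [//|j b Bb|i j ij].
  by rewrite dot_mulmx trmxK; apply: hh => /=; rewrite mulmxK.
by rewrite -mulmxBl dot_mulmx trmxK mulmxKV //; exact: hd.
Qed.

(** For k at least k0, the regular ellipsoid of B is mapped to the unit ball, one is chosen for the
    image of K, and [core_sepsys] applies. For smaller k only a bounded number m of points is
    required, and a segment provides them. *)
Lemma sepsys_of_sepn (eps : R) : 0 < eps -> exists2 d, 0 < d &
  forall n (K B : set 'rV[R]_n) N k, (0 < n)%N -> body K -> body B -> 0 < k ->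
    expR k <= N%:R -> sepn K B N -> 100 * (n%:R * eps) <= k ->
    exists2 N', sepsys K B d N' & expR (k / 100) <= N'%:R.
Proof.
move=> eps0; have [t t1 reg] := regular_ellipsoid eps0.
have t0 : 0 < t by lra.
pose s := 2 * (64 * (2 * t)) * t; have s0 : 0 < s by rewrite /s !mulr_gt0.
pose k0 := 50 * ln (16 * s).
pose m := (Num.truncn (expR k0)).+1.
pose d1 := 3 / 8 * (2 * s)^-1 / t ^+ 2; pose d2 : R := (2 * m%:R)^-1.
have d10 : 0 < d1 by rewrite !mulr_gt0 ?invr_gt0 ?exprn_gt0 // mulr_gt0.
have d20 : 0 < d2 by rewrite invr_gt0 mulr_gt0.
exists (Num.min d1 d2); first by rewrite lt_min d10.
move=> n K B N k n0 bK bB kp Nk sKB ek.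
have [kk|kk] := lerP k0 k.
  have [g gu [c1 c2]] := reg n B n0 bB.
  have igu : invmx g \in unitmx by rewrite unitmx_inv.
  pose K' := [set a | K (a *m invmx g)]; pose B' := [set a | B (a *m invmx g)].
  have bK' : body K' by exact: lin_body.
  have bB' : body B' by exact: lin_body.
  have [g2 g2u [c3 c4]] := reg n K' n0 bK'.
  have e0 : 0 <= n%:R * eps by rewrite mulr_ge0 // ltW.
  have cB' : cove (eball 1) [set x | gauge B' x <= t] (n%:R * eps).
    apply: (cove_lin igu _ _ c1) => x /=.
      by rewrite /eball /ell /= mulmxKV // expr1n.
    by move=> /(gauge_le _ bB t0) h; apply/(gauge_le _ bB' t0); rewrite /B' /= -scalemxAl.
  have cL' : cove (eball 1) [set x | supp B' x <= t] (n%:R * eps).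
    apply: (@cove_lin _ _ _ _ _ _ g^T _ _ _ _ c2) => [|x|x /= h]; first by rewrite unitmx_tr.
      by rewrite /eball /ell /= -mulmxA -trmx_mul mulVmx // trmx1 mulmx1 expr1n.
    apply: supp_le => // a Ba; apply: le_trans h.
    have -> : dot x a = dot (x *m g^T) (a *m invmx g) by rewrite dot_mulmx trmxK mulmxKV.
    exact: le_supp.
  have sKB' : sepn K' B' N.
    have [x [h1 h2]] := sKB; exists (fun i => x i *m g); split=> [i|i j ij].
      by rewrite /K' /= mulmxK.
    by rewrite -mulmxBl /B' /= mulmxK //; exact: h2.
  have hk : 16 * s <= expR (k / 50).
    rewrite -[leLHS]lnK ?posrE ?mulr_gt0 // ler_expR; move: kk; rewrite /k0; lra.
  have [N' h1 h2] := core_sepsys bK' bB' g2u t1 cB' cL' c3 c4 sKB' Nk kp ek hk.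
  exists N' => //; apply: (sepsys_lin gu); apply: sepsys_le h1.
  by rewrite ge_min lexx.
exists m; last first.
  apply: (@le_trans _ _ (expR k0)); first by rewrite ler_expR; lra.
  by apply: ltW; have /andP[] := truncn_itv (expR_ge0 k0).
have N2 : (1 < N)%N.
  by rewrite -(ltr_nat R); apply: lt_le_trans Nk; rewrite -expR0 ltr_expR.
have [x [xK xsep]] := sKB.
pose i0 : 'I_N := Ordinal (ltnW N2); pose i1 : 'I_N := Ordinal N2.
have i01 : i0 != i1 by [].
(* The norming functional of a difference outside B exceeds 1 there, so it is at least 1/2 at x_0 or
   at -x_1, both in K. *)
have [h hB hE] := supp_attained (x i0 - x i1) (polar_body bB).
have h1 : 1 < dot h (x i0) + dot h (- x i1).
  rewrite -dotDr dotC -hE ltNge; apply/negP => /(gauge_le1 _ bB); exact: xsep.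
have [y Ky hy] : exists2 y, K y & 1 / 2 <= dot h y.
  have [h2|h2] := lerP (1 / 2) (dot h (x i0)); first by exists (x i0).
  exists (- x i1); last by lra.
  by have [_ _ sy _] := bK; exact: sy.
apply: (@sepsys_le _ _ _ _ d2); first by rewrite ge_min lexx orbT.
apply: (sepsys_line bK Ky hB); first exact: ltW.
by rewrite /d2 invfM mulfVK ?pnatr_eq0 // -[_^-1]mul1r.
Qed.

(** If x0 is interior, a small x is the midpoint of x0 + 2x and -x0. *)
Lemma convex_body_body n (B : set 'rV[R]_n) :
  convex_body B -> origin_symmetric B -> body B.
Proof.
move=> [cv [cB [x0 ix0]]] sy; split=> //.
have [e /= e0 he] := (nbhs_ballP _ _).1 ix0.
exists (e / 4) => [|x hx]; first by rewrite divr_gt0.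
have Bx0 : B x0 by exact: nbhs_singleton.
have h1 : B (x0 + 2 *: x).
  apply: he; rewrite -ball_normE /ball_ /= opprD addrA subrr sub0r normrN.
  apply: le_lt_trans (_ : e / 2 < e); last by lra.
  apply: normr_le_nsq; first by rewrite divr_ge0 // ltW.
  by rewrite nsqZ; lra.
have half01 : 0 <= (1 / 2 : R) <= 1 by lra.
have := cv _ _ _ h1 (sy _ Bx0) half01; congr B.
by apply/rowP => i; rewrite !mxE; field.
Qed.

(** If x_i - x_j were in B, the midpoint of x_i and x_j would be interior to both translates. *)
Lemma packable_sepn n (K B : set 'rV[R]_n) N : body B -> packable K B N -> sepn K B N.
Proof.
move=> bB [x [xK xB]]; exists x; split=> // i j ij Bb.
have [_ cv sy [r r0 hr]] := bB.
have key a b : B b -> interior (translate a B) (a + (1 / 2) *: b).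
  move=> {Bb}Bb; have r20 : 0 < r / 2 by rewrite divr_gt0.
  apply: filterS (nbhs_nsq (a + (1 / 2) *: b) r20) => y /= hy.
  exists (y - a); last by rewrite addrC subrK.
  have h2 : B (2 *: (y - (a + (1 / 2) *: b))).
    by apply: hr; rewrite nsqZ -nsqN opprB; lra.
  have half01 : 0 <= (1 / 2 : R) <= 1 by lra.
  have := cv _ _ _ Bb h2 half01; congr B.
  by apply/rowP => l; rewrite !mxE; field.
have h1 := key (x j) _ Bb; have h2 := key (x i) _ (sy _ Bb).
have e : x j + (1 / 2) *: (x i - x j) = x i + (1 / 2) *: (- (x i - x j)).
  by apply/rowP => l; rewrite !mxE; field.
have hin : (interior (translate (x i) B) `&` interior (translate (x j) B))
   (x i + (1 / 2) *: (- (x i - x j))) by split=> //; rewrite -e.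
by rewrite xB in hin.
Qed.

(** Convexly separated points are in particular separated by a small ball. The bound is what makes
    the supremum defining the convex separation number meaningful. *)
Lemma convex_separable_bounded n (K B : set 'rV[R]_n) a : body K -> body B -> 0 < a ->
  exists M, forall N, convex_separable K (dilate a B) N -> (N <= M)%N.
Proof.
move=> bK bB a0; have [rK _ hrK] := body_bounded bK.
have [_ _ _ [r r0 hr]] := bB.
pose s := a * r / 2; have s0 : 0 < s by rewrite divr_gt0 // mulr_gt0.
have hin x : nsq x <= s ^+ 2 -> interior (dilate a B) x.
  move=> hx; apply: filterS (nbhs_nsq x s0) => y /= hy.
  exists (a^-1 *: y); last by rewrite scalerA mulfV ?scale1r // gt_eqF.
  apply: hr; rewrite nsqZ exprVn mulrC ler_pdivrMr ?exprn_gt0 // -exprMn mulrC.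
  have -> : a * r = s + s by rewrite /s; field.
  have -> : y = x + (- (x - y)) by rewrite opprB addrC subrK.
  by apply: nsqD_le; rewrite ?nsqN // ltW.
have [M hM] := @sepn_finite _ _ K (eball s) rK s hrK s0 (fun x h => h).
exists M => N [x [xK xsep]]; apply: hM; exists x; split=> //.
have key (i j : 'I_N) : (i < j)%N -> ~ eball s (x i - x j).
  move=> ij hs; have hin2 : (translate (x j) (interior (dilate a B)) `&`
    Defs.conv [set x i | i in [set i : 'I_N | (i < j)%N]]) (x i).
    split; first by exists (x i - x j); [exact: hin | rewrite addrC subrK].
    exists 1%N, (fun=> 1), (fun=> x i); split=> //; split; first by rewrite big_ord1.
    by split; [move=> _; exists i | rewrite big_ord1 scale1r].
  by rewrite xsep in hin2.
move=> i j; rewrite neq_ltn => /orP[ij|ij]; first exact: key.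
by move=> h; apply: (key _ _ ij); rewrite /eball /= -nsqN opprB.
Qed.

Lemma packable_dim0 (K B : set 'rV[R]_0) N : interior B !=set0 -> packable K B N -> (N <= 1)%N.
Proof.
move=> [b ib] [x [_ xB]]; rewrite leqNgt; apply/negP => N1.
have := xB (Ordinal (ltnW N1)) (Ordinal N1) isT.
have e z : translate z B = B.
  apply/seteqP; split=> [_ [y By <-]|y By]; first by rewrite (thinmx0 z) add0r.
  by exists y => //; rewrite (thinmx0 z) add0r.
by rewrite !e setIid => h; rewrite h in ib.
Qed.

End Final.

Theorem theorem5 (R : realType) :
  exists beta : R, 1 <= beta /\
  forall gamma : R, 0 < gamma ->
  exists alpha : R, 1 <= alpha /\
  forall (n : nat) (K B : set 'rV[R]_n),
    convex_body K -> convex_body B ->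
    origin_symmetric K -> origin_symmetric B ->
    gamma * n%:R <= log2 (packing_number K B) ->
    beta^-1 * log2 (packing_number K B)
      <= log2 (convex_separation_number K (dilate alpha^-1 B)).
Proof.
exists 100; split; first by lra.
move=> gamma gamma0; have ln20 : 0 < ln 2 :> R by rewrite ln_gt0 //; lra.
(* With this eps, 100 n eps = gamma n ln 2, which the hypothesis bounds by ln M(K,B). *)
have eps0 : 0 < gamma * ln 2 / 100 by rewrite divr_gt0 // mulr_gt0.
have [d d0 main] := sepsys_of_sepn eps0.
have a0 : 0 < d^-1 + 1 by rewrite addr_gt0 // invr_gt0.
exists (d^-1 + 1); split; first by rewrite lerDr invr_ge0 ltW.
set a := d^-1 + 1 in a0 *.
have ad : a^-1 < d by rewrite -[d]invrK ltf_pV2 ?posrE ?invr_gt0 // ltrDl.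
move=> n K B cK cB sK sB hyp.
have bK := convex_body_body cK sK; have bB := convex_body_body cB sB.
have ai0 : 0 < a^-1 by rewrite invr_gt0.
have [M hM] := convex_separable_bounded bK bB ai0.
set S := [set (N%:R : R) | N in convex_separable K (dilate a^-1 B)].
have ubS : has_ubound S by exists M%:R => _ [N /hM h <-]; rewrite ler_nat.
have hat1 : 1 <= convex_separation_number K (dilate a^-1 B).
  apply: ub_le_sup => //; exists 1%N => //.
  exists (fun=> 0); split; first by move=> _; exact: body0.
  move=> j; rewrite -subset0 => z [_ [m [l [y [_ [l1 [hy _]]]]]]].
  case: m l y l1 hy => [|m] l y l1 hy; first by rewrite big_ord0 in l1; have := oner_eq0 R; rewrite l1 eqxx.
  by have [i /= + _] := hy ord0; rewrite !ord1.
have log_hat : 0 <= log2 (convex_separation_number K (dilate a^-1 B)).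
  by rewrite divr_ge0 ?(ltW ln20) // ln_ge0.
have [low|high] := lerP (log2 (packing_number K B)) 0.
  by apply: le_trans log_hat; rewrite mulr_ge0_le0 // invr_ge0.
set P := packing_number K B in hyp high *.
have lnP : 0 < ln P by move: high; rewrite /log2 pmulr_lgt0 // invr_gt0.
have P1 : 1 < P.
  rewrite ltNge; apply/negP => le1; move: lnP; rewrite ltNge => /negP; apply.
  exact: ln_le0.
(* [sup] takes the value 0 on a set without supremum, which P > 1 excludes. *)
have hs : has_sup [set (N%:R : R) | N in packable K B].
  apply: contrapT => /sup_out h; move: P1; rewrite /P /packing_number h; lra.
(* The set consists of integers, so an element within 1/2 of the supremum attains it. *)
have [_ [N pN <-] hN] := @sup_adherent _ _ (1 / 2) ltac:(lra) hs.
have PN : P <= N%:R.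
  apply: ge_sup; first exact: hs.1.
  move=> _ [N' pN' <-]; rewrite ler_nat -ltnS -(ltr_nat R) -natr1.
  have : N'%:R <= P by apply: ub_le_sup; [exact: hs.2 | exists N'].
  by move: hN; rewrite -/(packing_number K B) -/P; lra.
have n0 : (0 < n)%N.
  case: (posnP n) => // n_0; subst n.
  have := packable_dim0 cB.2.2 pN; rewrite -(ler_nat R) => N1.
  by have := lt_le_trans P1 (le_trans PN N1); rewrite ltxx.
have Pk : expR (ln P) <= N%:R by rewrite lnK // posrE; lra.
have ek : 100 * (n%:R * (gamma * ln 2 / 100)) <= ln P.
  move: hyp; rewrite /log2 ler_pdivlMr //; lra.
have [N' h1 h2] := main n K B N (ln P) n0 bK bB lnP Pk (packable_sepn bB pN) ek.
have sepN' := sepsys_separable sB a0 ad h1.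
have hat2 : expR (ln P / 100) <= convex_separation_number K (dilate a^-1 B).
  by apply: le_trans h2 _; apply: ub_le_sup => //; exists N'.
have hat0 : 0 < convex_separation_number K (dilate a^-1 B) by lra.
rewrite /log2 mulrA ler_pM2r ?invr_gt0 // mulrC -[leLHS]expRK ler_ln ?posrE ?expR_gt0 //.
Qed.
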